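(* Let $\mathbb{K}$ be a field of characteristic zero that is finitely generated (as a field) over $\mathbb{Q}$, let $\mathbb{F}$ be an algebraic closure of $\mathbb{K}$, and let $\mathcal{C}\subseteq\mathbb{F}^N$ be a rational curve such that $\mathbb{K}$ is a field of definition of $\mathcal{C}$. If $\mathcal{C}$ is not parametrizable over $\mathbb{K}$, then $\mathcal{C}$ has infinitely many distinct fields of parametrization that are quadratic extensions of $\mathbb{K}$. In particular, if $\mathcal{C}$ is not parametrizable over its minimum field of definition $k$, then there are infinitely many minimal fields of parametrization of $\mathcal{C}$ that are quadratic over $k$.
   Context: Let $P\subset\mathbb{F}[x_1,\dots,x_N]$ be the prime ideal of the irreducible curve $\mathcal{C}$. A subfield $\mathbb{L}\subseteq\mathbb{F}$ is a field of definition of $\mathcal{C}$ if $P$ has a set of generators with coefficients in $\mathbb{L}$ (equivalently, $\mathcal{C}$ is the zero set in $\mathbb{F}^N$ of an ideal of $\mathbb{L}[x_1,\dots,x_N]$). There is a smallest field of definition $k$ with respect to inclusion (the minimum field of definition), and it is finitely generated over $\mathbb{Q}$. For a prime ideal $P$ write $\mathbb{F}(P)$ for the fraction field of $\mathbb{F}[x_1,\dots,x_N]/P$ and $\mathbb{L}(P)$ for the fraction field of $\mathbb{L}[x_1,\dots,x_N]/(P\cap\mathbb{L}[x_1,\dots,x_N])$, viewed as a subfield of $\mathbb{F}(P)$. The curve is rational if $\mathbb{F}(P)\cong\mathbb{F}(t)$ over $\mathbb{F}$. The field $\mathbb{L}$ is a field of parametrization of $\mathcal{C}$ (equivalently, $\mathcal{C}$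 is parametrizable over $\mathbb{L}$) if there is a field isomorphism $\varphi:\mathbb{F}(P)\to\mathbb{F}(t)$, identity on $\mathbb{F}$, with $\varphi([x_i])\in\mathbb{L}(t)$ for all $i$ and $\varphi^{-1}(t)\in\mathbb{L}(P)$. Minimal fields of parametrization are minimal with respect to inclusion. Quadratic extensions are taken inside $\mathbb{F}$. *)

(* Defs.v *)
From HB Require Import structures.
From mathcomp Require Export all_boot all_order all_algebra.
From mathcomp Require Export ring_quotient fraction.
From mathcomp Require Export boolp classical_sets functions cardinality.
From mathcomp Require Export mpoly.

Set Implicit Arguments.
Unset Strict Implicit.
Unset Printing Implicit Defensive.

Import GRing.Theory.
#[local] Open Scope ring_scope.
#[local] Open Scope classical_set_scope.
#[local] Open Scope quotient_scope.

Notation "x %:F" := (FracField.tofrac x) (at level 1) : ring_scope.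

Section Subfields.
Variable F : fieldType.
Implicit Types K L : set F.

Definition is_subfield L : Prop := divring_closed (mem L).

Definition generated_subfield (s : seq F) : set F :=
  [set x | forall L, is_subfield L -> {subset s <= (mem L)} -> L x].

(* In characteristic zero every subfield contains the prime field Q. *)
Definition finitely_generated_over_Q K : Prop :=
  exists s : seq F, K = generated_subfield s.

Definition algebraic_over K (x : F) : Prop :=
  exists p : {poly F}, [/\ p \is a polyOver (mem K), p != 0 & root p x].

Definition has_degree K L (n : nat) : Prop :=
  exists e : 'I_n -> F,
    [/\ forall i, L (e i),
        forall x, L x ->
          exists c : 'I_n -> F, (forall i, K (c i)) /\ x = \sum_i c i * e i
      & forall c : 'I_n -> F, (forall i, K (c i)) ->
          \sum_i c i * e i = 0 -> forall i, c i = 0].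

Definition quadratic_extension K L : Prop :=
  [/\ is_subfield L, K `<=` L & has_degree K L 2].

End Subfields.

Section AlgebraicSets.
Variables (F : fieldType) (N : nat).
Implicit Types (A B C : set ('I_N -> F)) (p : {mpoly F[N]}).

Definition zero_locus (S : set {mpoly F[N]}) : set ('I_N -> F) :=
  [set v | forall p, S p -> p.@[v] = 0].

Definition algebraic_set C : Prop := exists S, C = zero_locus S.

Definition irreducible_set C : Prop :=
  [/\ algebraic_set C, C !=set0
    & forall A B, algebraic_set A -> algebraic_set B ->
        C `<=` A `|` B -> C `<=` A \/ C `<=` B].

(* There is a chain Z_0 < ... < Z_d of irreducible closed subsets of C. *)
Definition dim_geq C (d : nat) : Prop :=
  exists Z : nat -> set ('I_N -> F),
    (forall i, (i <= d)%N -> irreducible_set (Z i) /\ Z i `<=` C) /\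
    (forall i, (i < d)%N -> Z i `<` Z i.+1).

Definition has_dim C (d : nat) : Prop := dim_geq C d /\ ~ dim_geq C d.+1.

Record irreducible_curve := IrreducibleCurve {
  curve_points :> set ('I_N -> F);
  curve_irreducible : irreducible_set curve_points;
  curve_dim : has_dim curve_points 1
}.

Definition generated_ideal (G : set {mpoly F[N]}) : set {mpoly F[N]} :=
  [set p | exists (n : nat) (c g : 'I_n -> {mpoly F[N]}),
     (forall i, G (g i)) /\ p = \sum_i c i * g i].

End AlgebraicSets.

Section PrimeIdeal.
Variables (F : fieldType) (N : nat) (C : irreducible_curve F N).

Definition curve_ideal : {pred {mpoly F[N]}} :=
  fun p => `[< forall v, (C : set _) v -> p.@[v] = 0 >].

Lemma curve_idealP p :
  reflect (forall v, (C : set _) v -> p.@[v] = 0) (p \in curve_ideal).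
Proof. exact: asboolP. Qed.

Lemma curve_ideal_closed : idealr_closed curve_ideal.
Proof.
split.
- by apply/curve_idealP => v _; rewrite meval0.
- apply/negP => /curve_idealP h1.
  have [_ [v Cv] _] := curve_irreducible C.
  by have /eqP := h1 v Cv; rewrite meval1 oner_eq0.
- move=> a p q /curve_idealP hp /curve_idealP hq; apply/curve_idealP => v Cv.
  by rewrite mevalD mevalM hp // hq // mulr0 addr0.
Qed.

Lemma curve_ideal_prime : prime_idealr_closed curve_ideal.
Proof.
move=> p q /curve_idealP hpq.
have [_ _ irrC] := curve_irreducible C.
have alg (r : {mpoly F[N]}) : algebraic_set (zero_locus [set r]).
  by exists [set r].
have sub : (C : set _) `<=` zero_locus [set p] `|` zero_locus [set q].
  move=> v Cv; have /eqP := hpq v Cv.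
  by rewrite mevalM mulf_eq0 => /orP[]/eqP h; [left|right] => _ ->.
have [hC|hC] := irrC _ _ (alg p) (alg q) sub.
- by apply/orP; left; apply/curve_idealP => v /hC; apply.
- by apply/orP; right; apply/curve_idealP => v /hC; apply.
Qed.

HB.instance Definition _ :=
  isIdealr.Build {mpoly F[N]} curve_ideal curve_ideal_closed.
HB.instance Definition _ :=
  isPrimeIdealrClosed.Build {mpoly F[N]} curve_ideal curve_ideal_prime.

Definition coordinate_ring := {ideal_quot curve_ideal}.

HB.instance Definition _ := GRing.ComNzRing.on coordinate_ring.

(* [fraction] requires an integral domain in the library's sense, that is with
   explicit units and inverses; both are provided by classical choice. *)
Definition coord_unit : pred coordinate_ring :=
  fun x => `[< exists y, y * x = 1 >].

Definition coord_inv (x : coordinate_ring) : coordinate_ring :=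
  xget x [set y | y * x = 1].

Lemma coord_mulVr : {in coord_unit, left_inverse 1 coord_inv *%R}.
Proof. by move=> x /asboolP[y yx]; rewrite /coord_inv; case: xgetP => // /(_ y). Qed.

Lemma coord_unitP (x y : coordinate_ring) : y * x = 1 -> coord_unit x.
Proof. by move=> yx; apply/asboolP; exists y. Qed.

Lemma coord_inv_out : {in [predC coord_unit], coord_inv =1 id}.
Proof.
move=> x /negP nx; rewrite /coord_inv; case: xgetP => // y _ yx.
by case: nx; apply: (coord_unitP yx).
Qed.

HB.instance Definition _ := GRing.ComNzRing_hasMulInverse.Build
  coordinate_ring coord_mulVr coord_unitP coord_inv_out.

Lemma coord_integral (x y : coordinate_ring) :
  x * y = 0 -> (x == 0) || (y == 0).
Proof. exact: Quotient.rquot_IdomainAxiom. Qed.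

HB.instance Definition _ :=
  GRing.ComUnitRing_isIntegral.Build coordinate_ring coord_integral.

Definition function_field := {fraction coordinate_ring}.
HB.instance Definition _ := GRing.Field.on function_field.

Definition curve_fun (p : {mpoly F[N]}) : function_field :=
  (\pi_{ideal_quot curve_ideal} p : coordinate_ring)%:F.

Definition function_subfield (L : set F) : set function_field :=
  [set z | exists p q : {mpoly F[N]},
     [/\ p \is a mpolyOver N (mem L), q \is a mpolyOver N (mem L),
         q \notin curve_ideal & z = curve_fun p / curve_fun q]].

End PrimeIdeal.

Arguments function_subfield {F N} C L _.

Section RationalFunctions.
Variable F : fieldType.

Definition ratfun := {fraction {poly F}}.
HB.instance Definition _ := GRing.Field.on ratfun.

Definition ratfunC (c : F) : ratfun := (c%:P)%:F.
Definition ratfunX : ratfun := ('X : {poly F})%:F.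

Definition ratfun_over (L : set F) : set ratfun :=
  [set z | exists p q : {poly F},
     [/\ p \is a polyOver (mem L), q \is a polyOver (mem L),
         q != 0 & z = p%:F / q%:F]].

End RationalFunctions.

Section Parametrization.
Variables (F : fieldType) (N : nat) (C : irreducible_curve F N).
Implicit Types (L k : set F).

Definition F_isomorphism
    (phi : {rmorphism function_field C -> ratfun F})
    (psi : ratfun F -> function_field C) : Prop :=
  [/\ cancel phi psi, cancel psi phi
    & forall c : F, phi (curve_fun C c%:MP) = ratfunC c].

Definition rational_curve : Prop := exists phi psi, F_isomorphism phi psi.

Definition is_field_of_definition L : Prop :=
  is_subfield L /\
  exists G : set {mpoly F[N]},
    (forall g, G g -> g \is a mpolyOver N (mem L)) /\
    [set` curve_ideal C] = generated_ideal G.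

Definition is_minimum_field_of_definition k : Prop :=
  is_field_of_definition k /\
  forall L, is_field_of_definition L -> k `<=` L.

Definition is_field_of_parametrization L : Prop :=
  is_subfield L /\
  exists phi psi,
    [/\ F_isomorphism phi psi,
        forall i : 'I_N, ratfun_over L (phi (curve_fun C 'X_i))
      & function_subfield C L (psi (ratfunX F))].

Definition is_minimal_field_of_parametrization L : Prop :=
  is_field_of_parametrization L /\
  forall L', is_field_of_parametrization L' -> L' `<=` L -> L' = L.

End Parametrization.

(* Main.v *)
Require Import Defs.
From HB Require Import structures.
From mathcomp Require Import ring.
From mathcomp Require Import polydiv vector falgebra fieldext separable mxpoly.

Set Implicit Arguments.
Unset Strict Implicit.
Unset Printing Implicit Defensive.

Import GRing.Theory Num.Theory.
#[local] Open Scope ring_scope.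
#[local] Open Scope classical_set_scope.
#[local] Open Scope quotient_scope.

(* Over an algebraic extension E of K the curve C has a parametrization t, by specializing
   the coefficients of any parametrization. The conjugates of t differ by Moebius
   transformations, so the vector fields (a + b t + c t^2) d/dt form a space defined over K:
   applied to a coordinate function they give a form of degree 2 over K on that space, that
   is a conic y^2 = al x^2 + ga with al, ga in K and x, y in K(C), birational to C. A point
   (m, s) of the conic, with m in K, provides the parametrization (y - s) / (x - m) of C over
   K(s), s^2 = al m^2 + ga.

   It remains to see that the square roots of al m^2 + ga do not all lie in a given finitely
   generated field L. Such an L is finite over a purely transcendental extension K0 of Q,
   and only finitely many square classes of K0(ga / al) become trivial in L. Taking norms
   down to K0, it suffices that the values at integers of a separable polynomial meet
   infinitely many square classes of K0; by specialization this reduces to Q, where a prime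
   divides some value exactly once. Hence no finite list of quadratic extensions suffices.

   For the minimality statement, a field of parametrization is a field of definition, so it
   contains k, and there is no field strictly between k and a quadratic extension of k. *)

(** * Fractions and the derivation of F(t) *)

(** The construction serves both [K] and the minimum field [k]. All that is known of [k] is that it
    defines the curve and lies in [K], so [F] may be transcendental over it; conjugation makes sense
    only for algebraic coefficients, which is why a parametrization is specialized before anything
    is conjugated. A parameter [t] cannot be averaged over its conjugates, being determined only up
    to Moebius transformations. The fields [a(t) d/dt] with [a] of degree at most 2 form a linear
    space preserved by these transformations, and linear spaces descend. The space has dimension 3;
    the six products of two basis elements are polynomials of degree at most 4, a space of dimension
    5, and the relation between them is the conic. Descent of a relation from [F] to [K] always goes
    through an additive functional [F -> K] that is linear over [K]. Applied to the coefficients of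
    a relation between elements of [K(X)] it gives a relation over [K], nontrivial as soon as the
    functional takes the value 1 at one coefficient. No basis of [F] over [K] and no Galois closure
    is involved. *)

Section FractionLift.
Variables (R : idomainType) (L : fieldType).

Lemma fracE (z : {fraction R}) :
  z = (frac (repr z)).1%:F / (frac (repr z)).2%:F.
Proof.
rewrite -{1}[z]reprK; case: (repr z) => -[n d] /= d0.
apply: (canRL (mulfK _)); first by rewrite tofrac_eq0.
rewrite /FracField.tofrac; unlock.
rewrite -[LHS](FracField.pi_mul (@mkRatio R (n, d) d0) (Ratio d 1)).
apply/eqmodP => /=; rewrite FracField.equivfE /FracField.mulf.
by rewrite !numden_Ratio ?mulf_neq0 ?oner_neq0 //= !mulr1 mulrC.
Qed.

Lemma frac_ex (z : {fraction R}) :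
  exists p q : R, q != 0 /\ z = p%:F / q%:F.
Proof.
exists (frac (repr z)).1, (frac (repr z)).2; split; last exact: fracE.
exact: denom_ratioP.
Qed.

Lemma frac_eq (p q p' q' : R) : q != 0 -> q' != 0 ->
  p%:F / q%:F = p'%:F / q'%:F -> p * q' = p' * q.
Proof.
move=> q0 q'0 /eqP; rewrite eqr_div ?tofrac_eq0 // -!tofracM tofrac_eq.
by move/eqP.
Qed.

Variables (f : {rmorphism R -> L}) (f_inj : forall x, f x = 0 -> x = 0).

Lemma rmorph_neq0 x : x != 0 -> f x != 0.
Proof. by apply: contraNneq => /f_inj ->. Qed.

(** The injectivity proof is an argument so that the term [frac_lift f_inj] determines the ring
    morphism structure declared on it below. *)
Definition frac_lift of (forall x, f x = 0 -> x = 0) := fun z : {fraction R} =>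
  f (frac (repr z)).1 / f (frac (repr z)).2.

Local Notation g := (frac_lift f_inj).

Lemma frac_liftE p q : q != 0 -> g (p%:F / q%:F) = f p / f q.
Proof.
move=> q0; rewrite /frac_lift; set z := (p%:F / q%:F).
have d0 : (frac (repr z)).2 != 0 by apply: denom_ratioP.
apply/eqP; rewrite eqr_div ?rmorph_neq0 // -!rmorphM; apply/eqP; congr (f _).
by apply: frac_eq => //; rewrite -fracE.
Qed.

Lemma frac_lift_tofrac p : g p%:F = f p.
Proof.
rewrite -[p%:F]divr1 -tofrac1 frac_liftE ?oner_neq0 //.
by rewrite rmorph1 divr1.
Qed.

Lemma frac_lift_zmod : zmod_morphism g.
Proof.
move=> x y; have [p [q [q0 ->]]] := frac_ex x; have [p' [q' [q'0 ->]]] := frac_ex y.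
rewrite -mulNr addf_div ?tofrac_eq0 // -tofracN -!tofracM -tofracD.
rewrite !frac_liftE ?mulf_neq0 // rmorphD !rmorphM rmorphN.
by rewrite -mulNr addf_div // rmorph_neq0.
Qed.

Lemma frac_lift_monoid : monoid_morphism g.
Proof.
split; first by rewrite -tofrac1 frac_lift_tofrac rmorph1.
move=> x y; have [p [q [q0 ->]]] := frac_ex x; have [p' [q' [q'0 ->]]] := frac_ex y.
by rewrite mulf_div -!tofracM !frac_liftE ?mulf_neq0 // !rmorphM mulf_div.
Qed.

HB.instance Definition _ :=
  GRing.isZmodMorphism.Build {fraction R} L g frac_lift_zmod.
HB.instance Definition _ :=
  GRing.isMonoidMorphism.Build {fraction R} L g frac_lift_monoid.

Lemma frac_lift_ex : exists g : {rmorphism {fraction R} -> L},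
  forall p, g p%:F = f p.
Proof. by exists g; exact: frac_lift_tofrac. Qed.

End FractionLift.

Notation "F '(t)'" := {fraction {poly F}} (at level 1, format "F '(t)'") : type_scope.

Lemma quot_rule (L : fieldType) (d x y e : L) : y != 0 ->
  d = ((d * y + x / y * e) * y - x * e) / y ^+ 2.
Proof. by move=> y0; field. Qed.

Lemma quot_chain (L : fieldType) (p p' q q' d : L) : q != 0 ->
  (p' * d * q - p * (q' * d)) / q ^+ 2 = (p' * q - p * q') / q ^+ 2 * d.
Proof. by move=> q0; field. Qed.

Lemma deriv_eq0_char0 (F : fieldType) (r : {poly F}) : [pchar F] =i pred0 ->
  r^`() = 0 -> (size r <= 1)%N.
Proof.
move=> ch0 r'; rewrite leqNgt; apply/negP => r1.
have : r^`()`_(size r).-2 = 0 by rewrite r' coef0.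
rewrite coef_deriv -[((size r).-2).+1]/_.
have -> : (size r).-2.+1 = (size r).-1 by case: (size r) r1 => [|[]].
move/eqP; rewrite -mulr_natr mulf_eq0 -lead_coefE lead_coef_eq0.
rewrite -size_poly_eq0; case: (size r) r1 => [|[|n]] //= _.
by move/pcharf0P: ch0 => ->.
Qed.

Section RationalFunctionField.
Variable F : fieldType.

Definition cst := (@FracField.tofrac {poly F} \o @polyC F).
HB.instance Definition _ := GRing.RMorphism.on cst.

Definition tF : F(t) := ('X : {poly F})%:F.

Lemma polyF (p : {poly F}) : p%:F = (map_poly cst p).[tF].
Proof.
elim/poly_ind: p => [|p c IH]; first by rewrite !rmorph0 horner0.
rewrite tofracD tofracM IH rmorphD rmorphM /= map_polyX map_polyC.
by rewrite hornerMXaddC.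
Qed.

(* The derivation d/dt. *)
Definition dF (z : F(t)) : F(t) :=
  let p := (frac (repr z)).1 in let q := (frac (repr z)).2 in
  (p^`() * q - p * q^`())%:F / (q ^+ 2)%:F.

(** Differentiating the relation [n * q = p * d] between two representatives [n / d] and [p / q]
    shows that the quotient rule gives the same value for both, so the choice made by [repr] is
    harmless. *)
Lemma dFE (p q : {poly F}) : q != 0 ->
  dF (p%:F / q%:F) = (p^`() * q - p * q^`())%:F / (q ^+ 2)%:F.
Proof.
move=> q0; rewrite /dF; set z := (p%:F / q%:F).
set n := (frac (repr z)).1; set d := (frac (repr z)).2.
have d0 : d != 0 by apply: denom_ratioP.
have e : n * q = p * d by apply: frac_eq => //; rewrite -fracE.
apply/eqP; rewrite eqr_div ?tofrac_eq0 ?expf_neq0 // -!tofracM tofrac_eq.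
apply/eqP; have e' := congr1 (@deriv F) e; rewrite !derivM in e'.
have -> : (n^`() * d - n * d^`()) * q ^+ 2 =
   d * q * (n^`() * q + n * q^`()) - q * d * n * q^`() - (n * q) * q * d^`() by ring.
rewrite e' e; ring: e.
Qed.

Lemma dFD x y : dF (x + y) = dF x + dF y.
Proof.
have [p [q [q0 ->]]] := frac_ex x; have [p' [q' [q'0 ->]]] := frac_ex y.
rewrite addf_div ?tofrac_eq0 // -!tofracM -tofracD !dFE ?mulf_neq0 //.
rewrite addf_div ?tofrac_eq0 ?expf_neq0 // -!tofracM -tofracD.
apply/eqP; rewrite eqr_div ?tofrac_eq0 ?mulf_neq0 ?expf_neq0 ?mulf_neq0 //.
by rewrite -!tofracM tofrac_eq !(derivD, derivM); apply/eqP; ring.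
Qed.

Lemma dFM x y : dF (x * y) = dF x * y + x * dF y.
Proof.
have [p [q [q0 ->]]] := frac_ex x; have [p' [q' [q'0 ->]]] := frac_ex y.
rewrite mulf_div -!tofracM !dFE ?mulf_neq0 // !mulf_div -!tofracM.
rewrite addf_div ?tofrac_eq0 ?mulf_neq0 ?expf_neq0 // -!tofracM -tofracD.
apply/eqP; rewrite eqr_div ?tofrac_eq0 ?mulf_neq0 ?expf_neq0 ?mulf_neq0 //.
by rewrite -!tofracM tofrac_eq !derivM; apply/eqP; ring.
Qed.

Lemma dF_poly (p : {poly F}) : dF p%:F = (p^`())%:F.
Proof.
rewrite -[p%:F]divr1 -tofrac1 dFE ?oner_neq0 //.
by rewrite -polyC1 derivC polyC1 mulr1 mulr0 subr0 expr1n tofrac1 divr1.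
Qed.

Lemma dF_cst c : dF (cst c) = 0.
Proof. by rewrite /cst /= dF_poly derivC rmorph0. Qed.

Lemma dF_t : dF tF = 1.
Proof. by rewrite /tF dF_poly derivX rmorph1. Qed.

Lemma dF_div x y : y != 0 -> dF (x / y) = (dF x * y - x * dF y) / y ^+ 2.
Proof.
move=> y0; have := dFM (x / y) y; rewrite divfK // => ->.
exact: quot_rule.
Qed.

Lemma coprime_frac_ex (z : F(t)) : exists p q : {poly F}, [/\ q != 0, coprimep p q & z = p%:F / q%:F].
Proof.
have [p [q [q0 ->]]] := frac_ex z.
have g0 : gcdp p q != 0 by rewrite gcdp_eq0 negb_and q0 orbT.
exists (p %/ gcdp p q), (q %/ gcdp p q); split.
- by rewrite dvdp_div_eq0 ?dvdp_gcdr.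
- by rewrite coprimep_div_gcd ?q0 ?orbT.
apply/eqP; rewrite eqr_div ?tofrac_eq0 ?dvdp_div_eq0 ?dvdp_gcdr //.
rewrite -!tofracM tofrac_eq; apply/eqP.
transitivity (p %/ gcdp p q * gcdp p q * (q %/ gcdp p q)).
  by rewrite divpK ?dvdp_gcdl.
by rewrite -mulrA [gcdp p q * _]mulrC divpK ?dvdp_gcdr.
Qed.

(** In lowest terms, [p' q = p q'] makes [q] divide its own derivative, which is shorter. Hence
    [q' = 0], then [p' = 0], and characteristic zero makes both constant. *)
Lemma dF_eq0 (z : F(t)) : [pchar F] =i pred0 -> dF z = 0 -> exists c, z = cst c.
Proof.
move=> ch0; have [p [q [q0 cop ->]]] := coprime_frac_ex z.
have ds0 := deriv_eq0_char0 ch0.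
rewrite dFE // => /eqP; rewrite mulf_eq0 invr_eq0 !tofrac_eq0 expf_eq0 /= (negPf q0).
rewrite orbF subr_eq0 => /eqP e.
have dq : q^`() = 0.
  apply/eqP; apply: contraT => q'0.
  have : q %| q^`() by rewrite -(Gauss_dvdpr _ (_ : coprimep q p)) -?e ?dvdp_mull // coprimep_sym.
  by move/dvdp_leq => /(_ q'0); rewrite leqNgt lt_size_deriv.
move: e; rewrite dq mulr0 => /eqP; rewrite mulf_eq0 (negPf q0) orbF => /eqP dp.
have [/size1_polyC -> /size1_polyC qc] := (ds0 _ dp, ds0 _ dq).
exists (p`_0 / q`_0); rewrite fmorph_div /cst /=.
by rewrite {1}qc.
Qed.

End RationalFunctionField.

Arguments tF {F}.

(** [tau] is only semilinear over [s], so that the rule covers automorphisms of [F(t)], with [s] the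
    identity, as well as changes of the coefficient field such as [mapF]. *)
Lemma dF_chain (F F' : fieldType) (s : {rmorphism F -> F'})
    (tau : {rmorphism F(t) -> F'(t)}) : (forall c, tau (cst c) = cst (s c)) ->
  forall z, dF (tau z) = tau (dF z) * dF (tau tF).
Proof.
move=> tau_c z.
have tau_p (p : {poly F}) : dF (tau p%:F) = tau (p^`())%:F * dF (tau tF).
  elim/poly_ind: p => [|p c IH].
    by rewrite derivC !rmorph0 mul0r -(rmorph0 (@cst F')) dF_cst.
  rewrite tofracD tofracM rmorphD rmorphM dFD dFM IH /= -/(cst c) tau_c dF_cst.
  rewrite addr0 derivMXaddC tofracD tofracM rmorphD rmorphM mulrDl.
  by rewrite -/tF addrC; congr (_ + _); rewrite mulrAC.
have [p [q [q0 ->]]] := frac_ex z.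
have tq : tau q%:F != 0 by rewrite fmorph_eq0 tofrac_eq0.
rewrite [tau (_ / _)]fmorph_div.
rewrite dF_div //.
rewrite (tau_p p) (tau_p q).
rewrite dFE //.
rewrite [in RHS]fmorph_div tofracXn rmorphXn.
rewrite tofracB !tofracM rmorphB.
rewrite [tau (_ * _)]rmorphM.
rewrite [tau (_ * _)]rmorphM.
apply: quot_chain.
exact: tq.
Qed.

(** * Automorphisms of F(t) *)

Lemma quot_moebius (L : fieldType) (a b c d : L) : b != 0 -> c != 0 -> d != 0 ->
  a / b / (d / (b * c)) = d^-1 * (a * c).
Proof. by move=> b0 c0 d0; field; rewrite b0 c0 d0. Qed.

Section Moebius.
Variable F : fieldType.

Definition homogenized d (f g p : {poly F}) :=
  \sum_(i < d.+1) p`_i *: (f ^+ i * g ^+ (d - i)).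

Lemma homogenizedE d (f g p : {poly F}) : g != 0 -> (size p <= d.+1)%N ->
  (map_poly (@cst F) p).[f%:F / g%:F] = (homogenized d f g p)%:F / (g ^+ d)%:F.
Proof.
move=> g0 sp; rewrite (@horner_coef_wide _ d.+1) ?size_map_poly //.
rewrite /homogenized rmorph_sum mulr_suml; apply: eq_bigr => i _ /=.
have id : (i <= d)%N by rewrite -ltnS.
rewrite coef_map /= -mul_polyC !tofracM -/(cst _) -[in RHS]mulrA.
congr (_ * _); apply: (canRL (mulfK _)); first by rewrite tofrac_eq0 expf_neq0.
have -> : g ^+ d = g ^+ (d - i) * g ^+ i by rewrite -exprD subnK.
rewrite expr_div_n tofracM !tofracXn.
by rewrite mulrCA mulrC divfK // expf_neq0 ?tofrac_eq0.
Qed.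

Lemma dvd_homogenized0 d (f g p : {poly F}) : f %| homogenized d f g p - p`_0 *: g ^+ d.
Proof.
rewrite /homogenized big_ord_recl expr0 mul1r subn0 addrAC subrr add0r.
apply: (big_ind (fun x => f %| x)) => [|x y|i _]; [exact: dvdp0|exact: dvdp_add|].
by rewrite -mul_polyC exprS -mulrA dvdp_mull // dvdp_mulr.
Qed.

Lemma dvd_homogenizedd d (f g p : {poly F}) : g %| homogenized d f g p - p`_d *: f ^+ d.
Proof.
rewrite /homogenized big_ord_recr /= subnn expr0 mulr1 addrK.
apply: (big_ind (fun x => g %| x)) => [|x y|i _]; [exact: dvdp0|exact: dvdp_add|].
have -> : (d - i = (d - i).-1.+1)%N by rewrite prednK // subn_gt0.
by rewrite -mul_polyC exprS dvdp_mull // dvdp_mull // dvdp_mulr.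
Qed.

Section Automorphism.
Variable tau : {rmorphism F(t) -> F(t)}.
Hypothesis tau_c : forall c, tau (cst c) = cst c.

Lemma tau_poly (p : {poly F}) : tau p%:F = (map_poly (@cst F) p).[tau tF].
Proof.
rewrite polyF -horner_map /= -map_poly_comp; congr (_.[_]).
by apply: eq_map_poly => c /=; rewrite tau_c.
Qed.

(** With [tau tF = f / g] and [z = p / q] in lowest terms, [tau z = tF] reads ['X * Q = P], where
    [P] and [Q] are [p] and [q] homogenized in [f], [g]. Modulo [f] only the constant coefficients
    remain, so [f] divides [q0 X - p0], which is nonzero because 0 is not a common root of [p] and
    [q]. Modulo [g] only the coefficients of degree [d] remain, and these are not both zero since
    [d] is the larger degree. *)
Lemma tau_t_linear : (exists z, tau z = tF) ->
  exists f g : {poly F}, [/\ g != 0, (size f <= 2)%N, (size g <= 2)%N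
    & tau tF = f%:F / g%:F].
Proof.
case=> z tz; have [f [g [g0 cfg tE]]] := coprime_frac_ex (tau tF).
have [p [q [q0 cpq zE]]] := coprime_frac_ex z.
exists f, g; split=> //.
all: pose d := (maxn (size p) (size q)).-1.
all: have d1 : maxn (size p) (size q) = d.+1
  by rewrite prednK // leq_max orbC size_poly_gt0 q0.
all: have e : 'X * homogenized d f g q = homogenized d f g p.
1,3: have tq0 : tau q%:F != 0 by rewrite fmorph_eq0 tofrac_eq0.
1,2: have := tz; rewrite zE fmorph_div => /(canRL (divfK tq0)).
1,2: rewrite (tau_poly p) (tau_poly q) tE !(@homogenizedE d) // -?d1 ?leq_maxl ?leq_maxr //.
1,2: have gd : (g ^+ d)%:F != 0 by rewrite tofrac_eq0 expf_neq0.
1,2: by rewrite mulrA => /(mulIf (invr_neq0 gd)); rewrite -tofracM => /eqP;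
        rewrite tofrac_eq => /eqP <-.
- have f_dvd : f %| (q`_0 *: 'X - (p`_0)%:P) * g ^+ d.
    have := dvdp_sub (dvd_homogenized0 d f g p) (dvdp_mull 'X (dvd_homogenized0 d f g q)).
    rewrite mulrBr e opprB addrC addrA subrK.
    by rewrite mulrBl mul_polyC -scalerAr -scalerAl addrC.
  rewrite Gauss_dvdpl ?coprimep_expr // in f_dvd.
  apply: leq_trans (dvdp_leq _ f_dvd) _.
    apply/eqP => h.
    have q00 : q`_0 = 0.
      by have := congr1 (fun r : {poly F} => r`_1) h; rewrite coefB coefZ coefX coefC coef0 mulr1 subr0.
    have p00 : p`_0 = 0.
      have := congr1 (fun r : {poly F} => r`_0) h.
      by rewrite coefB coefZ coefX coefC coef0 mulr0 sub0r => /eqP; rewrite oppr_eq0 => /eqP.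
    have := coprimep_root cpq (_ : root p 0).
    by rewrite rootE !horner_coef0 p00 q00 eqxx => /(_ isT).
  by rewrite (leq_trans (size_polyD _ _)) // geq_max size_polyN
    (leq_trans (size_polyC_leq1 _)) // andbT (leq_trans (size_scale_leq _ _)) ?size_polyX.
- have g_dvd : g %| (q`_d *: 'X - (p`_d)%:P) * f ^+ d.
    have := dvdp_sub (dvd_homogenizedd d f g p) (dvdp_mull 'X (dvd_homogenizedd d f g q)).
    rewrite mulrBr e opprB addrC addrA subrK.
    by rewrite mulrBl mul_polyC -scalerAr -scalerAl addrC.
  rewrite Gauss_dvdpl ?coprimep_expr // 1?coprimep_sym // in g_dvd.
  apply: leq_trans (dvdp_leq _ g_dvd) _.
    apply/eqP => h.
    have qd0 : q`_d = 0.
      by have := congr1 (fun r : {poly F} => r`_1) h; rewrite coefB coefZ coefX coefC coef0 mulr1 subr0.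
    have pd0 : p`_d = 0.
      have := congr1 (fun r : {poly F} => r`_0) h.
      by rewrite coefB coefZ coefX coefC coef0 mulr0 sub0r => /eqP; rewrite oppr_eq0 => /eqP.
    move: d1; case: (leqP (size q) (size p)) => [_|/ltnW _] sd.
      have : lead_coef p = 0 by rewrite lead_coefE sd.
      by move/eqP; rewrite lead_coef_eq0 -size_poly_eq0 sd.
    have : lead_coef q = 0 by rewrite lead_coefE sd.
    by move/eqP; rewrite lead_coef_eq0 -size_poly_eq0 sd.
  by rewrite (leq_trans (size_polyD _ _)) // geq_max size_polyN
    (leq_trans (size_polyC_leq1 _)) // andbT (leq_trans (size_scale_leq _ _)) ?size_polyX.
Qed.

(** For [tau tF = f / g] with [f], [g] of degree at most 1, the Wronskian [f' g - f g'] is the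
    determinant [D] of the Moebius transformation, so the quotient equals [f^l g^(2-l) / D]. The
    bound [l <= 2] keeps the exponent of [g] nonnegative. *)
Lemma moebius_pow (l : nat) : (exists z, tau z = tF) -> (l <= 2)%N ->
  exists a : {poly F}, (size a <= 3)%N /\ tau tF ^+ l / dF (tau tF) = a%:F.
Proof.
move=> [z tz] l2.
have D0 : dF (tau tF) != 0.
  have /eqP := dF_chain (s := idfun) tau_c z.
  by rewrite tz dF_t; apply: contraTneq => ->; rewrite mulr0 oner_eq0.
have [|f [g [g0 sf sg tE]]] := tau_t_linear; first by exists z.
pose W := f^`() * g - f * g^`().
have [D DE] : exists D, W = D%:P.
  have lin (r : {poly F}) : (size r <= 2)%N -> r = r`_1 *: 'X + (r`_0)%:P.
    move=> sr; apply/polyP => i; rewrite coefD coefZ coefX coefC.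
    case: i => [|[|i]] /=; rewrite ?mulr0 ?mulr1 ?addr0 ?add0r //.
    by rewrite nth_default // (leq_trans sr).
  exists (f`_1 * g`_0 - f`_0 * g`_1).
  rewrite /W (lin f sf) (lin g sg) !derivD !derivZ derivX !derivC.
  rewrite !coefD !coefZ !coefX !coefC /= !mulr0 !mulr1 !addr0 !add0r.
  by rewrite -!mul_polyC !mulr1 polyCB !polyCM; ring.
have D0' : D != 0.
  by apply: contraNneq D0 => D0; rewrite tE dFE // -/W DE D0 polyC0 tofrac0 mul0r.
exists (D^-1 *: (f ^+ l * g ^+ (2 - l))); split.
  rewrite (leq_trans (size_scale_leq _ _)) //.
  have szX (r : {poly F}) k : (size r <= 2)%N -> (size (r ^+ k) <= k.+1)%N.
    move=> sr; have := size_poly_exp_leq r k; move/leq_trans; apply.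
    by rewrite ltnS -{2}[k]mul1n leq_mul2r orbC; case: (size r) sr => [|[|[]]].
  rewrite (leq_trans (size_polyMleq _ _)) //.
  have := leq_add (szX f l sf) (szX g (2 - l)%N sg).
  by rewrite addSn addnS subnKC //; case: (_ + _)%N.
have -> : D^-1 *: (f ^+ l * g ^+ (2 - l)) = (D^-1)%:P * (f ^+ l * g ^+ (2 - l)).
  by rewrite mul_polyC.
rewrite tE dFE // -/W DE.
have -> : g ^+ 2 = g ^+ l * g ^+ (2 - l) by rewrite -exprD subnKC.
rewrite !tofracM.
have -> : ((D^-1)%:P)%:F = ((D%:P)%:F)^-1 by apply: (fmorphV (@cst F)).
rewrite expr_div_n -2!tofracXn.
by apply: quot_moebius; rewrite ?tofrac_eq0 ?expf_neq0 // fmorph_eq0.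
Qed.

End Automorphism.

(* The fields a(t) d/dt with deg a <= 2 form the Lie algebra of the group of Moebius
   transformations, hence are preserved by every automorphism of F(t) over F. *)
Lemma automorphism_degree2_fields (tau tau' : {rmorphism F(t) -> F(t)}) (u : F(t)) (l : nat) :
  (forall c, tau (cst c) = cst c) -> cancel tau tau' -> cancel tau' tau ->
  (l <= 2)%N -> exists a : {poly F}, (size a <= 3)%N /\
    tau' (tF ^+ l * dF (tau u)) = a%:F * dF u.
Proof.
move=> tau_c tK tK' l2.
have tau'_c c : tau' (cst c) = cst c by rewrite -{1}tau_c tK.
have [|a [sa aE]] := @moebius_pow tau' tau'_c l _ l2; first by exists (tau tF).
exists a; split=> //; rewrite -aE rmorphM rmorphXn -mulrA; congr (_ * _).
have /eqP := dF_chain (s := idfun) tau'_c (tau tF); rewrite tK dF_t => D0.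
have {}D0 : dF (tau' tF) != 0.
  by apply: contraTneq D0 => ->; rewrite mulr0 oner_eq0.
have := dF_chain (s := idfun) tau'_c (tau u); rewrite tK => ->.
by rewrite mulrC mulfK.
Qed.

End Moebius.

(** * Linear relations over a subfield *)

Section LinearFunctional.
Variables (K F : fieldType) (iota : {rmorphism K -> F}).

Definition klinear (lam : {additive F -> K}) :=
  forall k a, lam (iota k * a) = k * lam a.

(* The functional is the coordinate along x with respect to a maximal K-subspace avoiding x. *)
Lemma klinear_ex (x : F) : x != 0 ->
  exists lam : {additive F -> K}, klinear lam /\ lam x = 1.
Proof.
move=> x0.
pose P (H : set F) := [/\ forall a b, H a -> H b -> H (a + b),
  forall k a, H a -> H (iota k * a) & ~ H x].
have [H [[HD HZ Hx] Hmax]] : exists H, P H /\ forall B, H `<` B -> ~ P B.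
  apply: Zorn_bigcup => A AP totA; split.
  - move=> a b [B AB Ba] [B' AB' B'b].
    have [BB'|B'B] := totA _ _ AB AB'.
      by exists B' => //; have [D _ _] := AP _ AB'; apply: D => //; apply: BB'.
    by exists B => //; have [D _ _] := AP _ AB; apply: D => //; apply: B'B.
  - by move=> k a [B AB Ba]; exists B => //; have [_ Z _] := AP _ AB; apply: Z.
  - by move=> [B AB Bx]; have [_ _] := AP _ AB; apply.
have H0 a : H a -> H 0 by move=> Ha; rewrite -(mul0r a) -(rmorph0 iota); apply: HZ.
have HN a : H a -> H (- a) by move=> Ha; rewrite -mulN1r -(rmorphN1 iota); apply: HZ.
(* The empty set satisfies [P], being the union of the empty chain, so that [H] contains 0 has to
   come from maximality. *)
have H00 : H 0.
  apply: contrapT => nH0; pose B : set F := [set 0].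
  apply: (Hmax B).
    split=> [a /H0 //|BH]; apply: nH0; exact: BH.
  split=> [a b -> ->|k a ->|/= e]; rewrite /B /= ?addr0 ?mulr0 //.
  by rewrite e eqxx in x0.
(* Otherwise [H + K y] would be strictly larger than [H] and still avoid [x]. *)
have dec y : exists c, H (y - iota c * x).
  apply: contrapT => nd.
  pose B := [set z | exists k h, H h /\ z = h + iota k * y].
  apply: (Hmax B); first split.
  - by move=> z Hz; exists 0, z; rewrite rmorph0 mul0r addr0.
  - move=> /(_ y) By; apply: nd; exists 0; rewrite rmorph0 mul0r subr0.
    by apply: By; exists 1, 0; rewrite rmorph1 mul1r add0r.
  - split.
    + move=> a b [k [h [Hh ->]]] [k' [h' [Hh' ->]]].
      exists (k + k'), (h + h'); split; first exact: HD.
      by rewrite rmorphD mulrDl addrACA.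
    + move=> k a [k' [h [Hh ->]]]; exists (k * k'), (iota k * h).
      by split; [exact: HZ | rewrite mulrDr rmorphM mulrA].
    + move=> [k [h [Hh xE]]]; have [k0|k0] := eqVneq k 0.
        by apply: Hx; rewrite xE k0 rmorph0 mul0r addr0.
      apply: nd; exists k^-1.
      have -> : y - iota k^-1 * x = iota k^-1 * (- h).
        rewrite xE mulrDr mulrA -rmorphM mulVf // rmorph1 mul1r mulrN.
        by rewrite opprD addrCA subrr addr0.
      exact/HZ/HN.
have [c cP] := choice dec.
have uniq_c y k : H (y - iota k * x) -> c y = k.
  move=> Hk; apply/eqP; rewrite -subr_eq0; apply: contrapT => /negP ck; apply: Hx.
  have -> : x = iota (c y - k)^-1 * ((y - iota k * x) + - (y - iota (c y) * x)).
    have : iota (c y - k) != 0 by rewrite fmorph_eq0.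
    rewrite fmorphV rmorphB => ck0; apply: (mulfI ck0); rewrite mulrA mulfV //.
    by rewrite mul1r; ring.
  by apply: HZ; apply: HD => //; apply: HN.
have cB : zmod_morphism c.
  move=> a b; apply: uniq_c.
  have -> : a - b - iota (c a - c b) * x = (a - iota (c a) * x) + - (b - iota (c b) * x).
    by rewrite rmorphB; ring.
  by apply: HD => //; apply: HN.
pose cA := GRing.isZmodMorphism.Build F K c cB.
pose lam : {additive F -> K} := HB.pack c cA.
exists lam; split=> [k a|] /=; apply: uniq_c.
  by rewrite rmorphM -mulrA -mulrBr; apply: HZ.
by rewrite rmorph1 mul1r subrr.
Qed.

End LinearFunctional.

Section CommonDenominators.
Variable L : fieldType.

Definition fracs (Z : L -> Prop) z := exists a b, [/\ Z a, Z b, b != 0 & z = a / b].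

Lemma common_denom (Z : L -> Prop) n (b : 'I_n -> L) :
  Z 1 -> (forall x y, Z x -> Z y -> Z (x * y)) -> (forall i, fracs Z (b i)) ->
  exists d, [/\ Z d, d != 0 & forall i, Z (d * b i)].
Proof.
move=> Z1 ZM; elim: n b => [|n IH] b bZ.
  by exists 1; split=> //; [exact: oner_neq0 | case].
have [d [Zd d0 dP]] := IH _ (fun i => bZ (lift ord0 i)).
have [x [y [Zx Zy y0 bE]]] := bZ ord0.
exists (d * y); split; [exact: ZM|by rewrite mulf_neq0|].
move=> i; case: (unliftP ord0 i) => [j|] ->.
  by rewrite mulrAC; apply: ZM.
have -> : d * y * b ord0 = d * x by rewrite bE -mulrA [y * _]mulrC divfK.
exact: ZM.
Qed.

Variables (K F : fieldType) (iota : {rmorphism K -> F}) (c : {rmorphism F -> L}).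
Variables (lam : {additive F -> K}).

(** Linear disjointness of [Z] from [F] over [K], as seen by one functional: an [F]-linear relation
    between elements of [Z] stays a relation when [lam] is applied to its coefficients. This form
    asks for neither bases nor tensor products. *)
Definition lam_family (Z : L -> Prop) := forall n (f : 'I_n -> F) (b : 'I_n -> L),
  (forall i, Z (b i)) -> \sum_i c (f i) * b i = 0 ->
  \sum_i c (iota (lam (f i))) * b i = 0.

Lemma lam_family_fracs (Z : L -> Prop) : Z 1 ->
  (forall x y, Z x -> Z y -> Z (x * y)) -> lam_family Z -> lam_family (fracs Z).
Proof.
move=> Z1 ZM lamZ n f b bZ sum0.
have [d [Zd d0 dP]] := common_denom Z1 ZM bZ.
apply: (mulfI d0); rewrite mulr0 mulr_sumr.
under eq_bigr do rewrite mulrCA.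
apply: lamZ => //; under eq_bigr do rewrite mulrCA.
by rewrite -mulr_sumr sum0 mulr0.
Qed.

End CommonDenominators.

Lemma mpoly_hom_eq (N : nat) (R : comNzRingType) (S : comNzRingType)
    (f g : {rmorphism {mpoly R[N]} -> S}) :
  (forall c, f c%:MP = g c%:MP) -> (forall i, f 'X_i = g 'X_i) -> f =1 g.
Proof.
move=> fgC fgX p; rewrite [p]mpolyE !rmorph_sum; apply: eq_bigr => m _.
rewrite -mul_mpolyC !rmorphM fgC; congr (_ * _).
rewrite mpolyXE_id !rmorph_prod; apply: eq_bigr => i _.
by rewrite !rmorphXn fgX.
Qed.

Section Evaluation.
Variables (N : nat) (K : comNzRingType) (L : fieldType) (c : {rmorphism K -> L}).
Variable X : 'I_N -> L.

Definition ev : {mpoly K[N]} -> L := mmap c X.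
HB.instance Definition _ := GRing.RMorphism.on ev.

Lemma evC k : ev k%:MP = c k. Proof. exact: mmapC. Qed.
Lemma evX i : ev 'X_i = X i. Proof. by rewrite /ev mmapX mmap1U. Qed.
Lemma evZ k p : ev (k *: p) = c k * ev p.
Proof. by rewrite -mul_mpolyC rmorphM /= evC. Qed.

(* Membership in the field generated by the X_i over the image of K. *)
Definition coord_field := fracs (fun z => exists p, z = ev p).

Lemma coord_fieldE z : coord_field z <-> exists p q, ev q != 0 /\ z = ev p / ev q.
Proof.
split; first by move=> [_ [_ [[p ->] [q ->] q0 ->]]]; exists p, q.
by move=> [p [q [q0 ->]]]; exists (ev p), (ev q); split=> //; [exists p|exists q].
Qed.

Lemma coord_field_ev p : coord_field (ev p).
Proof. by apply/coord_fieldE; exists p, 1; rewrite rmorph1 divr1 oner_neq0. Qed.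

Lemma coord_fieldX i : coord_field (X i). Proof. by rewrite -evX; exact: coord_field_ev. Qed.
Lemma coord_fieldC k : coord_field (c k). Proof. by rewrite -evC; exact: coord_field_ev. Qed.
Lemma coord_field1 : coord_field 1. Proof. by rewrite -(rmorph1 ev); exact: coord_field_ev. Qed.
Lemma coord_field0 : coord_field 0. Proof. by rewrite -(rmorph0 ev); exact: coord_field_ev. Qed.

Lemma coord_fieldM x y : coord_field x -> coord_field y -> coord_field (x * y).
Proof.
move=> /coord_fieldE[p [q [q0 ->]]] /coord_fieldE[p' [q' [q'0 ->]]]; apply/coord_fieldE.
by exists (p * p'), (q * q'); rewrite !rmorphM mulf_neq0 // mulf_div.
Qed.

Lemma coord_fieldD x y : coord_field x -> coord_field y -> coord_field (x + y).
Proof.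
move=> /coord_fieldE[p [q [q0 ->]]] /coord_fieldE[p' [q' [q'0 ->]]]; apply/coord_fieldE.
exists (p * q' + p' * q), (q * q'); rewrite !rmorphD !rmorphM mulf_neq0 //.
by rewrite addf_div.
Qed.

Lemma coord_fieldV x : coord_field x -> coord_field x^-1.
Proof.
move=> /coord_fieldE[p [q [q0 ->]]]; apply/coord_fieldE; have [p0|p0] := eqVneq (ev p) 0.
  by exists 0, 1; rewrite p0 mul0r invr0 rmorph0 rmorph1 mul0r oner_neq0.
by exists q, p; rewrite invf_div.
Qed.

Lemma coord_fieldN x : coord_field x -> coord_field (- x).
Proof.
by move=> h; rewrite -mulN1r -(rmorphN1 ev); apply: coord_fieldM => //; exact: coord_field_ev.
Qed.

End Evaluation.

Lemma ev_morph N (K K' : comNzRingType) (L L' : fieldType) (c : {rmorphism K -> L})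
    (c' : {rmorphism K' -> L'}) (s : {rmorphism K -> K'}) (tau : {rmorphism L -> L'})
    (X : 'I_N -> L) : (forall k, tau (c k) = c' (s k)) ->
  forall p, tau (ev c X p) = ev c' (fun i => tau (X i)) (map_mpoly s p).
Proof.
move=> tc; pose Y i := tau (X i).
apply: (@mpoly_hom_eq _ _ _ (tau \o ev c X) (ev c' Y \o map_mpoly s)) => [k|i] /=.
  by rewrite map_mpolyC !evC.
by rewrite map_mpolyX !evX.
Qed.

Section DefinedOver.
Variables (N : nat) (K F L : fieldType) (iota : {rmorphism K -> F}).
Variables (c : {rmorphism F -> L}) (X : 'I_N -> L).

Local Notation evF := (ev c X).
Local Notation evK := (ev (c \o iota) X).

Lemma ev_map p : evF (map_mpoly iota p) = evK p.
Proof.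
apply: (@mpoly_hom_eq _ _ _ (evF \o map_mpoly iota) evK) => [k|i] /=.
  by rewrite map_mpolyC !evC.
by rewrite map_mpolyX !evX.
Qed.

Definition defined_over := forall p, evF p = 0 ->
  exists n (c : 'I_n -> {mpoly F[N]}) (g : 'I_n -> {mpoly K[N]}),
    (forall i, evK (g i) = 0) /\ p = \sum_i c i * map_mpoly iota (g i).

Hypothesis X_def : defined_over.
Variables (lam : {additive F -> K}) (lamP : klinear iota lam).

Lemma map_lamM (q : {mpoly F[N]}) (g : {mpoly K[N]}) :
  map_mpoly lam (q * map_mpoly iota g) = map_mpoly lam q * g.
Proof.
apply/mpolyP => m; rewrite mcoeff_map_mpoly !mcoeffM raddf_sum; apply: eq_bigr => k _.
by rewrite !mcoeff_map_mpoly mulrC lamP mulrC.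
Qed.

Lemma lam_stable p : evF p = 0 -> evK (map_mpoly lam p) = 0.
Proof.
move=> /X_def[n [q [g [g0 ->]]]]; rewrite [map_mpoly lam _]raddf_sum rmorph_sum big1 // => i _ /=.
by rewrite map_lamM rmorphM /= g0 mulr0.
Qed.

(** Here the field of definition enters. Once denominators are cleared, a relation over [F] between
    elements of [K(X)] is a polynomial in the ideal of [X]; this ideal is generated over [K], hence
    stable under coefficientwise application of [lam]. *)
Lemma lam_coord_field : lam_family iota c lam (coord_field (c \o iota) X).
Proof.
apply: lam_family_fracs.
- by exists 1; rewrite rmorph1.
- by move=> _ _ [p ->] [q ->]; exists (p * q); rewrite rmorphM.
move=> n f b bZ sum0; have [p pE] := choice bZ.
pose s := \sum_i (f i)%:MP * map_mpoly iota (p i).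
have : evF s = 0.
  rewrite /s rmorph_sum -[RHS]sum0; apply: eq_bigr => i _.
  by rewrite rmorphM /= evC pE ev_map.
move/lam_stable; rewrite /s [map_mpoly lam _]raddf_sum rmorph_sum => h; rewrite -[RHS]h.
apply: eq_bigr => i _ /=.
by rewrite map_lamM map_mpolyC rmorphM /= evC -pE.
Qed.

End DefinedOver.

(** * Function fields and parametrizations *)

Lemma clear_denom (L : fieldType) (a b e : L) i j k : e != 0 ->
  (a / e) ^+ i * (b / e) ^+ j * (e ^+ i * e ^+ j * e ^+ k) = a ^+ i * (b ^+ j * e ^+ k).
Proof. by move=> e0; rewrite !expr_div_n; field; rewrite !expf_neq0. Qed.

Section AlgebraicDependence.
Variable F : fieldType.

Lemma poly_dep (T : finType) n (P : T -> {poly F}) :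
  (forall x, (size (P x) <= n)%N) -> (n < #|T|)%N ->
  exists v : T -> F, (exists x, v x != 0) /\ \sum_x v x *: P x = 0.
Proof.
move=> sP nT; pose A := \matrix_(i < #|T|) poly_rV (P (enum_val i)) : 'M[F]_(#|T|, n).
have : kermx A != 0.
  rewrite -mxrank_eq0 mxrank_ker -lt0n subn_gt0.
  exact: leq_ltn_trans (rank_leq_col A) nT.
rewrite -nz_row_eq0; set w := nz_row _ => w0.
have wA : w *m A = 0 by apply/eqP; rewrite -sub_kermx nz_row_sub.
exists (fun x => w 0 (enum_rank x)); split.
  have /rV0Pn[i wi] := w0.
  by exists (enum_val i); rewrite enum_valK.
have -> : \sum_x w 0 (enum_rank x) *: P x = \sum_(i < #|T|) w 0 i *: P (enum_val i).
  rewrite (reindex (@enum_val T T)) /=; last exact/onW_bij/enum_val_bij.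
  by apply: eq_bigr => i _; rewrite enum_valK.
apply/polyP => j; rewrite coef0 coef_sum; have [jn|nj] := ltnP j n.
  have /(congr1 (fun B : 'rV_n => B 0 (Ordinal jn))) := wA; rewrite !mxE.
  by move=> h; rewrite -[RHS]h; apply: eq_bigr => i _; rewrite !mxE coefZ.
by apply: big1 => i _; rewrite coefZ nth_default ?mulr0 // (leq_trans (sP _)).
Qed.

(* With a common denominator of degree at most D, the (2D+2)^2 monomials of degree below
   2D+2 in a and in b live in a space of dimension (4D+4)D+1. *)
Lemma alg_dependent (a b : F(t)) : exists G : {poly {poly F}}, G != 0 /\
  (map_poly (fun q : {poly F} => (map_poly (@cst F) q).[b]) G).[a] = 0.
Proof.
have [p [q [q0 ->]]] := frac_ex a; have [p' [q' [q'0 ->]]] := frac_ex b.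
pose A := p * q'; pose B := p' * q; pose e := q * q'.
have e0 : e != 0 by rewrite mulf_neq0.
have -> : p%:F / q%:F = A%:F / e%:F.
  by rewrite /A /e !tofracM -mulf_div divff ?mulr1 // tofrac_eq0.
have -> : p'%:F / q'%:F = B%:F / e%:F.
  by rewrite /B /e [q * q']mulrC !tofracM -mulf_div divff ?mulr1 // tofrac_eq0.
clearbody A B e.
pose D := maxn (size A) (maxn (size B) (size e)); pose M := (2 * D).+2.
have [sA sB se] : [/\ size A <= D, size B <= D & size e <= D]%N.
  by rewrite /D !leq_max !leqnn !orbT.
have szX (r : {poly F}) k : (size r <= D)%N -> (size (r ^+ k) <= (k * D).+1)%N.
  move=> sr; have := size_poly_exp_leq r k; move/leq_trans; apply.
  by rewrite ltnS mulnC leq_mul2l (leq_trans (leq_pred _)) ?orbT.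
have szM (r s : {poly F}) k l : (size r <= k.+1)%N -> (size s <= l.+1)%N ->
    (size (r * s)%R <= (k + l).+1)%N.
  move=> sr ss; apply: leq_trans (size_polyMleq _ _) _.
  by have := leq_add sr ss; rewrite addSn addnS; case: (_ + _)%N.
pose P (ij : 'I_M * 'I_M) := A ^+ ij.1 * (B ^+ ij.2 * e ^+ (2 * M - ij.1 - ij.2)).
have le2 (i j : 'I_M) : (i + j <= 2 * M)%N by rewrite mul2n -addnn leq_add // ltnW.
have [||v [[ij0 v0] vP]] := @poly_dep _ (2 * M * D).+1 P.
- move=> [i j]; rewrite /P /=.
  have -> : (2 * M * D = i * D + (j * D + (2 * M - i - j) * D))%N.
    by rewrite -!mulnDl addnA -subnDA subnKC.
  exact: szM (szX _ _ sA) (szM _ _ _ _ (szX _ _ sB) (szX _ _ se)).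
- rewrite card_prod !card_ord.
  have -> : (M * M = 2 * M * D + 2 * M)%N by rewrite {1}/M -addn2 mulnDl (mulnAC 2 D M).
  by rewrite -addn2 leq_add2l leq_pmulr.
exists (\poly_(i < M) \poly_(j < M) v (inord i, inord j)); split.
  apply/eqP => /(congr1 (fun G : {poly {poly F}} => G`_ij0.1`_ij0.2)).
  rewrite coef_poly ltn_ord coef_poly ltn_ord !coef0.
  by case: ij0 v0 => i j /= v0 /eqP; rewrite !inord_val (negPf v0).
have eM0 : (e ^+ (2 * M))%:F != 0 by rewrite tofrac_eq0 expf_neq0.
apply: (mulIf eM0); rewrite mul0r.
pose hb : {rmorphism {poly F} -> F(t)} := horner_eval (B%:F / e%:F) \o map_poly (@cst F).
rewrite -[map_poly _ _]/(map_poly hb _) poly_def rmorph_sum horner_sum mulr_suml.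
have {}vP : \sum_(i < M) \sum_(j < M) v (i, j) *: P (i, j) = 0.
  by rewrite pair_bigA -[RHS]vP; apply: eq_bigr => -[].
rewrite -[RHS]tofrac0 -vP [RHS]rmorph_sum.
apply: eq_bigr => i _.
rewrite /= map_polyZ /= map_polyXn hornerZ hornerXn.
rewrite poly_def [map_poly _ _]rmorph_sum /horner_eval horner_sum -mulrA mulr_suml.
rewrite [RHS]rmorph_sum; apply: eq_bigr => j _.
rewrite /P /= map_polyZ /= map_polyXn hornerZ hornerXn !inord_val.
rewrite -[in RHS]mul_polyC [RHS]tofracM -[(_%:P)%:F]/(cst _) -!mulrA; congr (_ * _).
have -> : e ^+ (2 * M) = e ^+ i * e ^+ j * e ^+ (2 * M - i - j).
  by rewrite -!exprD -subnDA subnKC.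
rewrite !tofracM !tofracXn [LHS]mulrCA [LHS]mulrA.
by apply: clear_denom; rewrite tofrac_eq0.
Qed.

(** Factors ['X] can be removed from [G] because [a] is nonzero. The constant coefficient is what
    remains of the relation when [a] is specialized to 0, as happens in [param_ker]. *)
Lemma alg_dependent_coef0 (a b : F(t)) : a != 0 -> exists G : {poly {poly F}}, G`_0 != 0 /\
  (map_poly (fun q : {poly F} => (map_poly (@cst F) q).[b]) G).[a] = 0.
Proof.
move=> a0; have [G] := alg_dependent a b; elim/poly_ind: G => [|G c IH] [G0 GE].
  by rewrite eqxx in G0.
have [c0|c0] := eqVneq c 0; last first.
  by exists (G * 'X + c%:P); split=> //; rewrite coefD coefMX coefC eqxx add0r.
apply: IH; move: G0 GE; rewrite c0 polyC0 addr0 mulf_eq0 negb_or => /andP[G0 _].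
pose hb : {rmorphism {poly F} -> F(t)} := horner_eval b \o map_poly (@cst F).
rewrite -![map_poly _ _]/(map_poly hb _) rmorphM /= map_polyX hornerMX => /eqP.
by rewrite mulf_eq0 (negPf a0) orbF => /eqP.
Qed.

End AlgebraicDependence.

Lemma algebraic_cst (F : closedFieldType) (G : {poly F}) (b : F(t)) :
  G != 0 -> (map_poly (@cst F) G).[b] = 0 -> exists r, b = cst r.
Proof.
move=> G0; have [rs ->] := closed_field_poly_normal G.
rewrite map_polyZ hornerZ => /eqP.
rewrite mulf_eq0 fmorph_eq0 lead_coef_eq0 (negPf G0) /=.
rewrite rmorph_prod horner_prod prodf_seq_eq0 => /hasP[r _ /=].
rewrite rmorphB /= map_polyX map_polyC hornerXsubC subr_eq0 => /eqP ->.
by exists r.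
Qed.

Lemma tF_not_cst (F : fieldType) (r : F) : tF <> cst r.
Proof.
move/eqP; rewrite tofrac_eq => /eqP/(congr1 (fun p : {poly F} => size p)).
by rewrite size_polyX size_polyC; case: eqP.
Qed.

Section Kernel.
Variables (F : closedFieldType) (N : nat) (X Y : 'I_N -> F(t)).

(* Extra relations would make every Y_i algebraic over F, hence constant. *)
Lemma param_ker : (forall p, ev (@cst F) X p = 0 -> ev (@cst F) Y p = 0) ->
  coord_field (@cst F) Y tF -> forall h, ev (@cst F) Y h = 0 -> ev (@cst F) X h = 0.
Proof.
move=> kXY /coord_fieldE[p [q [q0 tE]]] h Yh; apply/eqP; apply: contraT => a0.
(* If [h] vanishes at [Y] but not at [X], an algebraic relation between [h(X)] and [X i] passes to
   [Y], where only its constant coefficient in [h] survives: a nonzero polynomial over [F] that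
   vanishes at [Y i]. *)
have Ycst i : exists r, Y i = cst r.
  have [G [G0 GE]] := alg_dependent_coef0 (X i) a0.
  apply: (algebraic_cst G0).
  pose g : {rmorphism {poly F} -> {mpoly F[N]}} :=
    horner_eval 'X_i \o map_poly (@mpolyC N F).
  have gE (Z : 'I_N -> F(t)) (r : {poly F}) :
      ev (@cst F) Z (g r) = (map_poly (@cst F) r).[Z i].
    rewrite /= /horner_eval -horner_map /= evX -map_poly_comp; congr (_.[_]).
    by apply: eq_map_poly => c /=; rewrite evC.
  pose Gamma := (map_poly g G).[h].
  have GammaE (Z : 'I_N -> F(t)) : ev (@cst F) Z Gamma =
     (map_poly (fun r : {poly F} => (map_poly (@cst F) r).[Z i]) G).[ev (@cst F) Z h].
    rewrite /Gamma -horner_map /= -map_poly_comp; congr (_.[_]).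
    by apply: eq_map_poly => r; rewrite -gE.
  have : ev (@cst F) Y Gamma = 0 by apply: kXY; rewrite GammaE.
  rewrite GammaE Yh horner_coef0 coef_map_id0 //.
  by rewrite rmorph0 horner0.
have [y yE] := choice Ycst.
have evY r : ev (@cst F) Y r = cst (meval y r).
  apply: (@mpoly_hom_eq _ _ _ (ev (@cst F) Y) (@cst F \o meval y)) => [k|i].
    by rewrite /= evC mevalC.
  by rewrite /= evX mevalXU.
case: (@tF_not_cst _ (meval y p / meval y q)).
by rewrite tE !evY; exact/esym/(fmorph_div (@cst F)).
Qed.

End Kernel.

Section FunctionField.
Variables (F : closedFieldType) (N : nat) (C : irreducible_curve F N).

(** A generic point of the curve with coordinates in [F(t)] stands for the isomorphism of function
    fields: substitutions and changes of coefficients then act on a tuple rather than on a field of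
    fractions of a quotient ring. *)
Definition is_param (X : 'I_N -> F(t)) :=
  (forall p, p \in curve_ideal C <-> ev (@cst F) X p = 0) /\ coord_field (@cst F) X tF.

Lemma curve_fun_eq0 p : curve_fun C p = 0 <-> p \in curve_ideal C.
Proof.
rewrite /curve_fun; split=> [/eqP|h].
  rewrite tofrac_eq0 => /eqP h.
  have : (\pi_{ideal_quot (curve_ideal C)} p == \pi_{ideal_quot (curve_ideal C)} 0).
    by rewrite h rmorph0.
  by rewrite -Quotient.idealrBE subr0.
apply/eqP; rewrite tofrac_eq0; apply/eqP.
rewrite -(rmorph0 (\pi_{ideal_quot (curve_ideal C)})); apply/eqP.
by rewrite -Quotient.idealrBE subr0.
Qed.

Definition curve_fun_pi : {mpoly F[N]} -> function_field C :=
  (@FracField.tofrac (coordinate_ring C)) \o (\pi_{ideal_quot (curve_ideal C)}).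
HB.instance Definition _ := GRing.RMorphism.on curve_fun_pi.

Lemma function_field_ex (z : function_field C) : exists p q : {mpoly F[N]},
  q \notin curve_ideal C /\ z = curve_fun C p / curve_fun C q.
Proof.
have [p [q [q0 ->]]] := frac_ex (z : {fraction coordinate_ring C}).
exists (repr p), (repr q); split; last by rewrite /curve_fun !reprK.
apply/negP => /curve_fun_eq0 /eqP; rewrite tofrac_eq0 /= reprK.
by rewrite (negPf q0).
Qed.

Lemma param_iso (X : 'I_N -> F(t)) : is_param X ->
  exists (phi : {rmorphism function_field C -> ratfun F})
    (psi : {rmorphism ratfun F -> function_field C}),
    [/\ cancel phi psi, cancel psi phi & forall p, phi (curve_fun C p) = ev (@cst F) X p].
Proof.
move=> [kerX tX].
pose f (x : coordinate_ring C) : ratfun F := ev (@cst F) X (repr x).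
have fE p : f (\pi_{ideal_quot (curve_ideal C)} p) = ev (@cst F) X p.
  apply/eqP; rewrite -subr_eq0 -rmorphB; apply/eqP/kerX.
  by rewrite Quotient.idealrBE reprK.
have fB : zmod_morphism f.
  move=> x y; rewrite -[x]reprK -[y]reprK -rmorphB !fE; exact: rmorphB.
have fM : monoid_morphism f.
  split=> [|x y]; last first.
    rewrite -[x]reprK -[y]reprK -rmorphM !fE; exact: rmorphM.
  rewrite -(rmorph1 (\pi_{ideal_quot (curve_ideal C)})) fE; exact: rmorph1.
pose fz := GRing.isZmodMorphism.Build _ _ f fB.
pose fm := GRing.isMonoidMorphism.Build _ _ f fM.
pose fr : {rmorphism coordinate_ring C -> ratfun F} := HB.pack f fz fm.
have f_inj x : fr x = 0 -> x = 0.
  rewrite -[x]reprK /= fE => /kerX xI.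
  by apply/eqP; rewrite -(rmorph0 (\pi_{ideal_quot (curve_ideal C)}))
    -Quotient.idealrBE subr0.
have [phi phiE] := frac_lift_ex f_inj.
have phi_ev p : phi (curve_fun C p) = ev (@cst F) X p by rewrite phiE /= fE.
have phi_inj : injective phi by apply: fmorph_inj.
have surj (z : ratfun F) : exists x, phi x = z.
  have evP (p : {poly F}) : exists x, phi x = p%:F.
    elim/poly_ind: p => [|p c [x xE]]; first by exists 0; rewrite !rmorph0.
    have [a [b [b0 tE]]] := (coord_fieldE _ _ _).1 tX.
    exists (x * (curve_fun C a / curve_fun C b) + curve_fun C c%:MP).
    rewrite rmorphD rmorphM fmorph_div !phi_ev xE -tE evC.
    by rewrite tofracD tofracM.
  have [p [q [q0 ->]]] := frac_ex (z : F(t)).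
  have [[x xE] [y yE]] := (evP p, evP q).
  by exists (x / y); rewrite fmorph_div xE yE.
have [psi psiK] := choice surj.
have phiK : cancel phi psi by move=> x; apply: phi_inj; rewrite psiK.
pose pz := GRing.isZmodMorphism.Build _ _ psi (can2_zmod_morphism phiK psiK).
pose pm := GRing.isMonoidMorphism.Build _ _ psi (can2_monoid_morphism phiK psiK).
pose psi' : {rmorphism ratfun F -> function_field C} := HB.pack psi pz pm.
by exists phi, psi'.
Qed.

Lemma curve_fun_pi_ev (X : 'I_N -> F(t)) (phi : {rmorphism function_field C -> ratfun F}) :
  (forall c, phi (curve_fun C c%:MP) = cst c) ->
  (forall i, phi (curve_fun C 'X_i) = X i) ->
  forall p, phi (curve_fun C p) = ev (@cst F) X p.
Proof.
move=> phiC phiX; apply: (@mpoly_hom_eq _ _ _ (phi \o curve_fun_pi) (ev (@cst F) X)).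
  by move=> c; apply: etrans (esym (evC _ _ _)); exact: phiC.
by move=> i; apply: etrans (esym (evX _ _ _)); exact: phiX.
Qed.

Lemma rational_param : rational_curve C -> exists X, is_param X.
Proof.
move=> [phi [psi [phiK psiK phiC]]].
exists (fun i => phi (curve_fun C 'X_i)).
have phiE := @curve_fun_pi_ev (fun i => phi (curve_fun C 'X_i)) phi phiC (fun => erefl).
split.
  move=> p; rewrite -phiE -curve_fun_eq0; split=> [->|/eqP]; first exact: rmorph0.
  by rewrite fmorph_eq0 => /eqP.
have [p [q [qI zE]]] := function_field_ex (psi (ratfunX F)).
apply/coord_fieldE; exists p, q; rewrite -!phiE; split.
  by rewrite fmorph_eq0; apply: contra qI => /eqP/curve_fun_eq0.
by rewrite -fmorph_div -zE psiK.
Qed.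

End FunctionField.

(** * Parametrizations with algebraic coefficients *)

Lemma natr_inj_char0 (R : idomainType) : [pchar R] =i pred0 ->
  injective (fun n : nat => n%:R : R).
Proof.
move=> /pcharf0P char0 i j; wlog ij : i j / (i <= j)%N.
  by move=> W; case: (leqP i j) => [|/ltnW] ij e; [exact: W|apply/esym/W].
move=> /eqP; rewrite eq_sym -subr_eq0 -natrB // char0 subn_eq0 => ji.
by apply/eqP; rewrite eqn_leq ij.
Qed.

Lemma nonroot_seq (R : idomainType) (f : nat -> R) (p : {poly R}) :
  injective f -> p != 0 -> exists n, p.[f n] != 0.
Proof.
move=> f_inj p0; apply: contrapT => h.
pose rs := [seq f i | i <- iota 0 (size p)].
have : (size rs < size p)%N.
  apply: max_poly_roots => //.
    apply/allP => _ /mapP[i _ ->]; rewrite rootE; apply: contraT => pi.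
    by case: h; exists i.
  by rewrite map_inj_uniq ?iota_uniq.
by rewrite size_map size_iota ltnn.
Qed.

Lemma nonroot_nat (R : idomainType) (p : {poly R}) : [pchar R] =i pred0 ->
  p != 0 -> exists n : nat, p.[n%:R] != 0.
Proof. by move=> /natr_inj_char0; exact: nonroot_seq. Qed.

Section Specialization.
Variables (K : fieldType) (F : closedFieldType) (io : {rmorphism K -> F}).
Hypothesis char0 : [pchar F] =i pred0.

(* Points with coordinates algebraic over K are dense among the specializations of rho. *)
Definition specializable (A : comNzRingType) (kap : {rmorphism K -> A})
    (rho : {rmorphism A -> F}) :=
  (forall k, rho (kap k) = io k) /\
  forall a, rho a != 0 -> exists rho' : {rmorphism A -> F},
    [/\ forall k, rho' (kap k) = io k, forall b, rho b = 0 -> rho' b = 0,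
        rho' a != 0 & forall b, algebraicOver io (rho' b)].

(** The induction step, extending a specialization [rho'] of [A] to one more generator [x]. The
    element [a0] gathers the leading coefficients that have to survive. If [x] is transcendental
    over the image of [A], it is sent to an integer where the specialized [a] is nonzero; otherwise
    to a suitable root of the specialization of a shortest relation [mu] of [x]. *)
Lemma specializable_poly (A : comNzRingType) (kap : {rmorphism K -> A})
    (rho : {rmorphism A -> F}) (x : F) : specializable kap rho ->
  specializable (@polyC A \o kap) (horner_eval x \o map_poly rho).
Proof.
move=> [rho_kap spec]; split=> [k|a].
  by rewrite /= /horner_eval map_polyC hornerC /= rho_kap.
rewrite /= /horner_eval => ax0.
suff [a0 [ra0 key]] : exists a0, rho a0 != 0 /\ forall rho' : {rmorphism A -> F},
    (forall b, rho b = 0 -> rho' b = 0) -> rho' a0 != 0 -> exists x',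
    [/\ exists2 p, map_poly rho' p != 0 & root (map_poly rho' p) x', (map_poly rho' a).[x'] != 0 &
     forall b, (map_poly rho b).[x] = 0 -> (map_poly rho' b).[x'] = 0].
  have [rho' [rk' ker a0' alg]] := spec _ ra0.
  have [x' [x'alg ax' ker']] := key _ ker a0'.
  exists (horner_eval x' \o map_poly rho'); split=> //.
    by move=> k; rewrite /= /horner_eval map_polyC hornerC /= rk'.
  have inta (p : {poly A}) : {in map_poly rho' p : seq F, integralRange io}.
    by apply/integral_poly => i; rewrite coef_map; exact/integral_algebraic/alg.
  have xint : integralOver io x'.
    by case: x'alg => p p0 px; exact: integral_root p0 px (inta p).
  move=> b; rewrite /= /horner_eval; apply/integral_algebraic.
  by apply: integral_horner => //; exact: inta.
case: (pselect (exists mu : {poly A}, map_poly rho mu != 0 /\ (map_poly rho mu).[x] = 0)); last first.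
  move=> transc.
  have a0 : map_poly rho a != 0 by apply: contraNneq ax0 => ->; rewrite horner0.
  exists (a`_(size (map_poly rho a)).-1); split.
    by rewrite -coef_map -lead_coefE lead_coef_eq0.
  move=> rho' ker ra'; have a'0 : map_poly rho' a != 0.
    by apply: contraNneq ra' => e; rewrite -coef_map e coef0.
  have [n an] := nonroot_nat char0 a'0.
  exists n%:R; split=> //.
    exists ('X - n%:R%:P); rewrite rmorphB /= map_polyX map_polyC /= rmorph_nat.
      by rewrite polyXsubC_eq0.
    by rewrite root_XsubC.
  move=> b bx; have : map_poly rho b = 0.
    by apply/eqP; apply: contra_notT transc => b0; exists b.
  move=> b0; suff -> : map_poly rho' b = 0 by rewrite horner0.
  by apply/polyP => i; rewrite coef0 coef_map /= ker // -coef_map b0 coef0.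
move=> alg.
pose Q n := `[< exists mu : {poly A}, [/\ map_poly rho mu != 0, (map_poly rho mu).[x] = 0
  & size (map_poly rho mu) = n] >].
have exQ : exists n, Q n.
  by have [mu [mu0 mux]] := alg; exists (size (map_poly rho mu)); apply/asboolP; exists mu.
have [n /asboolP[mu0 [nz0 mux0 sz0]] minQ] := ex_minnP exQ.
(* Truncation removes the top coefficients of [mu0] that [rho] kills, so that [mu] and its image
   have the same size. *)
pose mu := take_poly n mu0.
have muE : map_poly rho mu = map_poly rho mu0.
  apply/polyP => i; rewrite !coef_map coef_take_poly; case: (ltnP i n) => // ni.
  have : (map_poly rho mu0)`_i = 0 by rewrite nth_default // sz0.
  by rewrite coef_map /= => ->; rewrite rmorph0.
have [nz mux] : map_poly rho mu != 0 /\ (map_poly rho mu).[x] = 0 by rewrite muE.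
have n0 : (0 < n)%N by rewrite -sz0 size_poly_gt0.
have lead : rho mu`_n.-1 != 0 by rewrite -coef_map muE -sz0 -lead_coefE lead_coef_eq0.
have smu : size mu = n.
  apply/eqP; rewrite eqn_leq size_take_poly /= leqNgt; apply: contra lead => sm.
  by rewrite nth_default ?rmorph0 // -ltnS prednK.
have lE : lead_coef mu = mu`_n.-1 by rewrite lead_coefE smu.
have small (r : {poly A}) : (size r < n)%N -> (map_poly rho r).[x] = 0 -> map_poly rho r = 0.
  move=> sr rx; apply/eqP; apply: contraT => r0.
  have := minQ (size (map_poly rho r)); rewrite leqNgt => /(_ _)/negP.
  case; last exact: leq_ltn_trans (size_poly _ _) sr.
  by apply/asboolP; exists r.
(* [A] is only a ring, hence pseudo-division. The power [a ^+ n] is divided because the specialized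
   [mu] has [n - 1] roots with multiplicity: if [a] vanished at all of them, [mu] would divide
   [a ^+ n], hence also [r], which is shorter and is kept nonzero by [a0]. *)
pose k := Pdiv.Ring.rscalp (a ^+ n) mu; pose r := Pdiv.Ring.rmodp (a ^+ n) mu.
pose q := Pdiv.Ring.rdivp (a ^+ n) mu.
have div : lead_coef mu ^+ k *: a ^+ n = q * mu + r := Pdiv.ComRing.rdivp_eq _ _.
have mu_n0 : mu != 0 by rewrite -size_poly_gt0 smu.
have sr : (size r < n)%N by rewrite -smu Pdiv.CommonRing.ltn_rmodp.
have divx (rho' : {rmorphism A -> F}) (y : F) : (map_poly rho' mu).[y] = 0 ->
    rho' (lead_coef mu) ^+ k * (map_poly rho' a).[y] ^+ n = (map_poly rho' r).[y].
  move=> muy; have := congr1 (fun p => (map_poly rho' p).[y]) div.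
  by rewrite -mul_polyC !(rmorphM, rmorphD, rmorphXn) /= map_polyC !hornerE muy mulr0 add0r.
have r0 : map_poly rho r != 0.
  apply/eqP => e; have /eqP := divx rho x mux.
  by rewrite e horner0 mulf_eq0 !expf_eq0 lE (negPf lead) (negPf ax0) !andbF.
exists (mu`_n.-1 * r`_(size (map_poly rho r)).-1); split.
  by rewrite rmorphM mulf_neq0 // -coef_map -lead_coefE lead_coef_eq0.
move=> rho' ker; rewrite rmorphM mulf_eq0 negb_or => /andP[lead' r'0].
have smu' : size (map_poly rho' mu) = n by rewrite size_poly_eq smu.
have n1 : (1 < n)%N.
  rewrite ltn_neqAle n0 andbT; apply: contraTneq nz => n1.
  have /size_poly1P[c c0 cE] : size (map_poly rho mu) == 1%N by rewrite muE sz0 -n1.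
  by move: mux; rewrite cE hornerC => /eqP; rewrite (negPf c0).
suff [x' x'mu ax'] : exists2 x', root (map_poly rho' mu) x' & (map_poly rho' a).[x'] != 0.
  exists x'; split=> //.
    by exists mu => //; rewrite -size_poly_gt0 smu'.
  move=> b bx; pose l := lead_coef mu ^+ Pdiv.Ring.rscalp b mu.
  have bdiv : l *: b = Pdiv.Ring.rdivp b mu * mu + Pdiv.Ring.rmodp b mu := Pdiv.ComRing.rdivp_eq _ _.
  have rb : map_poly rho (Pdiv.Ring.rmodp b mu) = 0.
    apply: small; first by rewrite -smu Pdiv.CommonRing.ltn_rmodp.
    have := congr1 (fun p => (map_poly rho p).[x]) bdiv.
    by rewrite -mul_polyC !(rmorphM, rmorphD) /= map_polyC !hornerE mux bx !mulr0 add0r.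
  have rb' : map_poly rho' (Pdiv.Ring.rmodp b mu) = 0.
    by apply/polyP => i; rewrite coef0 coef_map /= ker // -coef_map rb coef0.
  have := congr1 (fun p => (map_poly rho' p).[x']) bdiv.
  rewrite -mul_polyC !(rmorphM, rmorphD) /= map_polyC !hornerE rb' (rootP x'mu).
  rewrite horner0 mulr0 addr0 => /eqP; rewrite mulf_eq0.
  have l0 : rho' l != 0 by rewrite /l rmorphXn expf_neq0 //= lE.
  by rewrite (negPf l0) => /eqP.
apply: contrapT => nox.
have roots y : root (map_poly rho' mu) y -> (map_poly rho' a).[y] = 0.
  by move=> muy; apply/eqP; apply: contra_notT nox => ay; exists y.
have : map_poly rho' mu %| map_poly rho' r.
  have [rs rsE] := closed_field_poly_normal (map_poly rho' mu).
  have : map_poly rho' mu %| map_poly rho' a ^+ n.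
    have lc0 : lead_coef (map_poly rho' mu) != 0 by rewrite lead_coef_eq0 -size_poly_gt0 smu'.
    have srs : size rs = n.-1.
      by have := smu'; rewrite rsE size_scale // size_prod_XsubC => <-.
    rewrite rsE dvdpZl // -(subnK (leq_pred n)) exprD -srs dvdp_mull //.
    have : all (root (map_poly rho' a)) rs.
      apply/allP => y yrs; rewrite rootE; apply/eqP/roots.
      by rewrite rsE rootZ // root_prod_XsubC.
    elim: {srs rsE} rs => [|y rs IH]; first by rewrite big_nil dvd1p.
    move=> /= /andP[ry ars]; rewrite big_cons exprS dvdp_mul ?IH //.
    by rewrite dvdp_XsubCl.
  move=> dv; have := congr1 (map_poly rho') div.
  rewrite -mul_polyC !(rmorphM, rmorphD, rmorphXn) /= => /esym/(canRL (addKr _)) ->.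
  by apply: dvdp_add; [rewrite dvdpNr dvdp_mull | exact: dvdp_mull dv].
move=> /dvdp_leq; have r'nz : map_poly rho' r != 0.
  by apply: contraNneq r'0 => e; rewrite -coef_map e coef0.
by move/(_ r'nz); rewrite smu' leqNgt (leq_ltn_trans (size_poly _ _) sr).
Qed.

Lemma specializable_ex (s : seq F) : exists (A : comNzRingType) (kap : {rmorphism K -> A})
  (rho : {rmorphism A -> F}), specializable kap rho /\ forall x, x \in s -> exists a, rho a = x.
Proof.
elim: s => [|x s [A [kap [rho [spec sub]]]]].
  exists K, idfun, io; split=> //; split=> // a a0.
  by exists io; split=> // b; exact: algebraic_id.
exists {poly A}, (@polyC A \o kap), (horner_eval x \o map_poly rho).
split; first exact: specializable_poly.
move=> y; rewrite inE => /orP[/eqP ->|/sub[a aE]].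
  by exists 'X; rewrite /= /horner_eval map_polyX hornerX.
by exists a%:P; rewrite /= /horner_eval map_polyC hornerC.
Qed.

End Specialization.

Section PrimitiveElement.
Variables (K F : fieldType) (io : {rmorphism K -> F}).

(** Polynomial expressions are enough: for [th] algebraic they already form a field, by
    [adjoinedV]. *)
Definition adjoined (th x : F) := exists r : {poly K}, x = (map_poly io r).[th].

Lemma adjoined_trans x y z : adjoined z y -> adjoined y x -> adjoined z x.
Proof.
by move=> [r ->] [s ->]; exists (s \Po r); rewrite map_comp_poly horner_comp.
Qed.

Lemma primitive_element (s : seq F) : [pchar F] =i pred0 ->
  (forall x, x \in s -> algebraicOver io x) ->
  exists th, algebraicOver io th /\ forall x, x \in s -> adjoined th x.
Proof.
move=> char0; elim: s => [|x s IH] alg.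
  by exists 0; split=> //; exact: algebraic0.
have [|th [[q q0 qth] sP]] := IH; first by move=> y ys; apply: alg; rewrite inE ys orbT.
have [|p p0 px] := alg x; first exact: mem_head.
have char0K : [pchar K] =i pred0 by move=> n; rewrite -(fmorph_pchar io) char0.
have [n [[r rx] [r' r'th]]] := pchar0_PET p0 px q0 qth char0K.
exists (th *+ n - x); split.
  apply: algebraic_sub; last by exists p.
  rewrite -mulr_natl; apply: algebraic_mul; last by exists q.
  by rewrite -(rmorph_nat io); exact: algebraic_id.
move=> y; rewrite inE => /orP[/eqP ->|/sP]; first by exists r.
by apply: adjoined_trans; exists r'.
Qed.

(** [K(th)] becomes a type of its own, with [e0] as one embedding into [F] among others; the
    conjugates of [th] provide the remaining ones in [conj_embed]. *)
Lemma simple_extension (th : F) : algebraicOver io th ->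
  exists (E : fieldType) (kap : {rmorphism K -> E}) (e0 : {rmorphism E -> F}) (thE : E),
    [/\ forall k, e0 (kap k) = io k, e0 thE = th
      & forall e, exists r, e = (map_poly kap r).[thE]].
Proof.
move=> [p p0 pth]; exists (subFExtend io th p), (@inj_subfx _ _ io th p).
exists (@subfx_inj _ _ io th p), (@subfx_root _ _ io th p); split.
- by move=> k; rewrite /= subfx_inj_eval // map_polyC hornerC.
- exact: subfx_inj_root.
move=> e; have [r ->] := subfxE e; exists r.
apply: (fmorph_inj (@subfx_inj _ _ io th p)).
apply: etrans (subfx_inj_eval pth p0 r) _.
apply: etrans _ (horner_map (@subfx_inj _ _ io th p) _ _).
transitivity (map_poly (@subfx_inj _ _ io th p)
    (map_poly (@inj_subfx _ _ io th p) r)).[th]; last first.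
  by congr (_.[_]); exact/esym/subfx_inj_root.
rewrite -map_poly_comp; congr (_.[_]); apply: eq_map_poly => k /=.
by rewrite subfx_inj_eval // map_polyC hornerC.
Qed.

End PrimitiveElement.

Section CoefficientMap.
Variables (E F : fieldType) (e : {rmorphism E -> F}).

Definition mapF0 (p : {poly E}) : F(t) := (map_poly e p)%:F.

Lemma mapF0_zmod : zmod_morphism mapF0.
Proof. by move=> p q; rewrite /mapF0 rmorphB tofracB. Qed.

Lemma mapF0_monoid : monoid_morphism mapF0.
Proof. by split=> [|p q]; rewrite /mapF0 ?rmorph1 ?tofrac1 // rmorphM tofracM. Qed.

HB.instance Definition _ :=
  GRing.isZmodMorphism.Build {poly E} F(t) mapF0 mapF0_zmod.
HB.instance Definition _ :=
  GRing.isMonoidMorphism.Build {poly E} F(t) mapF0 mapF0_monoid.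

Lemma mapF0_inj p : mapF0 p = 0 -> p = 0.
Proof. by move/eqP; rewrite /mapF0 /= tofrac_eq0 map_poly_eq0 => /eqP. Qed.

Definition mapF : E(t) -> F(t) := frac_lift mapF0_inj.
HB.instance Definition _ := GRing.RMorphism.on mapF.

Lemma mapF_poly p : mapF p%:F = (map_poly e p)%:F.
Proof. exact: frac_lift_tofrac. Qed.

Lemma mapF_frac p q : q != 0 ->
  mapF (p%:F / q%:F) = (map_poly e p)%:F / (map_poly e q)%:F.
Proof. exact: frac_liftE. Qed.

Lemma mapF_cst c : mapF (cst c) = cst (e c).
Proof. by rewrite /cst /= mapF_poly map_polyC. Qed.

Lemma mapF_t : mapF tF = tF.
Proof. by rewrite /tF mapF_poly map_polyX. Qed.

Lemma mapF_ev N (Y : 'I_N -> E(t)) (p : {mpoly E[N]}) :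
  mapF (ev (@cst E) Y p) = ev (@cst F) (fun i => mapF (Y i)) (map_mpoly e p).
Proof.
exact: (ev_morph (c := @cst E) (c' := @cst F) (tau := mapF) Y mapF_cst).
Qed.

End CoefficientMap.

Section Lifting.
Variables (A F : comNzRingType) (rho : {rmorphism A -> F}).

Lemma lift_poly (p : {poly F}) : (forall x, x \in polyseq p -> exists a, rho a = x) ->
  exists p', map_poly rho p' = p.
Proof.
move=> pP; have /choice[al alP] (i : nat) : exists a, rho a = p`_i.
  have [ip|pi] := ltnP i (size p); first exact/pP/mem_nth.
  by exists 0; rewrite nth_default // rmorph0.
exists (\poly_(i < size p) al i); apply/polyP => i.
by rewrite coef_map coef_poly /=; case: ltnP => pi; rewrite ?alP // nth_default // rmorph0.
Qed.

Lemma lift_mpoly N (p : {mpoly F[N]}) :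
  (forall x, x \in [seq p@_m | m <- msupp p] -> exists a, rho a = x) ->
  exists p', map_mpoly rho p' = p.
Proof.
move=> pP; have /choice[al alP] (m : 'X_{1..N}) : exists a, rho a = p@_m.
  have [mp|mp] := boolP (m \in msupp p); first exact/pP/map_f.
  by exists 0; rewrite rmorph0 memN_msupp_eq0.
exists (\sum_(m <- msupp p) al m *: 'X_[m]).
rewrite [RHS]mpolyE rmorph_sum; apply: eq_bigr => m _.
by rewrite /= map_mpolyZ map_mpolyX alP.
Qed.

End Lifting.

Section ClearDenominators.
Variables (N : nat) (A : comNzRingType) (F : fieldType).
Variables (fA : 'I_N -> {poly A}) (gA : {poly A}).

Definition specialized (rho : {rmorphism A -> F}) i : F(t) :=
  (map_poly rho (fA i))%:F / (map_poly rho gA)%:F.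

(** The order of the quantifiers matters: one [pt] serves all [rho]. The vanishing of [p] at the
    specialized point thus depends only on which coefficients of [pt] are killed, and passes from
    [rho] to any [rho'] with a larger kernel. *)
Definition clearable (p : {mpoly A[N]}) := exists d (pt : {poly A}),
  forall rho : {rmorphism A -> F}, map_poly rho gA != 0 ->
  ev (@cst F) (specialized rho) (map_mpoly rho p) =
    (map_poly rho pt)%:F / ((map_poly rho gA) ^+ d)%:F.

Lemma clearableM p q : clearable p -> clearable q -> clearable (p * q).
Proof.
move=> [d [pt pE]] [d' [qt qE]]; exists (d + d')%N, (pt * qt) => rho g0.
rewrite rmorphM [LHS]rmorphM /= pE // qE // rmorphM exprD !tofracM.
exact: mulf_div.
Qed.

Lemma clearableD p q : clearable p -> clearable q -> clearable (p + q).
Proof.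
move=> [d [pt pE]] [d' [qt qE]].
exists (d + d')%N, (pt * gA ^+ d' + qt * gA ^+ d) => rho g0.
have -> : map_poly rho (pt * gA ^+ d' + qt * gA ^+ d) =
    map_poly rho pt * map_poly rho gA ^+ d' + map_poly rho qt * map_poly rho gA ^+ d.
  by rewrite rmorphD !rmorphM !rmorphXn.
rewrite rmorphD [LHS]rmorphD /= pE // qE // exprD.
rewrite tofracD !tofracM; apply: addf_div; by rewrite tofrac_eq0 expf_neq0.
Qed.

Lemma clearableC c : clearable c%:MP.
Proof.
exists 0, c%:P => rho g0.
by rewrite map_mpolyC evC expr0 tofrac1 divr1 map_polyC.
Qed.

Lemma clearableX i : clearable 'X_i.
Proof. by exists 1, (fA i) => rho g0; rewrite map_mpolyX evX expr1. Qed.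

Lemma clearable_all p : clearable p.
Proof.
rewrite [p]mpolyE; apply: (big_ind clearable) => [|p1 p2|m _].
- exact: (clearableC 0).
- exact: clearableD.
rewrite -mul_mpolyC; apply: clearableM; first exact: clearableC.
rewrite mpolyXE_id; apply: (big_ind clearable) => [|p1 p2|i _].
- exact: (clearableC 1).
- exact: clearableM.
elim: (m i) => [|k IH]; first by rewrite expr0; exact: (clearableC 1).
by rewrite exprS; apply: clearableM IH; exact: clearableX.
Qed.

Variables (rho rho' : {rmorphism A -> F}).
Hypothesis ker : forall b, rho b = 0 -> rho' b = 0.

Lemma map_poly_ker (p : {poly A}) : map_poly rho p = 0 -> map_poly rho' p = 0.
Proof.
move=> e; apply/polyP => i; rewrite coef0 coef_map /= ker //.
by rewrite -coef_map e coef0.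
Qed.

Lemma ev_ker (p : {mpoly A[N]}) : map_poly rho gA != 0 -> map_poly rho' gA != 0 ->
  ev (@cst F) (specialized rho) (map_mpoly rho p) = 0 ->
  ev (@cst F) (specialized rho') (map_mpoly rho' p) = 0.
Proof.
move=> g0 g0'; have [d [pt pE]] := clearable_all p.
rewrite !pE // => /eqP; rewrite mulf_eq0 invr_eq0 !tofrac_eq0 expf_eq0 (negPf g0).
by rewrite andbF orbF => /eqP/map_poly_ker ->; rewrite tofrac0 mul0r.
Qed.

Lemma quot_ker (p q : {mpoly A[N]}) : map_poly rho gA != 0 -> map_poly rho' gA != 0 ->
  tF * ev (@cst F) (specialized rho) (map_mpoly rho q) =
        ev (@cst F) (specialized rho) (map_mpoly rho p) ->
  tF * ev (@cst F) (specialized rho') (map_mpoly rho' q) =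
        ev (@cst F) (specialized rho') (map_mpoly rho' p).
Proof.
move=> g0 g0' e.
have [d [pt pE]] := clearable_all p; have [d' [qt qE]] := clearable_all q.
move: e; rewrite !pE // !qE // !mulrA.
move=> /eqP; rewrite eqr_div ?tofrac_eq0 ?expf_neq0 // -!tofracM tofrac_eq => /eqP e.
apply/eqP; rewrite eqr_div ?tofrac_eq0 ?expf_neq0 // -!tofracM tofrac_eq; apply/eqP.
apply/eqP; rewrite -subr_eq0.
have mX (r : {rmorphism A -> F}) : 'X = map_poly r 'X by rewrite map_polyX.
rewrite (mX rho') -!rmorphXn -!rmorphM -rmorphB; apply/eqP/map_poly_ker.
by rewrite rmorphB !rmorphM !rmorphXn /= map_polyX e subrr.
Qed.

End ClearDenominators.

Section AlgebraicParametrization.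
Variables (K : fieldType) (F : closedFieldType) (io : {rmorphism K -> F}).
Variables (N : nat) (C : irreducible_curve F N).
Hypothesis char0 : [pchar F] =i pred0.

Definition curve_defined := forall p, p \in curve_ideal C ->
  exists n (c : 'I_n -> {mpoly F[N]}) (g : 'I_n -> {mpoly K[N]}),
    (forall i, map_mpoly io (g i) \in curve_ideal C) /\
    p = \sum_i c i * map_mpoly io (g i).

Hypothesis C_def : curve_defined.

Lemma curve_defined_over X : is_param C X -> defined_over io (@cst F) X.
Proof.
move=> [kerX _] p /kerX/C_def[n [c [g [gC pE]]]].
by exists n, c, g; split=> // i; rewrite -ev_map; apply/kerX.
Qed.

(** Relations over [K] are enough since they generate the ideal of the curve. That [Y] satisfies no
    further relation is [param_ker]. *)
Lemma is_param_specialized X Y : is_param C X -> coord_field (@cst F) Y tF ->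
  (forall p : {mpoly K[N]}, ev (@cst F) X (map_mpoly io p) = 0 ->
     ev (@cst F) Y (map_mpoly io p) = 0) -> is_param C Y.
Proof.
move=> [kerX _] tY XY.
have XY' p : ev (@cst F) X p = 0 -> ev (@cst F) Y p = 0.
  move=> /kerX/C_def[n [c [g [gC ->]]]]; rewrite rmorph_sum big1 // => i _.
  by rewrite rmorphM /= XY ?mulr0 //; exact/kerX.
split=> // p; rewrite kerX; split; first exact: XY'.
exact: param_ker.
Qed.

(** The coefficients of the coordinates, written with a common denominator [g], and those of an
    expression [p / q] of [tF] in the coordinates are lifted to [A] and specialized to algebraic
    values. The element [a] keeps [g] and the value of [q] nonzero. The finitely many values
    obtained lie in one simple extension [E] of [K]. *)
Lemma algebraic_param X : is_param C X ->
  exists (E : fieldType) (kap : {rmorphism K -> E}) (e0 : {rmorphism E -> F})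
    (th : E) (Y : 'I_N -> E(t)),
  [/\ forall k, e0 (kap k) = io k, algebraicOver io (e0 th),
    forall e, exists r, e = (map_poly kap r).[th],
    is_param C (fun i => mapF e0 (Y i)) & coord_field (@cst E) Y tF].
Proof.
move=> pX; have [kerX /coord_fieldE[p [q [q0 tE]]]] := pX.
pose Z (z : F(t)) := exists p : {poly F}, z = p%:F.
have [|x y [a ->] [b ->]|i|_ [[g ->]]] := @common_denom _ Z _ X.
- by exists 1; rewrite tofrac1.
- by exists (a * b); rewrite tofracM.
- have [a [b [b0 ->]]] := frac_ex (X i); exists a%:F, b%:F.
  by split; [exists a|exists b|rewrite tofrac_eq0|].
rewrite tofrac_eq0 => g0 /choice[f fE].
have XE i : X i = (f i)%:F / g%:F.
  have gF0 : g%:F != 0 by rewrite tofrac_eq0.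
  by apply: (canRL (mulfK gF0)); rewrite -fE mulrC.
pose s : seq F := g ++ [seq p@_m | m <- msupp p] ++ [seq q@_m | m <- msupp q]
  ++ flatten [seq (polyseq (f i)) | i <- enum 'I_N].
have [A [kapA [rho [[rk spec] sub]]]] := specializable_ex io char0 s.
have [gA gAE] : exists gA, map_poly rho gA = g.
  by apply: lift_poly => x xg; apply: sub; rewrite /s !mem_cat xg.
have [pA pAE] : exists pA, map_mpoly rho pA = p.
  by apply: lift_mpoly => x xg; apply: sub; rewrite /s !mem_cat xg !orbT.
have [qA qAE] : exists qA, map_mpoly rho qA = q.
  by apply: lift_mpoly => x xg; apply: sub; rewrite /s !mem_cat xg !orbT.
have /choice[fA fAE] (i : 'I_N) : exists fi, map_poly rho fi = f i.
  apply: lift_poly => x xg; apply: sub; rewrite /s !mem_cat.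
  by rewrite (_ : x \in flatten _) ?orbT //; apply/flatten_mapP; exists i; rewrite ?mem_enum.
have grho : map_poly rho gA != 0 by rewrite gAE.
have XrE : specialized fA gA rho = X by apply/funext => i; rewrite /specialized gAE fAE -XE.
have [d [qt qtE]] := @clearable_all N A F fA gA qA.
have qt0 : map_poly rho qt != 0.
  apply: contraNneq q0 => e; have := qtE rho grho.
  by rewrite XrE qAE e tofrac0 mul0r => ->.
have lc_coef (r : {poly A}) : map_poly rho r != 0 ->
    rho r`_(size (map_poly rho r)).-1 != 0.
  by move=> r0; rewrite -coef_map -lead_coefE lead_coef_eq0.
pose a := gA`_(size (map_poly rho gA)).-1 * qt`_(size (map_poly rho qt)).-1.
have [|rho' [rk' ker a0' alg]] := spec a; first by rewrite rmorphM mulf_neq0 ?lc_coef.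
move: a0'; rewrite rmorphM mulf_eq0 negb_or => /andP[ga' qa'].
have nz (r : {poly A}) j : rho' r`_j != 0 -> map_poly rho' r != 0.
  by move=> rj; apply: contraNneq rj => e; rewrite -coef_map e coef0.
have {ga'} g0' := nz _ _ ga'; have {qa'} qt0' := nz _ _ qa'.
pose Y := specialized fA gA rho'.
have q0' : ev (@cst F) Y (map_mpoly rho' qA) != 0.
  rewrite /Y (qtE rho' g0').
  apply: mulf_neq0.
  by rewrite tofrac_eq0.
  by rewrite invr_eq0 tofrac_eq0 expf_neq0.
have tE' : tF = ev (@cst F) Y (map_mpoly rho' pA) / ev (@cst F) Y (map_mpoly rho' qA).
  apply: (canRL (mulfK q0')); apply: (quot_ker ker grho g0').
  by rewrite XrE pAE qAE tE (divfK q0).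
have mio (r : {rmorphism A -> F}) (pK : {mpoly K[N]}) : (forall k, r (kapA k) = io k) ->
    map_mpoly io pK = map_mpoly r (map_mpoly kapA pK).
  by move=> rkE; apply/mpolyP => m; rewrite !mcoeff_map_mpoly /= rkE.
have pY : is_param C Y.
  apply: (is_param_specialized pX).
    by apply/coord_fieldE; exists (map_mpoly rho' pA), (map_mpoly rho' qA).
  move=> pK h; rewrite (mio rho' pK rk'); rewrite (mio rho pK rk) in h.
  by apply: (ev_ker ker grho g0'); rewrite XrE.
pose s' : seq F := map_poly rho' gA ++ [seq c | c <- [seq (map_mpoly rho' pA)@_m | m <- msupp (map_mpoly rho' pA)]]
  ++ [seq (map_mpoly rho' qA)@_m | m <- msupp (map_mpoly rho' qA)]
  ++ flatten [seq (polyseq (map_poly rho' (fA i))) | i <- enum 'I_N].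
have im_poly (r : {poly A}) x : x \in polyseq (map_poly rho' r) -> exists b, x = rho' b.
  by move=> /(nthP 0)[i _ <-]; exists r`_i; rewrite coef_map.
have im_mpoly (r : {mpoly A[N]}) x :
    x \in [seq (map_mpoly rho' r)@_m | m <- msupp (map_mpoly rho' r)] -> exists b, x = rho' b.
  by move=> /mapP[m _ ->]; exists r@_m; rewrite mcoeff_map_mpoly.
have [|th0 [th0alg th0P]] := @primitive_element _ _ io s' char0.
  move=> x xs; suff [b ->] : exists b, x = rho' b by exact: alg.
  move: xs; rewrite /s' map_id !mem_cat.
  case/or4P => [/im_poly//|/im_mpoly//|/im_mpoly//|].
  by move=> /flatten_mapP[i _ /im_poly].
have [E [kap [e0 [thE [e0k e0th Egen]]]]] := simple_extension th0alg.
have imE x : x \in s' -> exists e, e0 e = x.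
  move=> /th0P[r ->]; exists (map_poly kap r).[thE].
  rewrite -horner_map /= e0th -map_poly_comp; congr (_.[_]).
  by apply: eq_map_poly => k /=.
have [gE gEE] : exists gE, map_poly e0 gE = map_poly rho' gA.
  by apply: lift_poly => x xg; apply: imE; rewrite /s' !mem_cat xg.
have [pE pEE] : exists pE, map_mpoly e0 pE = map_mpoly rho' pA.
  by apply: lift_mpoly => x xg; apply: imE; rewrite /s' map_id !mem_cat xg !orbT.
have [qE qEE] : exists qE, map_mpoly e0 qE = map_mpoly rho' qA.
  by apply: lift_mpoly => x xg; apply: imE; rewrite /s' !mem_cat xg !orbT.
have /choice[fE' fEE] (i : 'I_N) : exists fi, map_poly e0 fi = map_poly rho' (fA i).
  apply: lift_poly => x xg; apply: imE; rewrite /s' !mem_cat.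
  by rewrite (_ : x \in flatten _) ?orbT //; apply/flatten_mapP; exists i; rewrite ?mem_enum.
pose YE i : E(t) := (fE' i)%:F / gE%:F.
have YEE : (fun i => mapF e0 (YE i)) = Y.
  have gE0 : gE != 0 by rewrite -(map_poly_eq0 e0) gEE.
  by apply/funext => i; rewrite /YE (mapF_frac _ _ gE0) fEE gEE.
exists E, kap, e0, thE, YE; split=> //; first by rewrite e0th.
  by rewrite YEE.
have mE r : mapF e0 (ev (@cst E) YE r) = ev (@cst F) Y (map_mpoly e0 r).
  by rewrite mapF_ev YEE.
apply/coord_fieldE; exists pE, qE; split.
  apply/eqP => e; move/eqP: q0'; apply; rewrite -qEE -mE e; exact: rmorph0.
apply: (fmorph_inj (mapF e0)); apply: etrans (mapF_t e0) _.
have d1 := mE pE; have d2 := mE qE; rewrite pEE in d1; rewrite qEE in d2.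
by rewrite [LHS]tE' -d1 -d2; exact/esym/(fmorph_div (mapF e0)).
Qed.

End AlgebraicParametrization.

(** * Galois descent *)

Section SubfieldType.
Variables (L : fieldType) (S : {pred L}).

Definition divring_pred of divring_closed S : {pred L} := S.
Variable S_closed : divring_closed S.
Local Notation P := (divring_pred S_closed).

HB.instance Definition _ := GRing.isDivringClosed.Build L P S_closed.

Definition subfield_type := {x : L | x \in P}.
HB.instance Definition _ := SubChoice.on subfield_type.
HB.instance Definition _ := [SubChoice_isSubIntegralDomain of subfield_type by <:].
HB.instance Definition _ := [SubIntegralDomain_isSubField of subfield_type by <:].

Lemma subfield_ex : exists (M : fieldType) (i : {rmorphism M -> L}),
  forall x, x \in S <-> exists m, i m = x.
Proof.
exists subfield_type, val => x; split=> [xS|[m <-]]; last exact: valP.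
by exists (exist _ x xS).
Qed.

End SubfieldType.

Section Adjoined.
Variables (M L : fieldType) (i : {rmorphism M -> L}) (th : L).
Hypothesis th_alg : algebraicOver i th.

Lemma adjoined_base m : adjoined i th (i m).
Proof. by exists m%:P; rewrite map_polyC hornerC. Qed.

Lemma adjoined_gen : adjoined i th th.
Proof. by exists 'X; rewrite map_polyX hornerX. Qed.

Lemma adjoinedD x y : adjoined i th x -> adjoined i th y -> adjoined i th (x + y).
Proof. by move=> [p ->] [q ->]; exists (p + q); rewrite rmorphD hornerD. Qed.

Lemma adjoinedM x y : adjoined i th x -> adjoined i th y -> adjoined i th (x * y).
Proof. by move=> [p ->] [q ->]; exists (p * q); rewrite rmorphM hornerM. Qed.

Lemma adjoinedN x : adjoined i th x -> adjoined i th (- x).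
Proof. by move=> [p ->]; exists (- p); rewrite rmorphN hornerN. Qed.

Lemma adjoined_alg x : adjoined i th x -> algebraicOver i x.
Proof.
move=> [p ->]; apply/integral_algebraic/integral_horner.
  by apply/integral_poly => j; rewrite coef_map; exact: integral_id.
exact/integral_algebraic.
Qed.

(** An equation of [x] with nonzero constant term, divided by that term, exhibits the inverse of [x]
    as a polynomial in [x]. *)
Lemma adjoinedV x : adjoined i th x -> adjoined i th x^-1.
Proof.
move=> Ax; have [x0|x0] := eqVneq x 0.
  by rewrite x0 invr0 -(rmorph0 i); exact: adjoined_base.
suff h : adjoined i x x^-1 by exact: adjoined_trans Ax h.
have [p p0] := adjoined_alg Ax; elim/poly_ind: p p0 => [|p c IH] p0.
  by rewrite eqxx in p0.
rewrite rootE rmorphD rmorphM /= map_polyX map_polyC hornerMXaddC /=.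
have [c0|c0] := eqVneq c 0.
  rewrite c0 rmorph0 addr0 mulf_eq0 (negPf x0) orbF => px; apply: IH => //.
  by apply: contraNneq p0 => ->; rewrite c0 mul0r polyC0 addr0.
rewrite addr_eq0 => /eqP e; exists ((- c^-1)%:P * p).
rewrite rmorphM /= map_polyC hornerM hornerC /= rmorphN fmorphV.
have ic0 : i c != 0 by rewrite fmorph_eq0.
by apply: (mulIf x0); rewrite mulVf // -mulrA e mulrNN mulVf.
Qed.

End Adjoined.

Lemma ev_morphK N (K : comNzRingType) (L L' : fieldType) (c : {rmorphism K -> L})
    (c' : {rmorphism K -> L'}) (tau : {rmorphism L -> L'}) (X : 'I_N -> L) (Y : 'I_N -> L') :
  (forall k, tau (c k) = c' k) -> (forall i, tau (X i) = Y i) ->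
  forall p, tau (ev c X p) = ev c' Y p.
Proof.
move=> tc tX; pose f : {rmorphism {mpoly K[N]} -> L'} := tau \o ev c X.
have fg : f =1 ev c' Y by apply: mpoly_hom_eq => [k|i] /=; rewrite ?evC ?evX.
exact: fg.
Qed.

Section Span.
Variables (N : nat) (K E L : fieldType) (kap : {rmorphism K -> E}) (c : {rmorphism E -> L}).
Variables (Y : 'I_N -> L) (th : E).
Hypothesis Egen : forall e, exists r, e = (map_poly kap r).[th].

Lemma coord_field_divring : divring_closed (fun x : L => `[< coord_field (c \o kap) Y x >]).
Proof.
split; first exact/asboolP/coord_field1.
  move=> x y /asboolP hx /asboolP hy; apply/asboolP; apply: coord_fieldD => //; exact: coord_fieldN.
move=> x y /asboolP hx /asboolP hy; apply/asboolP; apply: coord_fieldM => //; exact: coord_fieldV.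
Qed.

(** [E(Y)] is obtained from [K(Y)] by adjoining [c th], so [w] is a polynomial in [c th], to be
    reduced modulo [mu]. [M] is a copy of [K(Y)] as a type, over which polynomials can be
    divided. *)
Lemma coord_field_span (mu : {poly K}) (w : L) : mu != 0 -> root (map_poly kap mu) th ->
  coord_field c Y w -> exists q : {poly L},
  [/\ forall i, coord_field (c \o kap) Y q`_i, (size q < size mu)%N & w = q.[c th]].
Proof.
move=> mu0 muth /coord_fieldE[p [q [q0 ->]]].
have [M [i iP]] := subfield_ex coord_field_divring.
have iP' x : coord_field (c \o kap) Y x <-> exists m, i m = x.
  by rewrite -iP; split=> [?|/asboolP//]; apply/asboolP.
have [muM muME] : exists muM, map_poly i muM = map_poly (c \o kap) mu.
  apply: lift_poly => x /(nthP 0)[j _ <-]; apply/iP'; rewrite coef_map; exact: coord_fieldC.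
have muM0 : muM != 0 by rewrite -(map_poly_eq0 i) muME map_poly_eq0.
have muMth : root (map_poly i muM) (c th).
  by rewrite muME map_poly_comp fmorph_root.
have alg : algebraicOver i (c th) by exists muM.
have adK k : adjoined i (c th) (c (kap k)).
  have /iP'[m <-] : coord_field (c \o kap) Y (c (kap k)) := coord_fieldC (c \o kap) Y k.
  exact: adjoined_base.
have ad_sum (I : finType) (g : I -> L) : (forall j, adjoined i (c th) (g j)) ->
    adjoined i (c th) (\sum_j g j).
  move=> h; apply: big_ind => [|x y|j _]; [|exact: adjoinedD|exact: h].
  by rewrite -(rmorph0 i); exact: adjoined_base.
have adX (x : L) n : adjoined i (c th) x -> adjoined i (c th) (x ^+ n).
  move=> h; elim: n => [|n IH]; first by rewrite expr0 -(rmorph1 i); exact: adjoined_base.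
  by rewrite exprS; apply: adjoinedM.
have adE e : adjoined i (c th) (c e).
  have [r ->] := Egen e; rewrite -horner_map /= horner_coef; apply: ad_sum => j.
  apply: adjoinedM; last by apply: adX; exact: adjoined_gen.
  by rewrite !coef_map; exact: adK.
have adY j : adjoined i (c th) (Y j).
  have /iP'[m <-] : coord_field (c \o kap) Y (Y j) := coord_fieldX (c \o kap) Y j.
  exact: adjoined_base.
have adev r : adjoined i (c th) (ev c Y r).
  rewrite [r]mpolyE rmorph_sum; apply: (big_ind (adjoined i (c th))) => [|x y|m _].
  - by rewrite -(rmorph0 i); exact: adjoined_base.
  - exact: adjoinedD.
  rewrite /= evZ; apply: adjoinedM; first exact: adE.
  rewrite mpolyXE_id rmorph_prod; apply: (big_ind (adjoined i (c th))) => [|x y|j _].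
  - by rewrite -(rmorph1 i); exact: adjoined_base.
  - exact: adjoinedM.
  by rewrite rmorphXn /= evX; exact/adX/adY.
have [r rE] : adjoined i (c th) (ev c Y p / ev c Y q).
  by apply: adjoinedM; [exact: adev | exact/adjoinedV].
exists (map_poly i (r %% muM)); split.
- by move=> j; apply/iP'; exists (r %% muM)`_j; rewrite coef_map.
- by rewrite size_map_poly -(size_map_poly (c \o kap)) -muME size_map_poly ltn_modp.
rewrite rE {1}(divp_eq r muM) rmorphD rmorphM hornerD hornerM (rootP muMth).
by rewrite mulr0 add0r.
Qed.

End Span.

Lemma vandermonde_inv (F L : fieldType) (c : {rmorphism F -> L}) (n : nat)
    (r : 'I_n -> F) (z v : 'I_n -> L) : injective r ->
  (forall j, \sum_(i < n) c (r j ^+ i) * z i = v j) ->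
  exists d : 'I_n -> 'I_n -> F, forall i, z i = \sum_j c (d i j) * v j.
Proof.
move=> r_inj zv; pose V : 'M[F]_n := \matrix_(j, i) r j ^+ i.
have uV : V \in unitmx.
  have -> : V = (Vandermonde n (\row_j r j))^T by apply/matrixP => j i; rewrite !mxE.
  rewrite unitmx_tr unitmxE det_Vandermonde unitfE.
  apply/prodf_neq0 => i _; apply/prodf_neq0 => j ij; rewrite !mxE subr_eq0.
  by apply: contraTneq ij => /r_inj ->; rewrite ltnn.
exists (fun i j => invmx V i j) => i.
have := mulVmx uV; move=> /matrixP VV.
under eq_bigr do rewrite -zv mulr_sumr.
rewrite exchange_big /=.
have VE (k : 'I_n) : \sum_j c (invmx V i j) * (c (r j ^+ k) * z k) = (i == k)%:R * z k.
  under eq_bigr do rewrite mulrA -rmorphM.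
  rewrite -mulr_suml -rmorph_sum; congr (_ * _).
  have := VV i k; rewrite !mxE; under eq_bigr do rewrite !mxE.
  by move=> ->; rewrite rmorph_nat.
under eq_bigr do rewrite VE.
rewrite (bigD1 i) //= eqxx mul1r big1 ?addr0 // => k ki.
by rewrite eq_sym (negPf ki) mul0r.
Qed.

Section Conjugates.
Variables (K F : fieldType) (io : {rmorphism K -> F}) (th : F).

Lemma minimal_poly_ex : [pchar F] =i pred0 -> algebraicOver io th ->
  exists mu : {poly K}, [/\ mu != 0, root (map_poly io mu) th,
    forall p, root (map_poly io p) th -> mu %| p & separable_poly mu].
Proof.
move=> char0 [p0 p0n p0th].
pose Q n := `[< exists mu : {poly K}, [/\ mu != 0, root (map_poly io mu) th & size mu = n] >].
have exQ : exists n, Q n by exists (size p0); apply/asboolP; exists p0.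
have [n /asboolP[mu [mu0 muth smu]] minQ] := ex_minnP exQ.
have small (r : {poly K}) : root (map_poly io r) th -> (size r < size mu)%N -> r = 0.
  move=> rth sr; apply/eqP; apply: contraT => r0.
  have := minQ (size r); rewrite leqNgt -smu sr => /(_ _)/negP; case=> //.
  by apply/asboolP; exists r.
have mu_dvd p : root (map_poly io p) th -> mu %| p.
  move=> pth; apply/modp_eq0P/small; last by rewrite ltn_modp.
  move: pth; rewrite {1}(divp_eq p mu) !rootE rmorphD rmorphM hornerD hornerM.
  by rewrite (rootP muth) mulr0 add0r.
exists mu; split=> //.
have sep := make_separable mu0; set g := gcdp mu mu^`() in sep.
have g_dvd : g %| mu := dvdp_gcdl _ _.
have : root (map_poly io (mu %/ g)) th || root (map_poly io g) th.
  by rewrite -rootM -rmorphM divpK.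
case/orP => /mu_dvd h.
  by rewrite (eqp_separable (_ : mu %= mu %/ g)) // /eqp h divp_dvd.
have mu1 : (1 < size mu)%N.
  by rewrite -(size_map_poly io) (root_size_gt1 _ muth) ?map_poly_eq0.
have mu'0 : mu^`() != 0.
  have char0K : [pchar K] =i pred0 by move=> m; rewrite -(fmorph_pchar io) char0.
  by apply: contraTneq mu1 => /(deriv_eq0_char0 char0K); rewrite -leqNgt.
have : mu %| mu^`() by apply: dvdp_trans h _; exact: dvdp_gcdr.
by move/(dvdp_leq mu'0); rewrite leqNgt lt_size_deriv.
Qed.

Variables (E : fieldType) (kap : {rmorphism K -> E}) (e0 : {rmorphism E -> F}) (thE : E).
Hypothesis Egen : forall e, exists r, e = (map_poly kap r).[thE].
Hypothesis e0k : forall k, e0 (kap k) = io k.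
Hypothesis e0th : e0 thE = th.

Lemma e0_horner r : e0 (map_poly kap r).[thE] = (map_poly io r).[th].
Proof.
rewrite -horner_map /= e0th -map_poly_comp; congr (_.[_]).
exact: eq_map_poly.
Qed.

Lemma conj_embed (th' : F) :
  (forall p, root (map_poly io p) th -> root (map_poly io p) th') ->
  exists s : {rmorphism E -> F}, (forall k, s (kap k) = io k) /\ s thE = th'.
Proof.
move=> rt; have [r rE] := choice Egen.
pose s e := (map_poly io (r e)).[th'].
have sE p : s (map_poly kap p).[thE] = (map_poly io p).[th'].
  apply/eqP; rewrite /s -subr_eq0 -hornerN -hornerD -rmorphN -rmorphD; apply: rt.
  by rewrite rootE rmorphB hornerD hornerN -!e0_horner -rE subrr.
have sB : zmod_morphism s.
  by move=> x y; rewrite [x]rE [y]rE -hornerN -hornerD -rmorphN -rmorphD !sE rmorphB hornerD hornerN.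
have sM : monoid_morphism s.
  split=> [|x y]; last by rewrite [x]rE [y]rE -hornerM -rmorphM !sE rmorphM hornerM.
  have -> : 1 = (map_poly kap 1).[thE] by rewrite rmorph1 hornerC.
  by rewrite sE rmorph1 hornerC.
pose sz := GRing.isZmodMorphism.Build _ _ s sB.
pose sm := GRing.isMonoidMorphism.Build _ _ s sM.
pose s' : {rmorphism E -> F} := HB.pack s sz sm.
exists s'; split=> [k|] /=.
  by have := sE k%:P; rewrite !map_polyC !hornerC.
by have := sE 'X; rewrite !map_polyX !hornerX.
Qed.

End Conjugates.

Section ParamAut.
Variables (F : closedFieldType) (N : nat) (C : irreducible_curve F N).

Lemma param_aut X Y : is_param C X -> is_param C Y ->
  exists tau tau' : {rmorphism F(t) -> F(t)},
    [/\ cancel tau tau', cancel tau' tau, forall c, tau (cst c) = cst c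
      & forall i, tau (X i) = Y i].
Proof.
move=> /param_iso[phi [psi [phiK psiK phiE]]] /param_iso[phi' [psi' [phiK' psiK' phiE']]].
pose T : {rmorphism ratfun F -> ratfun F} := phi' \o psi.
pose T' : {rmorphism ratfun F -> ratfun F} := phi \o psi'.
have TE p : T (ev (@cst F) X p) = ev (@cst F) Y p.
  by rewrite /T /= -phiE phiK phiE'.
exists T, T'; split.
- by move=> x; rewrite /T /T' /= phiK' psiK.
- by move=> x; rewrite /T /T' /= phiK psiK'.
- move=> c; have := TE c%:MP; rewrite !evC; apply.
- by move=> i; have := TE 'X_i; rewrite !evX; apply.
Qed.

End ParamAut.

Section Transport.
Variables (N : nat) (K : comNzRingType) (L L' : fieldType) (c : {rmorphism K -> L})
  (c' : {rmorphism K -> L'}).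
Variables (X : 'I_N -> L) (Y : 'I_N -> L') (tau : {rmorphism L -> L'}).
Hypotheses (tc : forall k, tau (c k) = c' k) (tX : forall i, tau (X i) = Y i).

Lemma coord_field_morph z : coord_field c X z -> coord_field c' Y (tau z).
Proof.
move=> /coord_fieldE[p [q [q0 ->]]]; apply/coord_fieldE; exists p, q.
by rewrite fmorph_div !(ev_morphK tc tX) -(ev_morphK tc tX) fmorph_eq0.
Qed.

(** In the descent, this shows that the automorphism attached to a conjugate of [th] sends the image
    of an element of [K(Y)] under [e0] to its image under the conjugate embedding. *)
Lemma coord_field_agree (L0 : fieldType) (c0 : {rmorphism K -> L0}) (X0 : 'I_N -> L0)
    (s : {rmorphism L0 -> L}) (s' : {rmorphism L0 -> L'}) :
  (forall k, s (c0 k) = c k) -> (forall k, s' (c0 k) = c' k) ->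
  (forall i, s (X0 i) = X i) -> (forall i, s' (X0 i) = Y i) ->
  forall z, coord_field c0 X0 z -> tau (s z) = s' z.
Proof.
move=> sc s'c sX s'X z /coord_fieldE[p [q [q0 ->]]].
by rewrite !fmorph_div !(ev_morphK sc sX) !(ev_morphK tc tX) !(ev_morphK s'c s'X).
Qed.

End Transport.

Lemma coord_field_horner (N : nat) (F L : fieldType) (c : {rmorphism F -> L}) (X : 'I_N -> L)
    (x : L) (p : {poly F}) : coord_field c X x -> coord_field c X (map_poly c p).[x].
Proof.
move=> Xx; elim/poly_ind: p => [|p k IH]; first by rewrite rmorph0 horner0; exact: coord_field0.
rewrite rmorphD rmorphM /= map_polyX map_polyC hornerMXaddC.
by apply: coord_fieldD; [apply: coord_fieldM | exact: coord_fieldC].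
Qed.

Lemma coord_field_full (N : nat) (F : fieldType) (X : 'I_N -> F(t)) :
  coord_field (@cst F) X tF -> forall z, coord_field (@cst F) X z.
Proof.
move=> Xt z; have [p [q [q0 ->]]] := frac_ex z.
by rewrite !polyF; apply: coord_fieldM; last apply: coord_fieldV; exact: coord_field_horner.
Qed.

Lemma dF_mapF (E F : fieldType) (e : {rmorphism E -> F}) z :
  dF (mapF e z) = mapF e (dF z).
Proof.
have h := dF_chain (tau := mapF e) (mapF_cst e) z.
apply: etrans h _; transitivity (mapF e (dF z) * dF tF); last by rewrite dF_t mulr1.
by congr (_ * dF _); exact: mapF_t.
Qed.

Lemma mapF_vector_field (E F : fieldType) (e : {rmorphism E -> F}) l z :
  mapF e (tF ^+ l * dF z) = tF ^+ l * dF (mapF e z).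
Proof.
apply: etrans (rmorphM (mapF e) _ _) _; congr (_ * _); last exact/esym/dF_mapF.
apply: etrans (rmorphXn (mapF e) _ _) _.
by congr (_ ^+ l); exact: mapF_t.
Qed.

Section Descent.
Variables (K : fieldType) (F : closedFieldType) (io : {rmorphism K -> F}).
Variables (N : nat) (C : irreducible_curve F N).
Hypothesis char0 : [pchar F] =i pred0.
Hypothesis C_def : curve_defined io C.

Section Coefficients.
Variables (E : fieldType) (kap : {rmorphism K -> E}) (e0 : {rmorphism E -> F})
    (th : E) (Y : 'I_N -> E(t)).
Hypothesis e0k : forall k, e0 (kap k) = io k.
Hypothesis th_alg : algebraicOver io (e0 th).
Hypothesis Egen : forall e, exists r, e = (map_poly kap r).[th].
Let X i := mapF e0 (Y i).
Hypothesis pX : is_param C X.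
Hypothesis Yt : coord_field (@cst E) Y tF.

Lemma conj_aut (s : {rmorphism E -> F}) : (forall k, s (kap k) = io k) ->
  exists tau tau' : {rmorphism F(t) -> F(t)},
    [/\ cancel tau tau', cancel tau' tau, forall c, tau (cst c) = cst c
      & forall i, tau (X i) = mapF s (Y i)].
Proof.
move=> sk; apply: (param_aut pX); apply: (is_param_specialized C_def pX).
  have /coord_fieldE[p [q [q0 tE]]] := Yt; apply/coord_fieldE.
  exists (map_mpoly s p), (map_mpoly s q); rewrite -!mapF_ev fmorph_eq0; split=> //.
  apply: etrans (esym (mapF_t s)) _; rewrite tE; exact: fmorph_div.
have mio (r : {rmorphism E -> F}) (pK : {mpoly K[N]}) : (forall k, r (kap k) = io k) ->
    map_mpoly io pK = map_mpoly r (map_mpoly kap pK).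
  by move=> rkE; apply/mpolyP => m; rewrite !mcoeff_map_mpoly /= rkE.
move=> pK; rewrite (mio e0 pK e0k) -mapF_ev -(mio e0 pK e0k) (mio s pK sk) -mapF_ev.
by move=> /eqP; rewrite fmorph_eq0 => /eqP ->; exact: rmorph0.
Qed.

(* Write t^l dX/dt = \sum_i th^i b_i with b_i in K(X). Every conjugate of th corresponds
   to an automorphism of F(t) fixing K(X), which turns the left-hand side into a(t) dX/dt
   with deg a <= 2; inverting the Vandermonde system gives the b_i the same shape. *)
Lemma coef_descent (i0 : 'I_N) (l : nat) : (l <= 2)%N ->
  exists n (b : 'I_n -> {poly F}) (f : 'I_n -> F),
    (forall i, (size (b i) <= 3)%N /\
       coord_field (@cst F \o io) X ((b i)%:F * dF (X i0))) /\
    tF ^+ l * dF (X i0) = \sum_i cst (f i) * ((b i)%:F * dF (X i0)).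
Proof.
move=> l2.
have [mu [mu0 muth mu_dvd mu_sep]] := minimal_poly_ex char0 th_alg.
have muE : root (map_poly kap mu) th.
  rewrite -(fmorph_root e0) -map_poly_comp.
  by rewrite (eq_map_poly (g := io)) // => k /=.
pose w : E(t) := tF ^+ l * dF (Y i0).
have [q [qK sq wE]] := coord_field_span Egen mu0 muE (coord_field_full Yt w).
have [rs rsE] := closed_field_poly_normal (map_poly io mu).
have lc0 : lead_coef (map_poly io mu) != 0 by rewrite lead_coef_eq0 map_poly_eq0.
have rs_uniq : uniq rs.
  rewrite -separable_prod_XsubC -(eqp_separable (p := map_poly io mu)) ?separable_map //.
  by rewrite rsE eqp_scale.
have srs : (size mu = (size rs).+1)%N.
  by rewrite -(size_map_poly io) rsE size_scale // size_prod_XsubC.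
pose n := size rs; pose r (j : 'I_n) := rs`_j.
have r_inj : injective r.
  by move=> j k /eqP; rewrite nth_uniq // => /eqP/val_inj.
have rroot p j : root (map_poly io p) (e0 th) -> root (map_poly io p) (r j).
  move=> /mu_dvd/dvdpP[p' ->]; rewrite rmorphM rootM /=; apply/orP; right.
  by rewrite rsE rootZ // root_prod_XsubC mem_nth.
have /choice[sg sgP] (j : 'I_n) : exists s : {rmorphism E -> F},
    (forall k, s (kap k) = io k) /\ s th = r j.
  by apply: (conj_embed Egen e0k erefl) => p; exact: rroot.
have /choice[tau tauP] (j : 'I_n) : exists tau : {rmorphism F(t) -> F(t)} * {rmorphism F(t) -> F(t)},
    [/\ cancel tau.1 tau.2, cancel tau.2 tau.1, forall c, tau.1 (cst c) = cst c
      & forall i, tau.1 (X i) = mapF (sg j) (Y i)].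
  by have [t1 [t2 h]] := conj_aut (sgP j).1; exists (t1, t2).
have wsum (s : {rmorphism E -> F}) :
    mapF s w = \sum_(i < n) mapF s q`_i * cst (s th ^+ i).
  rewrite wE (@horner_coef_wide _ n); last by rewrite -ltnS -srs.
  rewrite (rmorph_sum (mapF s)); apply: eq_bigr => i _.
  apply: etrans (rmorphM (mapF s) _ _) _; congr (_ * _).
  transitivity (cst (s th) ^+ i); last exact/esym/(rmorphXn (@cst F)).
  by rewrite -mapF_cst; exact: (rmorphXn (mapF s)).
pose z (i : 'I_n) := mapF e0 q`_i; pose v (j : 'I_n) := (tau j).2 (mapF (sg j) w).
have zK i : coord_field (@cst F \o io) X (z i).
  apply: (coord_field_morph (c := @cst E \o kap) (X := Y)) => // k.
  by apply: etrans (mapF_cst e0 _) _; rewrite /= e0k.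
have zv j : \sum_(i < n) cst (r j ^+ i) * z i = v j.
  have [tK tK' tc tX] := tauP j.
  rewrite /v wsum rmorph_sum; apply: eq_bigr => i _.
  rewrite [RHS]rmorphM (sgP j).2 [LHS]mulrC; congr (_ * _); last first.
    by apply: (canRL tK); rewrite tc.
  apply: (canRL tK); rewrite /z.
  apply: (@coord_field_agree N K F(t) F(t) (@cst F \o io) (@cst F \o io) X
     (fun i => mapF (sg j) (Y i)) (tau j).1 _ _ E(t) (@cst E \o kap) Y) => // k.
  - by move=> /=; rewrite tc.
  - by apply: etrans (mapF_cst e0 _) _; rewrite /= e0k.
  - by apply: etrans (mapF_cst (sg j) _) _; rewrite /= (sgP j).1.
have [d dE] := vandermonde_inv r_inj zv.
have /choice[a aP] j : exists a : {poly F}, (size a <= 3)%N /\ v j = a%:F * dF (X i0).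
  have [tK tK' tc tX] := tauP j.
  have [a [sa aE]] := automorphism_degree2_fields (X i0) tc tK tK' l2.
  exists a; split=> //; rewrite -aE /v; congr ((tau j).2 _).
  by rewrite tX; exact: mapF_vector_field.
exists n, (fun i => \sum_j d i j *: a j), (fun i : 'I_n => e0 th ^+ i).
have zE i : z i = (\sum_j d i j *: a j)%:F * dF (X i0).
  rewrite dE rmorph_sum mulr_suml; apply: eq_bigr => j _.
  by rewrite (aP j).2 -mul_polyC /= tofracM -mulrA.
split=> [i|].
  split; last by rewrite -zE.
  apply: (big_ind (fun p : {poly F} => (size p <= 3)%N)) => [|p1 p2 h1 h2|j _].
  - by rewrite size_poly0.
  - by rewrite (leq_trans (size_polyD _ _)) // geq_max h1.
  by rewrite (leq_trans (size_scale_leq _ _)) // (aP j).1.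
have -> : tF ^+ l * dF (X i0) = mapF e0 w.
  by apply/esym; exact: mapF_vector_field.
by rewrite wsum; apply: eq_bigr => i _; rewrite -zE mulrC.
Qed.

End Coefficients.
End Descent.

(** * The conic *)

Section Triple.
Variable F : fieldType.

(** The elements of [A] that occur in the expressions of 1, ['X] and ['X^2], pooled in the index
    type [T], span the polynomials of degree at most 2. Their coefficient matrix has rank 3, and
    three independent rows are selected. *)
Lemma spanning_triple (A : {poly F} -> Prop) : (forall a, A a -> (size a <= 3)%N) ->
  (forall l, (l <= 2)%N -> exists n (b : 'I_n -> {poly F}) (f : 'I_n -> F),
     (forall i, A (b i)) /\ 'X^l = \sum_i f i *: b i) ->
  exists a : 'I_3 -> {poly F}, (forall i, A (a i)) /\
    \matrix_(i < 3, j < 3) (a i)`_j \in unitmx.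
Proof.
move=> sA span.
pose Q (l : 'I_3) (s : {n : nat & (('I_n -> {poly F}) * ('I_n -> F))%type}) :=
  (forall i, A ((tagged s).1 i)) /\ 'X^l = \sum_i (tagged s).2 i *: (tagged s).1 i.
have /choice[s sP] l : exists s, Q l s.
  have [n [b [f h]]] := span l (ltn_ord l).
  by exists (existT _ n (b, f)).
pose T : finType := {l : 'I_3 & 'I_(tag (s l))}.
pose b (p : T) := (tagged (s (tag p))).1 (tagged p).
pose f (p : T) := (tagged (s (tag p))).2 (tagged p).
pose B : 'M[F]_(#|T|, 3) := \matrix_(k, j) (b (enum_val k))`_j.
have fB : row_full B.
  rewrite -sub1mx; apply/row_subP => l; apply/submxP.
  exists (\row_k ((tag (enum_val k) == l)%:R * f (enum_val k))).
  apply/rowP => j; rewrite !mxE.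
  have -> : (l == j)%:R = ('X^l : {poly F})`_j :> F by rewrite coefXn eq_sym.
  rewrite (sP l).2 coef_sum.
  transitivity (\sum_(p : T) ((tag p == l)%:R * f p) * (b p)`_j); last first.
    rewrite (reindex (@enum_val T T)) /=; last exact/onW_bij/enum_val_bij.
    by apply: eq_bigr => k _; rewrite !mxE.
  transitivity (\sum_(l' < 3) \sum_(i < tag (s l'))
     ((l' == l)%:R * (tagged (s l')).2 i) * ((tagged (s l')).1 i)`_j); last first.
    by rewrite sig_big_dep; apply: eq_big.
  rewrite (bigD1 l) //= [X in _ + X]big1 ?addr0 => [|l' /negPf ll']; last first.
    by rewrite big1 // => i _; rewrite ll' !mul0r.
  by apply: eq_bigr => i _; rewrite eqxx mul1r coefZ.
pose g := fullrankfun fB.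
exists (fun i => b (enum_val (g i))); split=> [i|].
  exact: (sP _).1.
rewrite [X in X \in _](_ : _ = rowsub g B); first exact: fullrowsub_unit.
by apply/matrixP => i j; rewrite !mxE.
Qed.

End Triple.

Section Frame.
Variables (K : fieldType) (F : closedFieldType) (io : {rmorphism K -> F}).
Variables (N : nat) (C : irreducible_curve F N).
Hypothesis char0 : [pchar F] =i pred0.
Hypothesis C_def : curve_defined io C.

Lemma nonconstant_coord X : is_param C X -> exists i, dF (X i) != 0.
Proof.
move=> [_ Xt]; apply: contrapT => h.
have Xcst i : exists r, X i = cst r.
  by apply: (dF_eq0 char0); apply/eqP; apply: contra_notT h => ?; exists i.
have [x xE] := choice Xcst.
have evX' r : ev (@cst F) X r = cst (meval x r).
  apply: (@mpoly_hom_eq _ _ _ (ev (@cst F) X) (@cst F \o meval x)) => [k|i].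
    by rewrite /= evC mevalC.
  by rewrite /= evX mevalXU.
have [p [q [_ tE]]] := (coord_fieldE _ _ _).1 Xt.
case: (@tF_not_cst _ (meval x p / meval x q)).
by rewrite tE !evX'; exact/esym/(fmorph_div (@cst F)).
Qed.

Lemma frame_ex : rational_curve C -> exists X (u : F(t)) (a : 'I_3 -> {poly F}),
  [/\ is_param C X, u != 0, forall i, (size (a i) <= 3)%N,
     forall i, coord_field (@cst F \o io) X ((a i)%:F * u)
   & \matrix_(i < 3, j < 3) (a i)`_j \in unitmx].
Proof.
move=> /rational_param[X0 pX0].
have [E [kap [e0 [th [Y [e0k th_alg Egen pX Yt]]]]]] := algebraic_param char0 C_def pX0.
pose X i := mapF e0 (Y i); have [i0 u0] := nonconstant_coord pX.
pose A (a : {poly F}) := (size a <= 3)%N /\ coord_field (@cst F \o io) X (a%:F * dF (X i0)).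
have [a [aA aU]] : exists a : 'I_3 -> {poly F}, (forall i, A (a i)) /\
    \matrix_(i < 3, j < 3) (a i)`_j \in unitmx.
  apply: spanning_triple => [a [] //|l l2].
  have [n [b [f [bA e]]]] := coef_descent char0 C_def e0k th_alg Egen pX Yt i0 l2.
  exists n, b, f; split=> //; apply/eqP; rewrite -tofrac_eq tofracXn; apply/eqP.
  apply: (mulIf u0); apply: etrans e _; rewrite rmorph_sum mulr_suml.
  by apply: eq_bigr => i _; rewrite -mul_polyC /= [in RHS]tofracM mulrA.
exists X, (dF (X i0)), a; split=> // i; first exact: (aA i).1.
exact: (aA i).2.
Qed.

End Frame.

Section Conic.
Variables (K : fieldType) (F : closedFieldType) (io : {rmorphism K -> F}).
Hypothesis two0 : (2 : K) != 0.
Variable A : {poly F} -> Prop.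
Hypothesis AD : forall a b (k : K), A a -> A b -> A (a + (io k)%:P * b).

Definition frame a0 a1 a2 := [/\ A a0, A a1, A a2,
  forall c0 c1 c2 : F, c0%:P * a0 + c1%:P * a1 + c2%:P * a2 = 0 -> [/\ c0 = 0, c1 = 0 & c2 = 0]
  & forall p : {poly F}, (size p <= 3)%N ->
      exists c0 c1 c2 : F, p = c0%:P * a0 + c1%:P * a1 + c2%:P * a2].

Lemma frame_swap01 a0 a1 a2 : frame a0 a1 a2 -> frame a1 a0 a2.
Proof.
move=> [A0 A1 A2 ind span]; split=> //.
  by move=> c0 c1 c2; rewrite [c0%:P * _ + _]addrC => /ind[].
by move=> p /span[c0 [c1 [c2 ->]]]; exists c1, c0, c2; rewrite [c1%:P * _ + _]addrC.
Qed.

Lemma frame_swap12 a0 a1 a2 : frame a0 a1 a2 -> frame a0 a2 a1.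
Proof.
move=> [A0 A1 A2 ind span]; split=> //.
  by move=> c0 c1 c2; rewrite addrAC => /ind[].
by move=> p /span[c0 [c1 [c2 ->]]]; exists c0, c2, c1; rewrite addrAC.
Qed.

Lemma frame_add a0 a1 a2 k : frame a0 a1 a2 -> frame a0 a1 (a2 + (io k)%:P * a0).
Proof.
move=> [A0 A1 A2 ind span]; split=> //; first exact: AD.
  move=> c0 c1 c2; have -> : c0%:P * a0 + c1%:P * a1 + c2%:P * (a2 + (io k)%:P * a0) =
      (c0 + c2 * io k)%:P * a0 + c1%:P * a1 + c2%:P * a2.
    by rewrite polyCD polyCM; ring.
  by move=> /ind[+ -> c20]; rewrite c20 mul0r addr0.
move=> p /span[c0 [c1 [c2 ->]]]; exists (c0 - c2 * io k), c1, c2.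
by rewrite polyCB polyCM; ring.
Qed.

Lemma frame_add21 a0 a1 a2 k : frame a0 a1 a2 -> frame a0 a1 (a2 + (io k)%:P * a1).
Proof. by move=> fr; apply/frame_swap01/frame_add/frame_swap01. Qed.

Lemma frame_add10 a0 a1 a2 k : frame a0 a1 a2 -> frame a0 (a1 + (io k)%:P * a0) a2.
Proof. by move=> fr; apply/frame_swap12/frame_add/frame_swap12. Qed.

Lemma frame_add12 a0 a1 a2 k : frame a0 a1 a2 -> frame a0 (a1 + (io k)%:P * a2) a2.
Proof. by move=> fr; apply/frame_swap12/frame_add21/frame_swap12. Qed.

Lemma frame_add01 a0 a1 a2 k : frame a0 a1 a2 -> frame (a0 + (io k)%:P * a1) a1 a2.
Proof. by move=> fr; apply/frame_swap01/frame_add10/frame_swap01. Qed.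

Lemma frame_add02 a0 a1 a2 k : frame a0 a1 a2 -> frame (a0 + (io k)%:P * a2) a1 a2.
Proof. by move=> fr; apply/frame_swap12/frame_add01/frame_swap12. Qed.

Lemma frame_nz a0 a1 a2 : frame a0 a1 a2 -> a0 != 0.
Proof.
move=> [_ _ _ ind _]; apply/eqP => a00.
have [|/eqP] := ind 1 0 0; last by rewrite oner_eq0.
by rewrite a00 mulr0 polyC0 !mul0r !addr0.
Qed.

Definition pol (k : K) : {poly F} := (io k)%:P.
HB.instance Definition _ := GRing.RMorphism.copy pol (@polyC F \o io).

Definition quadric q00 q11 q22 q01 q02 q12 a0 a1 a2 :=
  pol q00 * a0 ^+ 2 + pol q11 * a1 ^+ 2 + pol q22 * a2 ^+ 2 +
  pol q01 * (a0 * a1) + pol q02 * (a0 * a2) + pol q12 * (a1 * a2) = 0.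

Definition diagonal_conic := exists a0 a1 a2 (al ga : K),
  [/\ frame a0 a1 a2, al != 0, ga != 0 & a2 ^+ 2 = pol al * a1 ^+ 2 + pol ga * a0 ^+ 2].

(** The square in [a1] is completed. The remaining coefficient of [a0^2] cannot vanish:
    [a2^2 = al a1^2] factors over [F] into linear forms, one of which would be zero, against the
    independence of the frame. *)
Lemma conic_diag2 a0 a1 a2 al ga be : frame a0 a1 a2 -> al != 0 ->
  a2 ^+ 2 = pol al * a1 ^+ 2 + pol be * (a0 * a1) + pol ga * a0 ^+ 2 -> diagonal_conic.
Proof.
move=> fr al0 e; pose h := be / (2 * al).
have be_h : be = al * h + al * h by rewrite /h; field; rewrite al0 two0.
pose a1' := a1 + pol h * a0; pose ga' := ga - al * h * h.
have fr' : frame a0 a1' a2 by exact: frame_add10.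
have e' : a2 ^+ 2 = pol al * a1' ^+ 2 + pol ga' * a0 ^+ 2.
  by rewrite e /a1' /ga' be_h; ring.
exists a0, a1', a2, al, ga'; split=> //; apply/eqP => ga0.
have [_ _ _ ind _] := fr'.
have [s sE] : exists s : F, s ^+ 2 = io al.
  by have [s] := @solve_monicpoly F 2 (fun i => if i == 0%N then io al else 0) isT;
    rewrite big_ord_recl big_ord1 /= expr0 mulr1 mul0r addr0; exists s.
have : (a2 - s%:P * a1') * (a2 + s%:P * a1') = 0.
  have -> : (a2 - s%:P * a1') * (a2 + s%:P * a1') = a2 ^+ 2 - (s ^+ 2)%:P * a1' ^+ 2.
    by rewrite rmorphXn /=; ring.
  by rewrite e' ga0 rmorph0 mul0r addr0 sE subrr.
move=> /eqP; rewrite mulf_eq0 => /orP[] /eqP e0.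
  have [|_ _ /eqP] := ind 0 (- s) 1; last by rewrite oner_eq0.
  by rewrite polyC0 mul0r add0r polyCN mul1r mulNr addrC.
have [|_ _ /eqP] := ind 0 s 1; last by rewrite oner_eq0.
by rewrite polyC0 mul0r add0r mul1r addrC.
Qed.

(** If neither [a1^2] nor [a0^2] occurs, the equation is [a2^2 = be a0 a1], and passing from [a0] to
    [a0 + a1] produces the square [- be a1^2]. *)
Lemma conic_diag1 a0 a1 a2 al ga be : frame a0 a1 a2 ->
  a2 ^+ 2 = pol al * a1 ^+ 2 + pol be * (a0 * a1) + pol ga * a0 ^+ 2 -> diagonal_conic.
Proof.
move=> fr e; have [al0|al0] := eqVneq al 0; last exact: conic_diag2 fr al0 e.
have [ga0|ga0] := eqVneq ga 0; last first.
  apply: (@conic_diag2 a1 a0 a2 ga al be) => //; first exact: frame_swap01.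
  by rewrite e; ring.
have be0 : be != 0.
  apply/eqP => be0; move: e; rewrite al0 ga0 be0 !rmorph0 !mul0r !addr0 => /eqP.
  rewrite expf_eq0 /= => a20.
  by have := frame_nz (frame_swap01 (frame_swap12 fr)); rewrite a20.
apply: (@conic_diag2 (a0 + pol 1 * a1) a1 a2 (- be) 0 be); rewrite ?oppr_eq0 //.
  exact: frame_add01.
by rewrite e al0 ga0; ring.
Qed.

Lemma conic_diag0 a0 a1 a2 q00 q11 q22 q01 q02 q12 : frame a0 a1 a2 -> q22 != 0 ->
  quadric q00 q11 q22 q01 q02 q12 a0 a1 a2 -> diagonal_conic.
Proof.
move=> fr q0; rewrite /quadric => e.
pose h0 := q02 / (2 * q22); pose h1 := q12 / (2 * q22).
have E0 : q02 = q22 * (h0 + h0) by rewrite /h0; field; rewrite q0 two0.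
have E1 : q12 = q22 * (h1 + h1) by rewrite /h1; field; rewrite q0 two0.
pose r00 := q00 / q22; pose r11 := q11 / q22; pose r01 := q01 / q22.
have E00 : q00 = q22 * r00 by rewrite /r00 mulrC divfK.
have E11 : q11 = q22 * r11 by rewrite /r11 mulrC divfK.
have E01 : q01 = q22 * r01 by rewrite /r01 mulrC divfK.
pose a2' := a2 + pol h0 * a0 + pol h1 * a1.
have fr' : frame a0 a1 a2'.
  by apply/frame_add21/frame_add.
apply: (@conic_diag1 a0 a1 a2' (h1 * h1 - r11) (h0 * h0 - r00) (2 * (h0 * h1) - r01)) => //.
have pq0 : pol q22 != 0 by rewrite fmorph_eq0 || rewrite polyC_eq0 fmorph_eq0.
apply/eqP; rewrite -subr_eq0 -(mulrI_eq0 _ (mulfI pq0)) -[X in _ == X]e; apply/eqP.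
rewrite E00 E11 E01 E0 E1 /a2'; ring.
Qed.

(** The disjunction says that the six coefficients are not all zero. If no square occurs, one of the
    mixed terms creates it: [a1 a2 = (a1 - a2) a2 + a2^2], and likewise for the other pairs. *)
Lemma conic_diag a0 a1 a2 q00 q11 q22 q01 q02 q12 : frame a0 a1 a2 ->
  ~ [/\ q00 = 0, q11 = 0 & q22 = 0] \/ ~ [/\ q01 = 0, q02 = 0 & q12 = 0] ->
  quadric q00 q11 q22 q01 q02 q12 a0 a1 a2 -> diagonal_conic.
Proof.
move=> fr nz e; move: (e); rewrite /quadric => e'.
have [z22|] := eqVneq q22 0; last by move=> h; exact: conic_diag0 fr h e.
have [z11|h] := eqVneq q11 0; last first.
  apply: (@conic_diag0 a0 a2 a1 q00 q22 q11 q02 q01 q12) => //; first exact: frame_swap12.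
  by rewrite /quadric -[RHS]e'; ring.
have [z00|h] := eqVneq q00 0; last first.
  apply: (@conic_diag0 a2 a1 a0 q22 q11 q00 q12 q02 q01) => //.
    exact/frame_swap01/frame_swap12/frame_swap01.
  by rewrite /quadric -[RHS]e'; ring.
have {}nz : ~ [/\ q01 = 0, q02 = 0 & q12 = 0] by case: nz => // h; case: h.
rewrite z00 z11 z22 !rmorph0 !mul0r !add0r in e'.
have [z12|h] := eqVneq q12 0; last first.
  apply: (@conic_diag0 a0 (a1 + pol (- 1) * a2) a2 0 0 q12 q01 (q01 + q02) q12) => //.
    exact: frame_add12.
  by rewrite /quadric -[RHS]e' ?rmorph0; ring.
have [z02|h] := eqVneq q02 0; last first.
  apply: (@conic_diag0 (a0 + pol (- 1) * a2) a1 a2 0 0 q02 q01 q02 (q01 + q12)) => //.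
    exact: frame_add02.
  by rewrite /quadric -[RHS]e' ?rmorph0; ring.
have [z01|h] := eqVneq q01 0; first by case: nz.
apply: (@conic_diag0 (a0 + pol (- 1) * a1) a2 a1 0 0 q01 (q02) q01 (q12 + q02)) => //.
  exact/frame_swap12/frame_add01.
by rewrite /quadric -[RHS]e' ?rmorph0; ring.
Qed.

End Conic.

Lemma quot_scale (L : fieldType) (x y u : L) : u != 0 -> x / y = x * u / (y * u).
Proof. by move=> u0; rewrite invfM mulrACA divff ?mulr1. Qed.

Lemma quot_conic (L : fieldType) (b0 b1 b2 al ga : L) : b0 != 0 ->
  b2 ^+ 2 = al * b1 ^+ 2 + ga * b0 ^+ 2 ->
  (b2 / b0) ^+ 2 = al * (b1 / b0) ^+ 2 + ga.
Proof.
by move=> h e; rewrite expr_div_n e; field.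
Qed.

Section ConicModel.
Variables (K : fieldType) (F : closedFieldType) (io : {rmorphism K -> F}).
Variables (N : nat) (C : irreducible_curve F N).
Hypothesis char0 : [pchar F] =i pred0.
Hypothesis C_def : curve_defined io C.

(** Six polynomials of degree at most 4 are linearly dependent over [F]. A functional with value 1
    at a nonzero coefficient turns the dependence into a nontrivial one over [K], the products with
    [u] being in [K(X)]. *)
Lemma lam_quadric X (u : F(t)) (P : 'I_6 -> {poly F}) : is_param C X -> u != 0 ->
  (forall i, (size (P i) <= 5)%N) ->
  (forall i, coord_field (@cst F \o io) X ((P i)%:F * u)) ->
  exists q : 'I_6 -> K, (exists i, q i != 0) /\ \sum_i (io (q i))%:P * P i = 0.
Proof.
move=> pX u0 sP PK.
have [|v [[k vk] vP]] := poly_dep sP; first by rewrite card_ord.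
have [lam [lamP lamk]] := klinear_ex io vk.
exists (fun i => lam (v i)); split; first by exists k; rewrite lamk oner_neq0.
have := lam_coord_field (curve_defined_over C_def pX) lamP PK (_ : \sum_i cst (v i) * ((P i)%:F * u) = 0).
have E (f : 'I_6 -> F) : \sum_i cst (f i) * ((P i)%:F * u) = (\sum_i (f i)%:P * P i)%:F * u.
  rewrite rmorph_sum mulr_suml; apply: eq_bigr => i _.
  by rewrite /= tofracM mulrA.
rewrite !E => h; have {}h : (\sum_i (io (lam (v i)))%:P * P i)%:F * u = 0.
  apply: h; have -> : \sum_i (v i)%:P * P i = 0.
    by rewrite -[RHS]vP; apply: eq_bigr => i _; rewrite mul_polyC.
  by rewrite tofrac0 mul0r.
apply/eqP; rewrite -tofrac_eq0; apply/eqP.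
by apply: (mulIf u0); rewrite mul0r.
Qed.

(** The last two conditions keep the conic tied to the curve: 1, [x], [y] are independent over [F],
    and [tF] is a quotient of two of their combinations, so [x] and [y] generate [F(t)]. *)
Definition conic_model (X : 'I_N -> F(t)) (x y : F(t)) (al ga : K) :=
  [/\ coord_field (@cst F \o io) X x, coord_field (@cst F \o io) X y,
      y ^+ 2 = cst (io al) * x ^+ 2 + cst (io ga),
      forall c0 c1 c2 : F, cst c0 + cst c1 * x + cst c2 * y = 0 ->
        [/\ c0 = 0, c1 = 0 & c2 = 0]
    & exists c0 c1 c2 d0 d1 d2 : F, tF =
       (cst c0 + cst c1 * x + cst c2 * y) / (cst d0 + cst d1 * x + cst d2 * y)].

Lemma conic_model_ex : rational_curve C -> exists X x y (al ga : K),
  [/\ is_param C X, al != 0, ga != 0 & conic_model X x y al ga].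
Proof.
move=> /(frame_ex char0 C_def)[X [u [a [pX u0 sa aK aU]]]].
pose A (b : {poly F}) := (size b <= 3)%N /\ coord_field (@cst F \o io) X (b%:F * u).
have AD b1 b2 (k : K) : A b1 -> A b2 -> A (b1 + (io k)%:P * b2).
  move=> [s1 k1] [s2 k2]; split.
    rewrite (leq_trans (size_polyD _ _)) // geq_max s1 mul_polyC.
    by rewrite (leq_trans (size_scale_leq _ _)).
  rewrite tofracD mulrDl tofracM -mulrA; apply: coord_fieldD => //; apply: coord_fieldM => //.
  exact: (coord_fieldC (@cst F \o io) X k).
pose M := \matrix_(i < 3, j < 3) (a i)`_j.
have comb (c : 'rV[F]_3) : \sum_i (c 0 i)%:P * a i = rVpoly (c *m M).
  apply/polyP => j; rewrite coef_sum coef_rVpoly; case: insubP => [j' _ <-|].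
    rewrite mxE; apply: eq_bigr => i _; rewrite coefCM mxE //.
  rewrite -leqNgt => j3; apply: big1 => i _.
  by rewrite coefCM nth_default ?mulr0 // (leq_trans (sa i)).
pose row3 (c0 c1 c2 : F) : 'rV[F]_3 := \row_i [:: c0; c1; c2]`_i.
have sum3 c0 c1 c2 : c0%:P * a 0 + c1%:P * a 1 + c2%:P * a 2%R = rVpoly (row3 c0 c1 c2 *m M).
  rewrite -comb !big_ord_recl big_ord0 addr0 !mxE /= addrA.
  by congr (_ * a _ + _ * a _ + _ * a _); apply: val_inj.
have fr : frame A (a 0) (a 1) (a 2%R).
  split; try by split; [exact: sa | exact: aK].
    move=> c0 c1 c2; rewrite sum3 => /(congr1 (@poly_rV _ 3)).
    rewrite rVpolyK linear0 => /(congr1 (mulmx^~ (invmx M))).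
    rewrite mulmxK // mul0mx => /rowP h.
    by have := (h 0, h 1, h 2%R); rewrite !mxE /= => -[[-> ->] ->].
  move=> p sp; pose c := poly_rV p *m invmx M : 'rV_3.
  exists (c 0 0), (c 0 1), (c 0 2%R); rewrite sum3.
  have -> : row3 (c 0 0) (c 0 1) (c 0 2%R) = c.
    by apply/rowP => -[[|[|[|//]]] i3]; rewrite mxE /=; congr (c 0 _); apply: val_inj.
  by rewrite /c mulmxKV // poly_rV_K.
have two0 : (2 : K) != 0.
  have /pcharf0P char0K : [pchar K] =i pred0 by move=> n; rewrite -(fmorph_pchar io) char0.
  by rewrite char0K.
have [a0 [a1 [a2 [al [ga [[A0 A1 A2 ind span] al0 ga0 e]]]]]] : diagonal_conic io A.
  (* The six monomials of degree 2 in the frame; their product with [u * u] lies in [K(X)]. *)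
  pose P (i : 'I_6) := [:: a 0 ^+ 2; a 1 ^+ 2; a 2%R ^+ 2; a 0 * a 1; a 0 * a 2%R; a 1 * a 2%R]`_i.
  have s5 (b c : {poly F}) : (size b <= 3)%N -> (size c <= 3)%N -> (size (b * c)%R <= 5)%N.
    move=> sb sc; apply: leq_trans (size_polyMleq _ _) _.
    by have := leq_add sb sc; case: (_ + _)%N.
  have cK i j : coord_field (@cst F \o io) X ((a i * a j)%:F * (u * u)).
    by rewrite tofracM mulrACA; apply: coord_fieldM.
  have [|||q [[k qk] qP]] := @lam_quadric X (u * u) P pX.
  - exact: mulf_neq0.
  - by case=> -[|[|[|[|[|[|//]]]]]] i6; rewrite /P /= ?expr2; exact: s5.
  - by case=> -[|[|[|[|[|[|//]]]]]] i6; rewrite /P /= ?expr2; exact: cK.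
  have o (i : nat) : (i < 6)%N -> 'I_6 by exact: Ordinal.
  apply: (conic_diag two0 AD (q00 := q (inord 0)) (q11 := q (inord 1)) (q22 := q (inord 2))
    (q01 := q (inord 3)) (q02 := q (inord 4)) (q12 := q (inord 5)) fr).
    case: (pselect [/\ q (inord 0) = 0, q (inord 1) = 0 & q (inord 2) = 0]); last by left.
    move=> [z0 z1 z2]; right=> -[z3 z4 z5]; move/eqP: qk; apply.
    by rewrite -(inord_val k); case: k => -[|[|[|[|[|[|//]]]]]] i6 /=.
  move: qP; rewrite !big_ord_recl big_ord0 addr0 !addrA /P /= /quadric /pol /=.
  move=> qP; rewrite -[RHS]qP.
  by do 5?[congr (_ + _)]; congr ((io (q _))%:P * _); apply: val_inj; rewrite /= inordK.
have a00 : a0 != 0.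
  by apply: (frame_nz (A := A)); split; [exact: A0|exact: A1|exact: A2|exact: ind|exact: span].
have a0F : a0%:F != 0 by rewrite tofrac_eq0.
have quo b : A b -> coord_field (@cst F \o io) X (b%:F / a0%:F).
  move=> [_ bK]; have -> : b%:F / a0%:F = (b%:F * u) / (a0%:F * u).
    exact: (@quot_scale F(t) b%:F a0%:F u u0).
  by apply: coord_fieldM => //; apply: coord_fieldV; exact: A0.2.
have lin c0 c1 c2 : cst c0 + cst c1 * (a1%:F / a0%:F) + cst c2 * (a2%:F / a0%:F) =
    (c0%:P * a0 + c1%:P * a1 + c2%:P * a2)%:F / a0%:F.
  by rewrite !tofracD !tofracM !mulrDl mulfK // -!mulrA.
exists X, (a1%:F / a0%:F), (a2%:F / a0%:F), al, ga; split=> //; split.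
- exact: quo.
- exact: quo.
- apply: quot_conic => //; rewrite -!tofracXn e /pol /= tofracD.
  by rewrite (tofracM (io al)%:P) (tofracM (io ga)%:P).
- move=> c0 c1 c2; rewrite lin => /eqP; rewrite mulf_eq0 invr_eq0 (negPf a0F) orbF tofrac_eq0.
  by move=> /eqP/ind.
(* Both ['X] and 1 have degree at most 2, so they are combinations of the frame; divided by [a0],
   they become combinations of 1, [x], [y] with quotient [tF]. *)
have [|c0 [c1 [c2 cE]]] := span 'X; first by rewrite size_polyX.
have [|d0 [d1 [d2 dE]]] := span 1; first by rewrite size_poly1.
exists c0, c1, c2, d0, d1, d2; rewrite !lin -cE -dE tofrac1 div1r invrK.
by rewrite divfK.
Qed.

End ConicModel.

(** * Points of the conic and parametrizations *)

Section Substitution.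
Variables (F : closedFieldType) (z : F(t)).
Hypothesis z_nc : forall c, z <> cst c.

Definition subst_poly : {poly F} -> F(t) := horner_eval z \o map_poly (@cst F).
HB.instance Definition _ := GRing.RMorphism.on subst_poly.

Lemma subst_poly_inj p : subst_poly p = 0 -> p = 0.
Proof.
move=> h; apply/eqP; apply: contraT => p0.
by have [r] := algebraic_cst p0 h; move/z_nc.
Qed.

Lemma subst_ex : exists rho : {rmorphism F(t) -> F(t)},
  [/\ forall c, rho (cst c) = cst c, rho tF = z
    & forall p, rho p%:F = (map_poly (@cst F) p).[z]].
Proof.
have [rho rhoE] := frac_lift_ex subst_poly_inj; exists rho; split=> // [c|].
  by apply: etrans (rhoE _) _; rewrite /= /subst_poly /= /horner_eval map_polyC hornerC.
by apply: etrans (rhoE _) _; rewrite /= /subst_poly /= /horner_eval map_polyX hornerX.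
Qed.

End Substitution.

Section ParametrizationOver.
Variables (F : closedFieldType) (N : nat) (C : irreducible_curve F N).
Variables (Lt : fieldType) (il : {rmorphism Lt -> F}) (L : set F).
Hypothesis L_subfield : is_subfield L.
Hypothesis Lim : forall x, L x <-> exists m, il m = x.

Lemma polyOver_im (p : {poly Lt}) : map_poly il p \is a polyOver (mem L).
Proof.
apply/allP => _ /(nthP 0)[i _ <-]; rewrite coef_map; apply/mem_set/Lim.
by exists p`_i.
Qed.

Lemma mpolyOver_im (p : {mpoly Lt[N]}) : map_mpoly il p \is a mpolyOver N (mem L).
Proof.
apply/allP => _ /mapP[m _ ->]; rewrite mcoeff_map_mpoly; apply/mem_set/Lim.
by exists p@_m.
Qed.

Lemma parametrization_of_param Y : is_param C Y ->
  (forall i, exists p q : {poly Lt}, q != 0 /\ Y i = (map_poly il p)%:F / (map_poly il q)%:F) ->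
  coord_field (@cst F \o il) Y tF -> is_field_of_parametrization C L.
Proof.
move=> pY YL /coord_fieldE[r1 [r2 [r20 tE]]]; split=> //.
have [phi [psi [phiK psiK phiE]]] := param_iso pY.
exists phi, psi; split.
- split=> // c; rewrite phiE; exact: evC.
- move=> i; rewrite phiE; have [p [q [q0 e]]] := YL i.
  exists (map_poly il p), (map_poly il q); split.
  + exact: polyOver_im.
  + exact: polyOver_im.
  + by rewrite map_poly_eq0.
  by apply: etrans e; exact: evX.
exists (map_mpoly il r1), (map_mpoly il r2); split.
- exact: mpolyOver_im.
- exact: mpolyOver_im.
- by apply/negP => /pY.1 /eqP; rewrite ev_map (negPf r20).
apply: (can_inj phiK); rewrite psiK fmorph_div !phiE !ev_map.
exact: tE.
Qed.

Hypothesis C_def : curve_defined il C.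

(** As [tF] is a rational function of [z], substituting [z] for [tF] is an automorphism [rho], and
    the preimage [Y] of [X] under [rho] is a parametrization with parameter [z]. Its coefficients
    descend to [L]: for [Y i = p / q], the equation [X i * q(z) = p(z)] is a relation over [F]
    between elements of [L(X)], and a functional with value 1 at the leading coefficient of [q]
    turns it into one over [L] with nonzero denominator. *)
Lemma field_of_parametrization X z : is_param C X -> coord_field (@cst F \o il) X z ->
  (forall c, z <> cst c) ->
  (exists p q : {poly F}, tF = (map_poly (@cst F) p).[z] / (map_poly (@cst F) q).[z]) ->
  is_field_of_parametrization C L.
Proof.
move=> pX zL z_nc [p0 [q0 tE]].
have [rho [rho_c rho_t rhoE]] := subst_ex z_nc.
have rho_inj : injective rho by exact: fmorph_inj.
have rho_surj w : exists w', rho w' = w.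
  have [p [q [_ ->]]] := frac_ex w.
  have ex (r : {poly F}) : exists w', rho w' = r%:F.
    exists (map_poly (@cst F) r).[p0%:F / q0%:F].
    rewrite -horner_map -map_poly_comp (polyF r).
    have e : rho (p0%:F / q0%:F) = tF by rewrite fmorph_div !rhoE -tE.
    rewrite /= e; by congr (_.[_]); apply: eq_map_poly => c /=; rewrite rho_c.
  have [[w1 e1] [w2 e2]] := (ex p, ex q).
  by exists (w1 / w2); rewrite fmorph_div e1 e2.
have /choice[Y YE] i : exists y, rho y = X i by exact: rho_surj.
have evXY p : ev (@cst F) X p = rho (ev (@cst F) Y p).
  by apply/esym/(ev_morphK (c := @cst F)).
apply: (@parametrization_of_param Y).
- split=> [p|].
    rewrite pX.1 evXY; split=> [/eqP|->]; last exact: rmorph0.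
    by rewrite fmorph_eq0 => /eqP.
  have [p [q [r20 e]]] := (coord_fieldE _ _ _).1 zL; apply/coord_fieldE.
  exists (map_mpoly il p), (map_mpoly il q).
  have q0Y : ev (@cst F) Y (map_mpoly il q) != 0.
    by rewrite -(fmorph_eq0 rho) -evXY ev_map.
  split; first exact: q0Y.
  by apply: rho_inj; rewrite rho_t fmorph_div -!evXY !ev_map; exact: e.
- move=> i; have [p [q [qn0 yE]]] := frac_ex (Y i).
  have lq0 : lead_coef q != 0 by rewrite lead_coef_eq0.
  have [lam [lamP lam1]] := klinear_ex il lq0.
  pose n := maxn (size p) (size q).
  have zK j : coord_field (@cst F \o il) X (z ^+ j).
    elim: j => [|j IH]; first by rewrite expr0; exact: coord_field1.
    by rewrite exprS; exact: coord_fieldM.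
  (* The equation as a single family of [n + n] terms: the coefficients of [q], attached to
     [X i * z ^+ j], then those of [- p], attached to [z ^+ j]. *)
  pose f (k : 'I_(n + n)) := match fintype.split k with inl j => q`_j | inr j => - p`_j end.
  pose b (k : 'I_(n + n)) := match fintype.split k with inl j => X i * z ^+ j | inr j => z ^+ j end.
  have sumE (g : {additive F -> F}) : g 0 = 0 ->
      \sum_k cst (g (f k)) * b k =
      X i * (map_poly (@cst F) (map_poly g q)).[z] - (map_poly (@cst F) (map_poly g p)).[z].
    move=> g0; have wide (r : {poly F}) : (size r <= n)%N ->
       (map_poly (@cst F) (map_poly g r)).[z] = \sum_(j < n) cst (g r`_j) * z ^+ j.
      move=> sr; rewrite (@horner_coef_wide _ n).
        by apply: eq_bigr => j _; rewrite coef_map /= coef_map_id0.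
      by rewrite size_map_poly (leq_trans (size_poly _ _)).
    rewrite big_split_ord /= !wide ?leq_maxl ?leq_maxr // mulr_sumr -sumrN.
    congr (_ + _); apply: eq_bigr => j _; rewrite /f /b.
      by rewrite (unsplitK (inl j)) mulrCA.
    by rewrite (unsplitK (inr j)) raddfN rmorphN mulNr.
  have qz0 : (map_poly (@cst F) q).[z] != 0 by rewrite -rhoE fmorph_eq0 tofrac_eq0.
  have sum0 : \sum_k cst (f k) * b k = 0.
    rewrite (sumE idfun) // !map_poly_id //.
    by rewrite -YE yE fmorph_div !rhoE divfK // subrr.
  have bK k : coord_field (@cst F \o il) X (b k).
    rewrite /b; case: (fintype.split k) => j //; apply: coord_fieldM => //; exact: coord_fieldX.
  have := lam_coord_field (curve_defined_over C_def pX) lamP bK sum0.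
  pose g : {additive F -> F} := il \o lam.
  rewrite (sumE g) ?rmorph0 //; last by rewrite /= !raddf0.
  have gE (r : {poly F}) : map_poly g r = map_poly il (map_poly lam r).
    by apply/polyP => j; rewrite coef_map /= !coef_map_id0 ?raddf0.
  rewrite !gE => /eqP; rewrite subr_eq0 -!rhoE -YE -rmorphM => /eqP/rho_inj e.
  have ql0 : map_poly lam q != 0.
    apply/eqP => /(congr1 (fun r : {poly Lt} => r`_(size q).-1)).
    rewrite coef_map_id0 ?raddf0 // -lead_coefE lam1 coef0 => /eqP.
    by rewrite oner_eq0.
  exists (map_poly lam p), (map_poly lam q); split=> //.
  have h0 : (map_poly il (map_poly lam q))%:F != 0 by rewrite tofrac_eq0 map_poly_eq0.
  exact: (canRL (mulfK h0) e).
have [p [q [r20 e]]] := (coord_fieldE _ _ _).1 zL; apply/coord_fieldE; exists p, q.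
have q0Y : ev (@cst F) Y (map_mpoly il q) != 0.
  by rewrite -(fmorph_eq0 rho) -evXY ev_map.
split; first by rewrite -ev_map.
apply: rho_inj; rewrite rho_t fmorph_div -!ev_map -!evXY !ev_map; exact: e.
Qed.

End ParametrizationOver.

(* z is the slope of the line through (m, s) and (x, y). *)
Lemma conic_slope (L : fieldType) (x y a g m s z : L) :
  y ^+ 2 = a * x ^+ 2 + g -> s ^+ 2 = a * m ^+ 2 + g -> x - m != 0 ->
  z = (y - s) / (x - m) -> z ^+ 2 - a != 0 ->
  x = (2 * a * m - 2 * s * z + m * (z ^+ 2 - a)) / (z ^+ 2 - a) /\
  y = (s * (z ^+ 2 - a) + z * (2 * a * m - 2 * s * z)) / (z ^+ 2 - a).
Proof.
move=> ye se w0 ze D0; set w := x - m in w0 ze.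
have yE : y = s + z * w by rewrite ze divfK // addrC subrK.
have xE : x = w + m by rewrite /w subrK.
have wD : w * (z ^+ 2 - a) = 2 * a * m - 2 * s * z.
  apply: (mulfI w0); apply/eqP; rewrite -subr_eq0; apply/eqP.
  have : y ^+ 2 - s ^+ 2 - (a * x ^+ 2 - a * m ^+ 2) = 0 by rewrite ye se; ring.
  by rewrite yE xE => <-; ring.
have wE : w = (2 * a * m - 2 * s * z) / (z ^+ 2 - a) by rewrite -wD mulfK.
split; first by rewrite xE mulrDl mulfK // -wE.
by rewrite yE mulrDl mulfK // -mulrA -wE.
Qed.

Lemma lin_quot (L : fieldType) (a0 a1 a2 d p q : L) : d != 0 ->
  a0 + a1 * (p / d) + a2 * (q / d) = (a0 * d + a1 * p + a2 * q) / d.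
Proof. by move=> d0; field. Qed.

Section QuadraticPoint.
Variables (K : fieldType) (F : closedFieldType) (io : {rmorphism K -> F}).
Variables (N : nat) (C : irreducible_curve F N).
Hypothesis C_def : curve_defined io C.
Variables (Lt : fieldType) (il : {rmorphism Lt -> F}) (j : {rmorphism K -> Lt}).
Hypothesis ilj : forall k, il (j k) = io k.

Lemma map_mpoly_ilj n (p : {mpoly K[n]}) : map_mpoly io p = map_mpoly il (map_mpoly j p).
Proof. by apply/mpolyP => m; rewrite !mcoeff_map_mpoly /= ilj. Qed.

Lemma curve_defined_ext : curve_defined il C.
Proof.
move=> p /C_def[n [c [g [gC ->]]]]; exists n, c, (fun i => map_mpoly j (g i)).
by split=> [i|]; [rewrite -map_mpoly_ilj | apply: eq_bigr => i _; rewrite -map_mpoly_ilj].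
Qed.

Lemma coord_field_ext X z : coord_field (@cst F \o io) X z -> coord_field (@cst F \o il) (X : 'I_N -> F(t)) z.
Proof.
move=> /coord_fieldE[p [q [q0 ->]]]; apply/coord_fieldE; exists (map_mpoly j p), (map_mpoly j q).
by rewrite -!ev_map -!map_mpoly_ilj !ev_map.
Qed.

Lemma point_parametrization L X x y al ga k s :
  is_subfield L -> (forall a, L a <-> exists m, il m = a) ->
  is_param C X -> conic_model io X x y al ga -> io (al * k ^+ 2 + ga) = s ^+ 2 -> L s ->
  is_field_of_parametrization C L.
Proof.
move=> Lsub Lim pX [xK yK e ind [c0 [c1 [c2 [d0 [d1 [d2 tE]]]]]]] sE Ls.
have xm0 : x - cst (io k) != 0.
  apply/eqP => h; have [|_ /eqP] := ind (- io k) 1 0; last by rewrite oner_eq0.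
  by rewrite rmorphN rmorph1 rmorph0 mul0r addr0 mul1r addrC.
pose z := (y - cst s) / (x - cst (io k)).
have zE : z = (y - cst s) / (x - cst (io k)) by [].
clearbody z.
(* A constant slope would be a linear relation between 1, [x] and [y]. *)
have z_nc c : z <> cst c.
  move=> h; have [|_ _ /eqP] := ind (c * io k - s) (- c) 1; last by rewrite oner_eq0.
  have : y - cst s = cst c * (x - cst (io k)) by rewrite -h zE divfK.
  rewrite rmorphB rmorphM rmorphN rmorph1 mul1r => /eqP; rewrite -subr_eq0 => /eqP <-.
  by ring.
have e' : cst s ^+ 2 = cst (io al) * cst (io k) ^+ 2 + cst (io ga).
  by rewrite -[LHS](rmorphXn (@cst F)) -sE !(rmorphD, rmorphM, rmorphXn).
have D0 : z ^+ 2 - cst (io al) != 0.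
  apply/eqP => h; have [||r] := @algebraic_cst F ('X^2 - (io al)%:P) z.
  - by rewrite -size_poly_eq0 size_XnsubC.
  - by rewrite rmorphB /= map_polyXn map_polyC /= hornerD hornerN hornerXn hornerC.
  exact: z_nc.
have [xE yE] := conic_slope e e' xm0 zE D0.
have zL : coord_field (@cst F \o il) X z.
  rewrite zE; apply: coord_fieldM; first apply: coord_fieldD; first exact: coord_field_ext.
    have /Lim[s' <-] := Ls; apply: coord_fieldN; exact: (coord_fieldC (@cst F \o il) X s').
  apply: coord_fieldV; apply: coord_fieldD; first exact: coord_field_ext.
  by apply: coord_fieldN; rewrite -ilj; exact: (coord_fieldC (@cst F \o il) X (j k)).
apply: (field_of_parametrization Lsub Lim curve_defined_ext pX zL z_nc).
(* As functions of the slope, [x - k = W / D], [x = P / D] and [y = Q / D]. *)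
pose D : {poly F} := 'X^2 - (io al)%:P.
pose W : {poly F} := (2 * io al * io k)%:P - (2 * s) *: 'X.
pose P := W + io k *: D; pose Q := s *: D + 'X * W.
have DE : (map_poly (@cst F) D).[z] = z ^+ 2 - cst (io al).
  by rewrite rmorphB /= map_polyXn map_polyC /= hornerD hornerN hornerXn hornerC.
have WE : (map_poly (@cst F) W).[z] = 2 * cst (io al) * cst (io k) - 2 * cst s * z.
  rewrite rmorphB /= map_polyC map_polyZ map_polyX /= hornerD hornerN hornerZ hornerX hornerC.
  by rewrite !(rmorphM (@cst F)) !(rmorph_nat (@cst F)).
have PE : x = (map_poly (@cst F) P).[z] / (map_poly (@cst F) D).[z].
  by rewrite {1}xE DE rmorphD /= map_polyZ hornerD hornerZ WE DE.
have QE : y = (map_poly (@cst F) Q).[z] / (map_poly (@cst F) D).[z].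
  by rewrite {1}yE DE rmorphD rmorphM /= map_polyZ map_polyX hornerD hornerZ hornerM hornerX WE DE.
clearbody P Q; clearbody W; clearbody D.
have lin a0 a1 a2 : cst a0 + cst a1 * x + cst a2 * y =
    (map_poly (@cst F) (a0 *: D + a1 *: P + a2 *: Q)).[z] / (map_poly (@cst F) D).[z].
  rewrite PE QE !rmorphD /= !map_polyZ !hornerD !hornerZ; apply: lin_quot.
  by rewrite DE.
exists (c0 *: D + c1 *: P + c2 *: Q), (d0 *: D + d1 *: P + d2 *: Q).
rewrite {1}tE (lin c0) (lin d0).
by apply/esym/quot_scale; rewrite invr_eq0 DE.
Qed.

End QuadraticPoint.

(** * Square classes of polynomial values *)

(* The values of a separable polynomial at integers meet infinitely many square classes. *)
Definition many_square_classes (K : fieldType) := forall h : {poly K},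
  (1 < size h)%N -> coprimep h h^`() -> forall D : seq K,
  exists y : int, forall d s, d \in D -> h.[y%:~R] <> d * s ^+ 2.

Lemma bezout_scale (L : fieldType) (a b c : L) (x y z w : {poly L}) :
  a%:P * (b *: x) * (c *: z) + b%:P * (a *: y) * (c *: w) =
  (b * a * c)%:P * (x * z + y * w).
Proof. by rewrite -!mul_polyC !polyCM; ring. Qed.

Section ClearPoly.
Variable R : idomainType.
Local Notation toF := (@FracField.tofrac R).

Lemma clear_poly (h : {poly {fraction R}}) : exists e (H : {poly R}),
  e != 0 /\ map_poly toF H = e%:F *: h.
Proof.
pose Z (z : {fraction R}) := exists p : R, z = p%:F.
have [|x y [a ->] [b ->]|i|_ [[e ->]]] :=
    @common_denom _ Z _ (fun i : 'I_(size h) => h`_i).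
- by exists 1; rewrite tofrac1.
- by exists (a * b); rewrite tofracM.
- have [a [b [b0 ->]]] := frac_ex h`_i; exists a%:F, b%:F.
  by split; [exists a|exists b|rewrite tofrac_eq0|].
rewrite tofrac_eq0 => e0 eP.
have [H HE] : exists H, map_poly toF H = e%:F *: h.
  apply: lift_poly => x /(nthP 0)[i _ <-]; rewrite coefZ.
  have [ih|hi] := ltnP i (size h).
    by have [p ->] := eP (Ordinal ih); exists p.
  by exists 0; rewrite nth_default // mulr0 rmorph0.
by exists e, H.
Qed.

(** The Bezout identity of [h] and its derivative without denominators. Separability survives
    specialization at any point where the constant [r] does not vanish, and a prime not dividing [r]
    cannot divide a value of [H] and of its derivative at the same integer. *)
Lemma clear_coprime (h : {poly {fraction R}}) : coprimep h h^`() ->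
  exists e r (H U V : {poly R}), [/\ e != 0, r != 0, map_poly toF H = e%:F *: h
    & U * H + V * H^`() = r%:P].
Proof.
move=> /Bezout_eq1_coprimepP[[u v] /= uv].
have [e [H [e0 HE]]] := clear_poly h.
have [eu [U0 [eu0 UE]]] := clear_poly u; have [ev [V0 [ev0 VE]]] := clear_poly v.
exists e, (eu * ev * e), H, (ev%:P * U0), (eu%:P * V0).
split=> //; first by rewrite !mulf_neq0.
apply: (map_inj_poly (f := toF)); [by move=> x y /eqP; rewrite tofrac_eq => /eqP | exact: tofrac0|].
have -> : map_poly toF (ev%:P * U0 * H + eu%:P * V0 * H^`()) =
    ev%:F%:P * (eu%:F *: u) * (e%:F *: h) + eu%:F%:P * (ev%:F *: v) * (e%:F *: h^`()).
  by rewrite -UE -VE -HE -derivZ -HE deriv_map rmorphD !rmorphM /= !map_polyC.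
by rewrite (@bezout_scale {fraction R}) uv mulr1 map_polyC /= !tofracM.
Qed.

End ClearPoly.

Lemma square_class_num (L : fieldType) (a b s : L) : b != 0 ->
  a / b * s ^+ 2 = a * b * (s ^+ 2 / b ^+ 2).
Proof. by move=> b0; field. Qed.

Section ClearSquare.
Variable R : idomainType.

(** [d] times the square of its denominator: a representative in [R] of the square class of [d]. *)
Definition numden (d : {fraction R}) : R := (frac (repr d)).1 * (frac (repr d)).2.

Lemma clear_square (h : {poly {fraction R}}) (H : {poly R}) (e : R) (y : int) d s :
  map_poly (@FracField.tofrac R) H = e%:F *: h -> h.[y%:~R] = d * s ^+ 2 ->
  exists s', (H.[y%:~R])%:F = (e * numden d)%:F * s' ^+ 2.
Proof.
move=> HE hy; exists (s / (frac (repr d)).2%:F).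
have q0 : (frac (repr d)).2%:F != 0 by rewrite tofrac_eq0; exact: denom_ratioP.
rewrite -horner_map rmorph_int HE hornerZ hy tofracM -mulrA; congr (_ * _).
rewrite {1}[d]fracE /numden tofracM expr_div_n.
exact: (@square_class_num {fraction R}).
Qed.

End ClearSquare.

(* Specialize the variable at an integer that is generic for h and D. *)
Lemma classes_transcendental (K : fieldType) : [pchar K] =i pred0 ->
  many_square_classes K -> many_square_classes {fraction {poly K}}.
Proof.
move=> char0 PK h h1 hcop D.
have [e [r [H [U [V [e0 r0 HE UV]]]]]] := clear_coprime hcop.
have sH : size H = size h.
  rewrite -(@size_scale _ e%:F h) ?tofrac_eq0 // -HE.
  by rewrite size_map_inj_poly ?tofrac0 // => x z /eqP; rewrite tofrac_eq => /eqP.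
have H0 : lead_coef H != 0 by rewrite lead_coef_eq0 -size_poly_gt0 sH ltnW.
pose del d := e * numden d.
pose pr := \prod_(d <- D | del d != 0) del d.
have pr0 : pr != 0 by rewrite prodf_seq_neq0; apply/allP => d _; apply/implyP.
have [c cn] := nonroot_nat char0 (mulf_neq0 (mulf_neq0 r0 H0) pr0).
move: cn; rewrite !hornerM !mulf_eq0 !negb_or -andbA => /and3P[rc Hc prc].
have delc d : d \in D -> del d != 0 -> (del d).[c%:R] != 0.
  move=> dD d0; move: prc; rewrite /pr horner_prod prodf_seq_neq0 => /allP/(_ d dD).
  by rewrite d0.
pose sp : {rmorphism {poly K} -> K} := horner_eval c%:R.
have sHc : size (map_poly sp H) = size H by rewrite size_poly_eq //= -lead_coefE.
have [||y yP] := PK (map_poly sp H) _ _ [seq sp (del d) | d <- D].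
- by rewrite sHc sH.
- apply/Bezout_coprimepP; exists (map_poly sp U, map_poly sp V) => /=.
  have UVc := congr1 (map_poly sp) UV; rewrite rmorphD !rmorphM /= map_polyC in UVc.
  by rewrite deriv_map UVc polyC_eqp1.
exists y => d s dD hy; have [s' s'E] := clear_square HE hy.
have sHy : sp H.[y%:~R] = (map_poly sp H).[y%:~R] by rewrite -horner_map rmorph_int.
have [d0|d0] := eqVneq (del d) 0.
  apply: (yP (sp (del d)) 0 (map_f _ dD)); rewrite d0 rmorph0 mul0r -sHy.
  move: s'E; rewrite -/(del d) d0 tofrac0 mul0r => /eqP.
  by rewrite tofrac_eq0 => /eqP ->; rewrite rmorph0.
have [n [m [m0 cop sE]]] := coprime_frac_ex s'.
have key : H.[y%:~R] * m ^+ 2 = del d * n ^+ 2.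
  have m20 : (m ^+ 2)%:F != 0 by rewrite tofrac_eq0 expf_neq0.
  apply/eqP; rewrite -tofrac_eq (tofracM H.[_]) s'E sE (tofracM (del d)) expr_div_n.
  by rewrite -2!tofracXn mulrA (divfK m20).
have keyc : (map_poly sp H).[y%:~R] * sp m ^+ 2 = sp (del d) * sp n ^+ 2.
  by rewrite -sHy -!rmorphXn -!rmorphM key.
(* If the denominator [m] vanished at the chosen integer, so would [n], since [del d] does not; but
   [n] and [m] are coprime. *)
have [mc|mc] := eqVneq (sp m) 0; last first.
  apply: (yP (sp (del d)) (sp n / sp m) (map_f _ dD)).
  apply: (mulIf (_ : sp m ^+ 2 != 0)); first by rewrite expf_neq0.
  by rewrite keyc -mulrA expr_div_n divfK // expf_neq0.
have nc : sp n = 0.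
  move: keyc; rewrite mc expr0n mulr0 => /esym/eqP; rewrite mulf_eq0 (negPf (delc d dD d0)) /=.
  by rewrite expf_eq0 /= => /eqP.
have := coprimep_root cop (_ : root n c%:R); rewrite rootE => /(_ (introT eqP nc)).
by rewrite -[_.[_]]/(sp m) mc eqxx.
Qed.

Lemma taylor_sq (H : {poly int}) (y p : int) :
  exists e, H.[y + p] = H.[y] + p * H^`().[y] + p ^+ 2 * e.
Proof.
elim/poly_ind: H => [|H c [e IH]]; first by exists 0; rewrite deriv0 !horner0; ring.
exists (H^`().[y] + e * (y + p)).
rewrite derivMXaddC !hornerMXaddC !(hornerD, hornerM, hornerX) IH; ring.
Qed.

(* With a = H(0), the value H(a B n) / a is congruent to 1 modulo B. *)
Lemma schur_prime (H : {poly int}) (B : int) : (1 < size H)%N -> B != 0 ->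
  exists (p : nat) (y : int), [/\ prime p, ~~ (p %| B)%Z & (p %| H.[y])%Z].
Proof.
move=> H1 B0.
have B0n : (0 < `|B|)%N by rewrite absz_gt0.
have notB (p : nat) : prime p -> coprime p `|B| -> ~~ (p%:Z %| B)%Z.
  move=> pp cop; rewrite dvdzE /=; apply/negP => pB.
  by move: cop; rewrite prime_coprime // pB.
(* [q] settles the case where some value of [H] is zero, which every prime divides. *)
have [q qB qp] : exists2 q, (`|B| < q)%N & prime q by have [q h1 h2] := prime_above `|B|; exists q.
have qcop : coprime q `|B|.
  by rewrite prime_coprime //; apply/negP => /(dvdn_leq B0n); rewrite leqNgt qB.
have triv (y : int) : H.[y] = 0 -> exists (p : nat) (y : int),
    [/\ prime p, ~~ (p%:Z %| B)%Z & (p%:Z %| H.[y])%Z].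
  by move=> Hy; exists q, y; rewrite Hy dvdz0; split=> //; exact: notB.
have [a0|a0] := eqVneq H.[0] 0; first exact: triv a0.
pose a := H.[0]; have [H' HE] : exists H' : {poly int}, H = a%:P + 'X * H'.
  have : root (H - a%:P) 0 by rewrite rootE !hornerE subrr.
  move=> /factor_theorem[H' e]; exists H'.
  by rewrite subr0 mulrC in e; rewrite -e addrC subrK.
have H'0 : H' != 0.
  by apply: contraTneq H1 => e; rewrite HE e mulr0 addr0 -leqNgt size_polyC_leq1.
(* The shift to [n.+1] keeps the argument [y] nonzero. *)
pose f (n : nat) : int := a * B * n.+1%:R.
have f_inj : injective f.
  move=> i j /(mulfI (mulf_neq0 a0 B0)) /(natr_inj_char0 (@pchar_num int)) [].
  by [].
(* For [H.[y] = a * m], the two factors, with [H'] the cofactor of ['X] in [H - a], exclude [m = 1]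
   and [m = -1]. Unless it is zero, [m] then has a prime factor. *)
have Q0 : H' * ('X * H' + (2 * a)%:P) != 0.
  rewrite mulf_neq0 //; apply/eqP => e; have : ('X * H')`_0 = - (2 * a).
    move/(congr1 (fun r : {poly int} => r`_0)): e.
    by rewrite coefD coefC /= coef0 => /eqP; rewrite addr_eq0 => /eqP.
  by rewrite coefXM /= => /eqP; rewrite eq_sym oppr_eq0 mulf_eq0 (negPf a0).
have [n] := nonroot_seq f_inj Q0; rewrite !(hornerM, hornerD, hornerX, hornerC).
rewrite mulf_eq0 negb_or => /andP[n1 n2]; set y := f n in n1 n2.
pose m := 1 + B * n.+1%:R * H'.[y].
have Hy : H.[y] = a * m by rewrite HE hornerD hornerC hornerM hornerX /y /f /m; ring.
have [m0|m0] := eqVneq m 0; first by apply: (triv y); rewrite Hy m0 mulr0.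
have nn : (n.+1%:R : int) != 0 by rewrite pnatr_eq0.
have y0 : y != 0 := mulf_neq0 (mulf_neq0 a0 B0) nn.
have m1 : (1 < `|m|)%N.
  rewrite ltn_neqAle absz_gt0 m0 andbT eq_sym; apply/negP.
  rewrite -eqz_nat abszE => /eqP m1.
  have : (m - 1) * (m + 1) = 0.
    have : m ^+ 2 = 1 by rewrite -(real_normK (num_real m)) m1 expr1n.
    have -> : (m - 1) * (m + 1) = m ^+ 2 - 1 by ring.
    by move=> ->; rewrite subrr.
  have e1 : a * (m - 1) = y * H'.[y] by rewrite /m /y /f; ring.
  have e2 : a * (m + 1) = y * H'.[y] + 2 * a by rewrite /m /y /f; ring.
  move=> /eqP; rewrite mulf_eq0 => /orP[]/eqP e.
    by move: e1; rewrite e mulr0 => /esym/eqP; rewrite mulf_eq0 (negPf y0) (negPf n1).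
  by move: e2; rewrite e mulr0 => /esym/eqP; rewrite (negPf n2).
have [p pp pm] := pdivP m1.
exists p, y; split=> //; last by rewrite Hy dvdz_mull // dvdzE.
apply: notB => //; rewrite prime_coprime //; apply/negP => pB.
have : (p%:Z %| m - B * (n.+1%:R * H'.[y]))%Z.
  by rewrite rpredB // ?dvdz_mulr // dvdzE.
rewrite /m mulrA addrK dvdz1 /= => /eqP e.
by move: pp; rewrite e.
Qed.

(* For a prime p dividing H(y) but not the Bezout constant r, p divides H(y) or H(y + p) exactly once. *)
Lemma classes_int : many_square_classes {fraction int}.
Proof.
move=> h h1 hcop D.
have [e [r [H [U [V [e0 r0 HE UV]]]]]] := clear_coprime hcop.
have sH : size H = size h.
  rewrite -(@size_scale _ e%:F h) ?tofrac_eq0 // -HE.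
  by rewrite size_map_inj_poly ?tofrac0 // => x z /eqP; rewrite tofrac_eq => /eqP.
pose del d := e * numden d.
pose pr := \prod_(d <- D | del d != 0) del d.
have pr0 : pr != 0 by rewrite prodf_seq_neq0; apply/allP => d _; apply/implyP.
have [|p [y0 [pp pB pH]]] := @schur_prime H (r * pr) _ (mulf_neq0 r0 pr0).
  by rewrite sH.
have pr_ndvd : ~~ (p %| r)%Z by apply: contra pB => /dvdz_mulr.
have del_ndvd d : d \in D -> del d != 0 -> ~~ (p %| del d)%Z.
  move=> dD d0; apply: contra pB => pd; apply/dvdz_mull.
  by rewrite /pr (big_rem d) //= d0 dvdz_mulr.
have p0 : p%:Z != 0 by rewrite eqz_nat -lt0n prime_gt0.
have [y [pHy p2Hy]] : exists y : int, (p %| H.[y])%Z /\ ~~ (p%:Z ^+ 2 %| H.[y])%Z.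
  have [p2|] := boolP (p%:Z ^+ 2 %| H.[y0])%Z; last by exists y0.
  have [k kE] := taylor_sq H y0 p; exists (y0 + p); rewrite kE; split.
    by rewrite !rpredD // ?dvdz_mulr // expr2 -mulrA dvdz_mulr.
  apply/negP => hp2; have : (p%:Z ^+ 2 %| p%:Z * H^`().[y0])%Z.
    have -> : p%:Z * H^`().[y0] = H.[y0] + p%:Z * H^`().[y0] + p%:Z ^+ 2 * k - H.[y0] - p%:Z ^+ 2 * k.
      by ring.
    by apply: rpredB; [exact: rpredB | exact: dvdz_mulr].
  rewrite expr2 dvdz_mul2l // => pH'; move/negP: pr_ndvd; apply.
  have := congr1 (fun q : {poly int} => q.[y0]) UV.
  by rewrite hornerD !hornerM hornerC => <-; rewrite rpredD // dvdz_mull.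
exists y => d s dD hy; have [s' s'E] := clear_square HE hy; rewrite intz in s'E.
have [d0|d0] := eqVneq (del d) 0.
  move: s'E; rewrite -/(del d) d0 tofrac0 mul0r => /eqP.
  by rewrite tofrac_eq0 => /eqP Hy; rewrite Hy dvdz0 in p2Hy.
have [n [m [m0 sE]]] := frac_ex s'.
have key : H.[y] * m ^+ 2 = del d * n ^+ 2.
  have m20 : (m ^+ 2)%:F != 0 by rewrite tofrac_eq0 expf_neq0.
  apply/eqP; rewrite -tofrac_eq (tofracM H.[_]) s'E sE (tofracM (del d)) expr_div_n.
  by rewrite -2!tofracXn mulrA (divfK m20).
have Hy0 : H.[y] != 0 by apply: contraNneq p2Hy => ->; rewrite dvdz0.
have n0 : n != 0.
  apply: contra_eq_neq key => ->; rewrite expr0n mulr0.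
  by rewrite mulf_eq0 (negPf Hy0) expf_eq0 (negPf m0).
have ldel : logn p `|del d| = 0%N.
  by apply/eqP; rewrite -leqn0 leqNgt logn_gt0 mem_primes pp absz_gt0 d0 /= -(dvdzE p); exact: del_ndvd.
have lH : logn p `|H.[y]| = 1%N.
  have Hn : (0 < `|H.[y]|)%N by rewrite absz_gt0.
  apply/eqP; rewrite eqn_leq; apply/andP; split.
    rewrite leqNgt -(pfactor_dvdn 2 pp Hn); apply: contra p2Hy.
    by rewrite dvdzE abszX.
  by rewrite -(pfactor_dvdn 1 pp Hn) expn1; move: pHy; rewrite dvdzE.
(* The valuation at [p] of the left-hand side of [key] is odd, that of the right-hand side even. *)
have := congr1 (fun x : int => odd (logn p `|x|)) key.
rewrite !(abszM _ (_ ^+ 2)) !abszX !lognM ?expn_gt0 ?absz_gt0 ?Hy0 ?m0 ?n0 ?d0 //.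
by rewrite lH ldel !addnn !oddD !odd_double.
Qed.

(** * Values that are not squares *)

Section Kummer.
Variables (K : fieldType) (L : fieldExtType K) (M : {subfield L}).
Hypothesis two_neq0 : 2%:R != 0 :> L.

Lemma Fadjoin_sqrt (E : {subfield L}) (r s : L) : r ^+ 2 \in E -> s \in <<E; r>>%VS ->
  exists a b, [/\ a \in E, b \in E & s = a + b * r].
Proof.
move=> r2 /Fadjoin_polyP[p pE ->].
have q0 : size ('X^2 - (r ^+ 2)%:P : {poly L}) = 3%N by rewrite size_XnsubC.
have qm : ('X^2 - (r ^+ 2)%:P : {poly L}) \is monic by rewrite monicXnsubC.
have qE : ('X^2 - (r ^+ 2)%:P) \is a polyOver E.
  by rewrite rpredB ?rpredX ?polyOverX ?polyOverC.
pose m := p %% ('X^2 - (r ^+ 2)%:P).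
have mE : m \is a polyOver E by rewrite modp_polyOver.
have pm : p.[r] = m.[r].
  rewrite [in LHS](divp_eq p ('X^2 - (r ^+ 2)%:P)) hornerD hornerM.
  by rewrite !hornerE subrr mulr0 add0r.
have sm : (size m <= 2)%N by rewrite -ltnS -q0 ltn_modp -size_poly_gt0 q0.
exists m`_0, m`_1; split; try exact: (polyOverP mE).
by rewrite pm (horner_coef_wide _ sm) !big_ord_recl big_ord0 /= expr0 mulr1 expr1 addr0.
Qed.

(* Adjoining r with r^2 in M enlarges D only by its multiples by r^2, since (a + b r)^2 can
   lie in M only if a b = 0. *)
Lemma finite_square_classes : exists D : seq L, {subset D <= M} /\
  forall e s, e \in M -> e = s ^+ 2 -> exists d r, [/\ d \in D, r \in M & e = d * r ^+ 2].
Proof.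
(* [E] runs through the fields between [M] and [L], and [D] represents the elements of [M] that are
   squares in [E]. The induction is on the codimension of [E]; it ends when every square root in [L]
   of an element of [M] lies in [E]. *)
suff main n : forall (E : {subfield L}) (D : seq L), (\dim {:L} - \dim E < n)%N ->
    (M <= E)%VS -> {subset D <= M} ->
    (forall e s, e \in M -> s \in E -> e = s ^+ 2 ->
       exists d r, [/\ d \in D, r \in M & e = d * r ^+ 2]) ->
    exists D : seq L, {subset D <= M} /\ forall e s, e \in M -> e = s ^+ 2 ->
      exists d r, [/\ d \in D, r \in M & e = d * r ^+ 2].
  apply: (main (\dim {:L} - \dim M).+1 M [:: 1]) => //.
    by move=> d; rewrite inE => /eqP->; exact: mem1v.
  move=> e s eM sM es; exists 1, s; split=> //; first exact: mem_head.
  by rewrite mul1r.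
elim: n => // n IH E D dimE ME DM QE.
have [[r [rM rE]]|noR] := pselect (exists r, r ^+ 2 \in M /\ r \notin E); last first.
  exists D; split=> // e s eM es; apply: (QE e s) => //.
  by apply/negPn/negP => sE; apply: noR; exists s; rewrite -es.
have r0 : r != 0 by apply: contraNneq rE => ->; exact: mem0v.
have rE2 : r ^+ 2 \in E := subvP ME _ rM.
apply: (IH <<E; r>>%AS (D ++ [seq d * r ^+ 2 | d <- D])).
- have lt : (\dim E < \dim <<E; r>>)%N.
    rewrite ltn_neqAle dimvS ?subv_adjoin // andbT; apply: contra rE => /eqP e.
    have /eqP -> : E == <<E; r>>%VS :> {vspace L} by rewrite eqEdim subv_adjoin e /=.
    exact: memv_adjoin.
  rewrite -ltnS; apply: leq_trans dimE; rewrite ltnS ltn_sub2l //.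
  by apply: leq_trans lt _; apply: dimvS; exact: subvf.
- exact: subv_trans ME (subv_adjoin _ _).
- move=> d; rewrite mem_cat => /orP[/DM //|/mapP[d' /DM d'M ->]].
  by rewrite rpredM.
move=> e s eM sE' es; have [a [b [aE bE sE]]] := Fadjoin_sqrt rE2 sE'.
have ab0 : a * b = 0.
  apply/eqP; apply: contraNT rE => ab0.
  have -> : r = (e - a ^+ 2 - b ^+ 2 * r ^+ 2) / (2%:R * (a * b)).
    apply: (canRL (mulfK _)); first by rewrite mulf_neq0.
    by rewrite es sE; ring.
  have eE : e \in E := subvP ME _ eM.
  have numE : e - a ^+ 2 - b ^+ 2 * r ^+ 2 \in E.
    by apply: rpredB; [rewrite rpredB // rpredX | apply: rpredM => //; rewrite rpredX].
  have denE : 2%:R * (a * b) \in E by rewrite mulr_natl rpredMn // rpredM.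
  exact: rpred_div numE denE.
move/eqP: ab0; rewrite mulf_eq0 => /orP[]/eqP e0.
  have [||d [k [dD kM ek]]] := QE (e / r ^+ 2) b _ bE.
  - by rewrite rpred_div.
  - by rewrite es sE e0 add0r exprMn mulfK // expf_neq0.
  exists (d * r ^+ 2), k; split=> //; last first.
    by rewrite mulrAC -ek divfK // expf_neq0.
  by rewrite mem_cat; apply/orP; right; apply: map_f.
have [|d [k [dD kM ek]]] := QE e s eM _ es; first by rewrite sE e0 mul0r addr0.
by exists d, k; split=> //; rewrite mem_cat dD.
Qed.

End Kummer.

(** The dimension is put in the form [n.+1], for which square matrices form a ring and [horner_mx]
    is available. *)
Lemma matrix_of_monic (K : fieldType) (mu : {poly K}) : mu \is monic -> (1 < size mu)%N ->
  exists n (A : 'M[K]_n.+1), char_poly A = mu.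
Proof.
move=> mon s1; have := companionmxK mon; move: (companionmx mu).
have -> : (size mu).-1 = (size mu).-2.+1 by rewrite prednK // -subn1 subn_gt0.
by move=> A; exists (size mu).-2, A.
Qed.

Lemma det_add_scalar (K : comNzRingType) n (A : 'M[K]_n.+1) (a : K) :
  \det (a%:M + A) = (-1) ^+ n.+1 * (char_poly A).[- a].
Proof.
rewrite -[_.[_]]/(horner_eval (- a) (char_poly A)) /char_poly -det_map_mx.
have -> : map_mx (horner_eval (- a)) (char_poly_mx A) = -1 *: (a%:M + A).
  apply/matrixP => i j; rewrite !mxE /horner_eval /=.
  by rewrite hornerD hornerN hornerC hornerMn hornerX mulN1r opprD mulNrn.
by rewrite detZ mulrA -exprMn mulrNN mulr1 expr1n mul1r.
Qed.

(** The map sending [p] to [\det (horner_mx A p)] plays the part of the norm from [K[c]], for [c] a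
    root of the characteristic polynomial of [A]: it is multiplicative, and by Cayley-Hamilton it
    depends only on [p] modulo that polynomial. *)
Lemma det_horner_mx_square (K : fieldType) n (A : 'M[K]_n.+1) (a : K) (d r : {poly K}) :
  char_poly A %| a%:P + 'X - d * r ^+ 2 ->
  \det (a%:M + A) = \det (horner_mx A d) * \det (horner_mx A r) ^+ 2.
Proof.
move=> /dvdpP[q e]; have := congr1 (horner_mx A) e.
rewrite rmorphB rmorphD !rmorphM /= Cayley_Hamilton mulr0 horner_mx_C horner_mx_X.
by move/eqP; rewrite subr_eq0 => /eqP->; rewrite !det_mulmx expr2.
Qed.

(** By the chain rule the derivative is [-2 X] times [mu'(-X^2)]. Separability of [mu] takes care of
    the second factor, [mu.[0] != 0] of the first. *)
Lemma coprimep_comp_NX2 (K : fieldType) (mu : {poly K}) : [pchar K] =i pred0 ->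
  separable_poly mu -> mu.[0] != 0 ->
  coprimep (mu \Po - 'X^2) (mu \Po - 'X^2)^`().
Proof.
move=> char0 smu mu0; rewrite deriv_comp coprimepMr; apply/andP; split.
  move: smu; rewrite separable_poly.unlock => /Bezout_eq1_coprimepP[[u v] /= uv].
  apply/Bezout_eq1_coprimepP; exists (u \Po - 'X^2, v \Po - 'X^2) => /=.
  by rewrite -!comp_polyM -comp_polyD uv comp_polyC.
have -> : (- 'X^2 : {poly K})^`() = - 2%:R *: 'X.
  by rewrite derivN derivXn /= expr1 scaleNr scaler_nat.
rewrite coprimepZr; last by rewrite oppr_eq0 ((pcharf0P _).1 char0).
have := coprimep_XsubC (mu \Po - 'X^2) 0; rewrite subr0 => ->.
by rewrite rootE horner_comp !hornerE /= expr0n oppr0.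
Qed.

(* Otherwise the y^2 + c, for integers y, fill finitely many square classes
   of K(c); taking norms, so do the values of mu(-Y^2) in K, mu the minimal polynomial of c. *)
Lemma nonsquare_translate (K : fieldType) (L : fieldExtType K) (c : L) :
  [pchar K] =i pred0 -> many_square_classes K -> c != 0 ->
  exists y : int, forall s : L, y%:~R ^+ 2 + c != s ^+ 2.
Proof.
move=> char0 PK c0; apply: contrapT => /forallNP nex.
have sq (y : int) : exists s : L, y%:~R ^+ 2 + c = s ^+ 2.
  apply: contrapT => h; apply: (nex y) => s; apply/eqP => e; apply: h; by exists s.
have charL0 : [pchar L] =i pred0 by move=> p; rewrite (fmorph_pchar (in_alg L)).
have two0 : 2%:R != 0 :> L by rewrite ((pcharf0P _).1 charL0).
have algc : algebraicOver (in_alg L) c.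
  have /polyOver1P[p pE] := minPolyOver 1%AS c.
  exists p; last by rewrite -pE root_minPoly.
  apply: contraTneq (monic_minPoly 1%AS c) => p0.
  by rewrite pE p0 rmorph0 monicE lead_coef0 eq_sym oner_eq0.
have [mu0 [mu00 mu0c mu0min mu0sep]] := minimal_poly_ex charL0 algc.
have lc0 : (lead_coef mu0)^-1 != 0 by rewrite invr_eq0 lead_coef_eq0.
pose mu := (lead_coef mu0)^-1 *: mu0.
have mumon : mu \is monic by rewrite monicE lead_coefZ mulVf // lead_coef_eq0.
have mumin p : root (map_poly (in_alg L) p) c -> mu %| p.
  by move=> /mu0min; rewrite dvdpZl.
have musep : separable_poly mu by rewrite (eqp_separable (eqp_scale _ lc0)).
have muc : root (map_poly (in_alg L) mu) c.
  by rewrite map_polyZ rootZ ?fmorph_eq0.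
have s1 : (1 < size mu)%N.
  rewrite ltnNge; apply/negP => /size1_polyC e; move: muc mumon; rewrite e map_polyC rootC fmorph_eq0.
  by move=> /eqP->; rewrite monicE lead_coef0 eq_sym oner_eq0.
have mun0 : mu != 0 by rewrite -size_poly_gt0 ltnW.
have mu_0 : mu.[0] != 0.
  apply: contra_neq c0 => /eqP; rewrite -[_ == 0]/(root mu 0) => /factor_theorem[q qE].
  move: muc; rewrite qE rmorphM rootM /= map_polyXsubC rmorph0 root_XsubC => /orP[|/eqP //].
  move=> /mumin/dvdp_leq; have q0 : q != 0 by apply: contraNneq mun0 => q0; rewrite qE q0 mul0r.
  by rewrite qE size_Mmonic ?monicXsubC // size_XsubC addn2 ltnn => /(_ q0).
have [n [A AE]] := matrix_of_monic mumon s1.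
have [D [DM DP]] := finite_square_classes <<1; c>>%AS two0.
have lift x : exists p : {poly K}, x \in <<1; c>>%VS -> x = (map_poly (in_alg L) p).[c].
  have [/Fadjoin1_polyP[p ->]|_] := boolP (x \in <<1; c>>%VS); by [exists p|exists 0].
have {lift}[l lP] := choice lift.
(* By [det_add_scalar], the value of [h] at [y] is the norm of [y^2 + c]. *)
pose h := (-1) ^+ n.+1 *: (mu \Po - 'X^2).
have sgn0 : (-1) ^+ n.+1 != 0 :> K by rewrite signr_eq0.
have [||y yP] := PK h _ _ [seq \det (horner_mx A (l d)) | d <- D].
- rewrite size_scale // -subn_gt0 subn1 size_comp_poly size_polyN size_polyXn.
  by rewrite muln_gt0 andbT -subn1 subn_gt0.
- by rewrite coprimepZl // derivZ coprimepZr //; exact: coprimep_comp_NX2.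
have [s ys] := sq y; have cM : c \in <<1; c>>%VS by exact: memv_adjoin.
have [|d [r [dD rM er]]] := DP _ s _ ys.
  by rewrite rpredD // rpredX // rpred_int.
apply: (yP (\det (horner_mx A (l d))) (\det (horner_mx A (l r)))); first exact: map_f.
rewrite -(@det_horner_mx_square _ _ _ (y%:~R ^+ 2)) ?det_add_scalar ?AE.
  by rewrite hornerZ horner_comp hornerN hornerXn.
apply: mumin; rewrite !rmorphB !rmorphD !rmorphM /= map_polyC map_polyX rootE.
rewrite hornerD hornerN !(hornerM, hornerD, hornerC, hornerX) /=.
rewrite -(lP d (DM d dD)) -(lP r rM) -expr2 -er scaler_int -rmorphXn /=.
by rewrite subrr.
Qed.

Lemma intr_inj_char0 (F : fieldType) : [pchar F] =i pred0 ->
  forall m : int, m%:~R = 0 :> F -> m = 0.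
Proof.
move=> char0 m /eqP; case: (intP m) => // n.
  by rewrite ((pcharf0P _).1 char0).
by rewrite mulrNz oppr_eq0 ((pcharf0P _).1 char0).
Qed.

Lemma pchar_fraction (R : idomainType) : [pchar R] =i pred0 -> [pchar {fraction R}] =i pred0.
Proof.
move=> char0 p; rewrite -(char0 p) !inE; congr (_ && _).
by rewrite -[_%:R](rmorph_nat (@FracField.tofrac R)) tofrac_eq0.
Qed.

(* K is purely transcendental over the rational numbers and z a primitive element. *)
Lemma many_classes_subfield (F : fieldType) (s : seq F) : [pchar F] =i pred0 ->
  exists (K : fieldType) (io : {rmorphism K -> F}) z,
  [/\ [pchar K] =i pred0, many_square_classes K, algebraicOver io z
    & forall x, x \in s -> adjoined io z x].
Proof.
move=> char0; elim: s => [|x s [K [io [z [cK PK algz IH]]]]].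
  have [io _] := @frac_lift_ex _ _ intr (intr_inj_char0 char0).
  exists {fraction int}, io, 0; split=> //.
  - by apply: pchar_fraction; exact: Num.Theory.pchar_num.
  - exact: classes_int.
  - exact: algebraic0.
have [algx|trx] := pselect (algebraicOver io x).
  have [|th [algth adj]] := @primitive_element _ _ io [:: z; x] char0.
    by move=> y; rewrite !inE => /orP[]/eqP->.
  exists K, io, th; split=> // y; rewrite inE => /orP[/eqP->|ys].
    by apply: adj; rewrite !inE eqxx orbT.
  by apply: adjoined_trans (IH y ys); apply: adj; rewrite !inE eqxx.
pose f : {rmorphism {poly K} -> F} := horner_eval x \o map_poly io.
have f_inj p : f p = 0 -> p = 0.
  move=> fp; apply/eqP; apply/negPn/negP => p0; apply: trx.
  by exists p => //; rewrite rootE -[_.[x]]/(f p) fp.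
have [io' io'E] := frac_lift_ex f_inj.
have io'C k : io' k%:P%:F = io k by rewrite io'E /f /= map_polyC /horner_eval hornerC.
have lift (r : {poly K}) y : (map_poly io r).[y] =
    (map_poly io' (map_poly (@FracField.tofrac _ \o polyC) r)).[y].
  by rewrite -map_poly_comp; congr (_.[y]); apply: eq_map_poly => k /=; rewrite io'C.
exists {fraction {poly K}}, io', z; split.
- by apply: pchar_fraction => p; rewrite pchar_poly.
- exact: classes_transcendental.
- have [p p0 pz] := algz; exists (map_poly (@FracField.tofrac _ \o polyC) p).
    by rewrite map_poly_eq0.
  by rewrite rootE -lift.
move=> y; rewrite inE => /orP[/eqP->|/IH[r ->]].
  suff -> : x = io' 'X%:F by exact: adjoined_base.
  by rewrite io'E /f /= map_polyX /horner_eval hornerX.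
by exists (map_poly (@FracField.tofrac _ \o polyC) r); rewrite lift.
Qed.

(** * Subfields and quadratic extensions *)

Lemma is_subfieldP (F : fieldType) (L : set F) :
  is_subfield L <-> [/\ L 1, forall x y, L x -> L y -> L (x - y)
    & forall x y, L x -> L y -> L (x / y)].
Proof.
have mE x : (x \in mem L) = (x \in L) by [].
split=> [[h1 hB hV]|[h1 hB hV]].
  split=> [|x y Lx Ly|x y Lx Ly]; apply/set_mem; [exact: h1|apply: hB|apply: hV];
    exact/mem_set.
by split=> [|x y /set_mem Lx /set_mem Ly|x y /set_mem Lx /set_mem Ly]; apply/mem_set;
  [|exact: hB|exact: hV].
Qed.

Lemma generated_subfield_min (F : fieldType) (s : seq F) (L : set F) :
  is_subfield L -> (forall x, x \in s -> L x) -> generated_subfield s `<=` L.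
Proof. by move=> Ls sL x; apply=> // y /sL; exact/mem_set. Qed.

Lemma adjoined_subfield (K F : fieldType) (io : {rmorphism K -> F}) z :
  algebraicOver io z -> is_subfield [set x | adjoined io z x].
Proof.
move=> algz; apply/is_subfieldP; split=> [|x y hx hy|x y hx hy] /=.
- by rewrite -(rmorph1 io); exact: adjoined_base.
- by apply: adjoinedD => //; exact: adjoinedN.
by apply: adjoinedM => //; exact: adjoinedV.
Qed.

Lemma irreducible_minimal (K F : fieldType) (io : {rmorphism K -> F}) (z : F) mu :
  mu != 0 -> root (map_poly io mu) z ->
  (forall p, root (map_poly io p) z -> mu %| p) -> irreducible_poly mu.
Proof.
move=> mu0 muz mumin; split.
  rewrite ltnNge; apply/negP => /size1_polyC e; move: muz mu0.
  by rewrite e map_polyC rootC fmorph_eq0 polyC_eq0 => ->.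
move=> q q1 /dvdpP[r e]; rewrite /eqp e dvdp_mull //= -e.
rewrite {1}e rmorphM rootM in muz; case/orP: muz => [/mumin/dvdp_leq h|/mumin //].
have [r0 q0] : r != 0 /\ q != 0 by apply/andP; rewrite -negb_or -mulf_eq0 -e.
have := h r0; rewrite e size_mul // => le.
case/negP: q1; rewrite eqn_leq size_poly_gt0 q0 andbT.
rewrite -(leq_add2l (size r)) addn1 -[leqLHS]prednK ?ltnS //.
by rewrite addn_gt0 size_poly_gt0 r0.
Qed.

(** Writing [al = a^2] gives [al y^2 + ga = a^2 (y^2 + ga / al)], so with [a], [al], [ga] added to
    the generators the question becomes whether [y^2 + c] is a square, for [c = ga / al].
    [nonsquare_translate] answers it in [L], a copy of [K(z)] as a finite extension type; [tr]
    carries polynomial relations of [z] over to [zL]. *)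
Lemma nonsquare_value (F : closedFieldType) (S : seq F) (al ga : F) :
  [pchar F] =i pred0 -> al != 0 -> ga != 0 ->
  exists y : int, forall w, w ^+ 2 = al * y%:~R ^+ 2 + ga -> ~ generated_subfield S w.
Proof.
move=> char0 al0 ga0.
have [a aE] : exists a, a ^+ 2 = al.
  have [a] := @solve_monicpoly F 2 (fun i => if i == 0%N then al else 0) isT.
  by rewrite !big_ord_recl big_ord0 /= mul0r !addr0 expr0 mulr1 => ?; exists a.
have a0 : a != 0 by apply: contraNneq al0 => a0; rewrite -aE a0 expr0n.
have [K [io [z [charK PK algz adj]]]] := many_classes_subfield [:: a, al, ga & S] char0.
have subF := adjoined_subfield algz.
have aA : adjoined io z a by apply: adj; rewrite !inE eqxx.
have cA : adjoined io z (ga / al).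
  apply: adjoinedM; first by apply: adj; rewrite !inE eqxx !orbT.
  by apply: adjoinedV => //; apply: adj; rewrite !inE eqxx !orbT.
have cVA := adjoinedV algz cA.
have [mu [mu0 muz mumin _]] := minimal_poly_ex char0 algz.
have [L _ [zL rzL _]] := irredp_FAdjoin (irreducible_minimal mu0 muz mumin).
have tr p : (map_poly io p).[z] = 0 -> (map_poly (in_alg L) p).[zL] = 0.
  move=> pz; have /mumin/dvdpP[q ->] : root (map_poly io p) z by exact/eqP.
  by rewrite rmorphM hornerM (eqP rzL) mulr0.
have [c cE] := cA; have [c' c'E] := cVA.
pose cL := (map_poly (in_alg L) c).[zL].
have cL0 : cL != 0.
  have : cL * (map_poly (in_alg L) c').[zL] - 1 = 0.
    have := tr (c * c' - 1); rewrite !rmorphB !rmorphM !rmorph1 /= !hornerE; apply.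
    by rewrite -cE -c'E mulfV ?subrr // mulf_neq0 // invr_eq0.
  by apply: contra_eq_neq => ->; rewrite mul0r sub0r oppr_eq0 oner_eq0.
have [y yP] := nonsquare_translate charK PK cL0.
exists y => w wE Sw.
have [s sE] : adjoined io z (w / a).
  apply: adjoinedM; last exact: adjoinedV.
  apply: (generated_subfield_min subF _ Sw) => x xS; apply: adj.
  by rewrite !inE xS !orbT.
have /eqP[] := yP (map_poly (in_alg L) s).[zL].
have tE (M : fieldType) (f : {rmorphism K -> M}) v :
    (map_poly f ((y%:~R ^+ 2)%:P + c - s ^+ 2)).[v] =
    y%:~R ^+ 2 + (map_poly f c).[v] - (map_poly f s).[v] ^+ 2.
  rewrite rmorphB rmorphD /= map_polyC hornerD hornerN hornerD hornerC.
  by rewrite /= !rmorphXn rmorph_int /= horner_exp.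
apply/eqP; rewrite -subr_eq0 -tE; apply/eqP; apply: tr; rewrite tE -cE -sE.
by rewrite expr_div_n aE wE mulrDl mulrAC mulfV // mul1r subrr.
Qed.

Section SubfieldEmbedding.
Variables (F : fieldType) (L : set F).
Hypothesis L_subfield : is_subfield L.

Lemma embedded_subfield : exists (M : fieldType) (io : {rmorphism M -> F}),
  forall x, L x <-> exists m, io m = x.
Proof.
have [M [io ioP]] := subfield_ex L_subfield; exists M, io => x.
by rewrite -ioP; split=> [/mem_set|/set_mem].
Qed.

Lemma subfield0 : L 0.
Proof. by have /is_subfieldP[L1 LB _] := L_subfield; rewrite -(subrr 1); exact: LB. Qed.
Lemma subfield1 : L 1. Proof. by have /is_subfieldP[] := L_subfield. Qed.
Lemma subfieldB x y : L x -> L y -> L (x - y).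
Proof. by have /is_subfieldP[_ LB _] := L_subfield; exact: LB. Qed.
Lemma subfield_div x y : L x -> L y -> L (x / y).
Proof. by have /is_subfieldP[_ _ LV] := L_subfield; exact: LV. Qed.
Lemma subfieldD x y : L x -> L y -> L (x + y).
Proof.
by move=> Lx Ly; rewrite -[y]opprK -[- y]sub0r; do 2!apply: subfieldB => //; exact: subfield0.
Qed.
Lemma subfieldM x y : L x -> L y -> L (x * y).
Proof.
by move=> Lx Ly; rewrite -[y]invrK -[y^-1]mul1r; do 2!apply: subfield_div => //; exact: subfield1.
Qed.

End SubfieldEmbedding.

Lemma inclusion_ex (K L F : fieldType) (io : {rmorphism K -> F}) (il : {rmorphism L -> F}) :
  (forall k, exists l, il l = io k) ->
  exists j : {rmorphism K -> L}, forall k, il (j k) = io k.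
Proof.
move=> /choice[j jE].
have jB : zmod_morphism j by move=> x y; apply: (fmorph_inj il); rewrite rmorphB !jE rmorphB.
have jM : monoid_morphism j.
  by split=> [|x y]; apply: (fmorph_inj il); rewrite ?rmorph1 ?rmorphM !jE ?rmorph1 ?rmorphM.
pose jm := HB.pack_for {rmorphism K -> L} j (GRing.isZmodMorphism.Build K L j jB)
  (GRing.isMonoidMorphism.Build K L j jM).
by exists jm.
Qed.

Section SquareRoot.
Variables (F : fieldType) (K : set F) (w d : F).
Hypotheses (K_subfield : is_subfield K) (wd : w ^+ 2 = d) (Kd : K d) (Kw : ~ K w).

Definition adjoin_sqrt : set F := [set x | exists a b, [/\ K a, K b & x = a + b * w]].

Lemma adjoin_sqrt_base : K `<=` adjoin_sqrt.
Proof. by move=> x Kx; exists x, 0; split=> //; [exact: subfield0 | rewrite mul0r addr0]. Qed.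

Lemma adjoin_sqrt_gen : adjoin_sqrt w.
Proof.
by exists 0, 1; split; [exact: subfield0 | exact: subfield1 | rewrite mul1r add0r].
Qed.

Lemma sqrt_free a b : K a -> K b -> a + b * w = 0 -> a = 0 /\ b = 0.
Proof.
move=> Ka Kb e; have b0 : b = 0.
  apply/eqP; apply: contrapT => /negP b0; apply: Kw.
  have -> : w = (0 - a) / b by apply: (mulIf b0); rewrite divfK // -e; ring.
  by apply: subfield_div => //; apply: subfieldB => //; exact: subfield0.
by move: e; rewrite b0 mul0r addr0.
Qed.

Lemma adjoin_sqrt_subfield : is_subfield adjoin_sqrt.
Proof.
have K0 := subfield0 K_subfield; have KB := subfieldB K_subfield.
have KM := subfieldM K_subfield; have KV := subfield_div K_subfield.
apply/is_subfieldP; split.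
- by apply: adjoin_sqrt_base; exact: subfield1.
- move=> _ _ [a [b [Ka Kb ->]]] [a' [b' [Ka' Kb' ->]]].
  by exists (a - a'), (b - b'); split; [exact: KB|exact: KB|ring].
move=> _ _ [a [b [Ka Kb ->]]] [c [e [Kc Ke ->]]].
have [y0|y0] := eqVneq (c + e * w) 0.
  by rewrite y0 invr0 mulr0; apply: adjoin_sqrt_base.
have y'0 : c - e * w != 0.
  apply/eqP => h; have [|||c0 e0] := @sqrt_free c (0 - e); [by []|exact: KB| |].
    by rewrite sub0r mulNr.
  move/eqP: y0; apply; have -> : e = 0 - (0 - e) by ring.
  by rewrite c0 e0; ring.
have N0 : c ^+ 2 - e ^+ 2 * d != 0.
  have -> : c ^+ 2 - e ^+ 2 * d = (c + e * w) * (c - e * w) by rewrite -wd; ring.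
  exact: mulf_neq0.
have KN : K (c ^+ 2 - e ^+ 2 * d) by rewrite !expr2; apply: (KB); apply: (KM) => //; exact: KM.
exists ((a * c - b * e * d) / (c ^+ 2 - e ^+ 2 * d)), ((b * c - a * e) / (c ^+ 2 - e ^+ 2 * d)).
split; [apply: (KV) => //; apply: (KB); [exact: KM | apply: (KM) => //; exact: KM]
       |apply: (KV) => //; apply: (KB); exact: KM|].
move: N0; rewrite -wd => N0; field; rewrite y0 andbT.
by apply: contraNneq N0 => <-; apply/eqP; ring.
Qed.

Lemma adjoin_sqrt_quadratic : quadratic_extension K adjoin_sqrt.
Proof.
split; [exact: adjoin_sqrt_subfield | exact: adjoin_sqrt_base|].
exists (fun i : 'I_2 => if i == 0 then 1 else w); split.
- move=> i; case: ifP => _; last exact: adjoin_sqrt_gen.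
  by apply: adjoin_sqrt_base; exact: subfield1.
- move=> _ [a [b [Ka Kb ->]]]; exists (fun i : 'I_2 => if i == 0 then a else b).
  by split=> [i|]; [case: ifP | rewrite !big_ord_recl big_ord0 /= mulr1 addr0].
move=> c Kc; rewrite !big_ord_recl big_ord0 /= mulr1 addr0 => /sqrt_free[] // c0 c1 i.
by case: (unliftP ord0 i) => [k ->|-> //]; rewrite (ord1 k).
Qed.

End SquareRoot.

(** Let [x] be in [M] but not in [K]. The coordinates of 1 and [x] in the basis [e0], [e1] have
    nonzero determinant, since otherwise [x] would be a quotient of elements of [K]. Cramer's rule
    then puts [e0] and [e1] in [M]. *)
Lemma quadratic_intermediate (F : fieldType) (K M L : set F) :
  is_subfield K -> quadratic_extension K L -> is_subfield M -> K `<=` M -> M `<=` L ->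
  M = K \/ M = L.
Proof.
move=> Ks [Ls KL [b [bL bS _]]] Ms KM ML.
have [MK|] := pselect (M `<=` K); first by left; apply/seteqP.
move=> /existsNP[x /not_implyP[Mx nKx]]; right; apply/seteqP; split=> //.
pose e0 := b ord0; pose e1 := b (lift ord0 ord0).
have sp y : L y -> exists c0 c1, [/\ K c0, K c1 & y = c0 * e0 + c1 * e1].
  move=> /bS[c [Kc ->]]; exists (c ord0), (c (lift ord0 ord0)).
  by split=> //; rewrite !big_ord_recl big_ord0 addr0.
have [a0 [a1 [Ka0 Ka1 aE]]] := sp 1 (subfield1 Ls).
have [c0 [c1 [Kc0 Kc1 cE]]] := sp x (ML _ Mx).
have dt : a0 * c1 - a1 * c0 != 0.
  apply/eqP => h.
  have h1 : a1 * x = c1.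
    transitivity (c1 * 1 - (a0 * c1 - a1 * c0) * e0); last by rewrite h mul0r subr0 mulr1.
    by rewrite {1}aE cE; ring.
  have h0 : a0 * x = c0.
    transitivity (c0 * 1 + (a0 * c1 - a1 * c0) * e1); last by rewrite h mul0r addr0 mulr1.
    by rewrite {1}aE cE; ring.
  have [a10|a10] := eqVneq a1 0.
    have [a00|a00] := eqVneq a0 0.
      by move: aE; rewrite a00 a10 !mul0r addr0 => /eqP; rewrite oner_eq0.
    by apply: nKx; rewrite -(mulfK a00 x) [x * _]mulrC h0; exact: subfield_div.
  by apply: nKx; rewrite -(mulfK a10 x) [x * _]mulrC h1; exact: subfield_div.
have Kdt : K (a0 * c1 - a1 * c0) by apply: subfieldB => //; exact: subfieldM.
have M0 : M e0.
  have -> : e0 = (c1 - a1 * x) / (a0 * c1 - a1 * c0).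
    apply: (mulIf dt); rewrite divfK //.
    by transitivity (c1 * 1 - a1 * x); [rewrite aE cE; ring | rewrite mulr1].
  by apply: subfield_div; [|apply: subfieldB; [|exact: KM|apply: subfieldM]|exact: KM] => //; exact: KM.
have M1 : M e1.
  have -> : e1 = (a0 * x - c0) / (a0 * c1 - a1 * c0).
    apply: (mulIf dt); rewrite divfK //.
    by transitivity (a0 * x - c0 * 1); [rewrite aE cE; ring | rewrite mulr1].
  by apply: subfield_div; [|apply: subfieldB; [|apply: subfieldM|exact: KM]|exact: KM] => //; exact: KM.
move=> y /sp[d0 [d1 [Kd0 Kd1 ->]]].
by apply: subfieldD => //; apply: subfieldM => //; exact: KM.
Qed.

(** * Fields of definition and of parametrization *)

Lemma fracs1 (L : fieldType) (Z : L -> Prop) : Z 1 -> fracs Z 1.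
Proof. by move=> Z1; exists 1, 1; split=> //; rewrite ?oner_neq0 ?divr1. Qed.

Lemma fracsM (L : fieldType) (Z : L -> Prop) : (forall x y, Z x -> Z y -> Z (x * y)) ->
  forall x y, fracs Z x -> fracs Z y -> fracs Z (x * y).
Proof.
move=> ZM _ _ [a [b [Za Zb b0 ->]]] [c [d [Zc Zd d0 ->]]]; exists (a * c), (b * d).
by split; [exact: ZM|exact: ZM|exact: mulf_neq0|exact: mulf_div].
Qed.

Section FieldsOfDefinition.
Variables (F : closedFieldType) (N : nat) (C : irreducible_curve F N).

Lemma field_of_definition_curve_defined (K : set F) (M : fieldType) (io : {rmorphism M -> F}) :
  (forall x, K x <-> exists m, io m = x) -> is_field_of_definition C K -> curve_defined io C.
Proof.
move=> ioP [_ [G [GK GI]]] p pC.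
have [n [c [g [gG ->]]]] : generated_ideal G p by rewrite -GI.
have lift i : exists h, map_mpoly io h = g i.
  apply: lift_mpoly => x xg; apply/ioP/set_mem.
  by have /allP := GK _ (gG i); exact.
have [h hE] := choice lift; exists n, c, h; split=> [i|].
  rewrite hE; suff : [set` curve_ideal C] (g i) by [].
  rewrite GI; exists 1, (fun=> 1), (fun=> g i); split=> //.
  by rewrite big_ord_recl big_ord0 mul1r addr0.
by apply: eq_bigr => i _; rewrite hE.
Qed.

Definition polys_over (M : fieldType) (io : {rmorphism M -> F}) : F(t) -> Prop :=
  fun z => exists P : {poly M}, z = (map_poly io P)%:F.

Lemma lam_polys_over (M : fieldType) (io : {rmorphism M -> F}) (lam : {additive F -> M}) :
  klinear io lam -> lam_family io (@cst F) lam (polys_over io).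
Proof.
move=> lamP n f b bZ; have [P PE] := choice bZ.
have E (g : 'I_n -> F) : \sum_i cst (g i) * b i = (\sum_i (g i)%:P * map_poly io (P i))%:F.
  by rewrite rmorph_sum; apply: eq_bigr => i _; rewrite PE /= tofracM.
rewrite !E => /eqP; rewrite tofrac_eq0 => /eqP e; apply/eqP; rewrite tofrac_eq0; apply/eqP.
apply/polyP => k; have := congr1 (fun q : {poly F} => io (lam q`_k)) e.
rewrite !coef_sum !coef0 !raddf0 => h; rewrite -[RHS]h !raddf_sum; apply: eq_bigr => i _.
by rewrite !coefCM !coef_map /= [f i * _]mulrC lamP rmorphM mulrC.
Qed.

Lemma map_mpoly_add_monomials (M : fieldType) (lam : {additive F -> M}) (p : {mpoly F[N]}) :
  map_mpoly lam p = \sum_(m <- msupp p) lam p@_m *: 'X_[m].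
Proof.
apply/mpolyP => m; rewrite mcoeff_map_mpoly {1}[p]mpolyE !raddf_sum /=.
by apply: eq_bigr => m' _; rewrite !mcoeffZ !mcoeffX; case: eqP => _; rewrite ?mulr1 ?mulr0 ?raddf0.
Qed.

(** The functionals are used here in the opposite direction to [lam_coord_field]: it is known that
    the coordinates, hence the values of all monomials, are quotients of polynomials over [M], and
    the stability of the ideal under [lam] is deduced from this. *)
Lemma param_lam_stable (M : fieldType) (io : {rmorphism M -> F}) (X : 'I_N -> F(t))
    (lam : {additive F -> M}) (p : {mpoly F[N]}) : klinear io lam ->
  (forall i, fracs (polys_over io) (X i)) ->
  ev (@cst F) X p = 0 -> ev (@cst F) X (map_mpoly io (map_mpoly lam p)) = 0.
Proof.
move=> lamP XM Xp.
have one : polys_over io 1 by exists 1; rewrite rmorph1 tofrac1.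
have mul x y : polys_over io x -> polys_over io y -> polys_over io (x * y).
  by move=> [P ->] [Q ->]; exists (P * Q); rewrite rmorphM tofracM.
have frac1 := fracs1 one.
have fracM := fracsM mul.
have monM m : fracs (polys_over io) (mmap1 X m).
  rewrite /mmap1; elim/big_ind: _ => // i _; elim: (m i) => [|n IH] //.
  by rewrite exprS; exact: fracM.
have evE (f : F -> F) :
    \sum_(i < size (msupp p)) cst (f p@_(nth 0%MM (msupp p) i)) * mmap1 X (nth 0%MM (msupp p) i) =
    \sum_(m <- msupp p) cst (f p@_m) * mmap1 X m.
  by rewrite (big_nth 0%MM) big_mkord.
have h := lam_family_fracs one mul (lam_polys_over lamP)
  (fun i : 'I_(size (msupp p)) => monM (nth 0%MM (msupp p) i)).
have {h} := h (fun i => p@_(nth 0%MM (msupp p) i)).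
rewrite (evE id) (evE (io \o lam)) => h; rewrite -[RHS](h Xp).
have -> : map_mpoly io (map_mpoly lam p) = map_mpoly (io \o lam) p.
  by apply/mpolyP => m; rewrite !mcoeff_map_mpoly.
rewrite map_mpoly_add_monomials rmorph_sum; apply: eq_bigr => m _ /=.
by rewrite evZ /ev mmapX.
Qed.

(* The ideal is stable under coefficientwise application of L-linear functionals F -> L;
   these produce elements with coefficients in L and a smaller difference with p. *)
Lemma parametrization_definition (L : set F) :
  is_field_of_parametrization C L -> is_field_of_definition C L.
Proof.
move=> [Ls [phi [psi [[phiK psiK phiC] XL _]]]]; split=> //.
have [M [io ioP]] := embedded_subfield Ls.
pose X i : F(t) := phi (curve_fun C 'X_i).
have phiE := @curve_fun_pi_ev _ _ _ X phi phiC (fun => erefl).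
have kerX p : p \in curve_ideal C <-> ev (@cst F) X p = 0.
  rewrite -phiE -curve_fun_eq0; split=> [->|h]; first exact: rmorph0.
  by apply: (can_inj phiK); rewrite h rmorph0.
have XM i : fracs (polys_over io) (X i).
  have [p [q [pL qL q0 XE]]] := XL i.
  have lift (r : {poly F}) : r \is a polyOver (mem L) -> exists r', map_poly io r' = r.
    move=> /allP rL; apply: lift_poly => x /rL xL; exact/ioP/set_mem.
  have [p' p'E] := lift p pL; have [q' q'E] := lift q qL.
  exists p%:F, q%:F; split; [by exists p'; rewrite p'E|by exists q'; rewrite q'E| |exact: XE].
  by rewrite tofrac_eq0.
exists [set g | g \is a mpolyOver N (mem L) /\ g \in curve_ideal C].
split; first by move=> g [].
apply/seteqP; split=> [p|p [n [c [g [gG ->]]]]]; last first.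
  by rewrite /= rpred_sum // => i _; have [_ gC] := gG i; exact: idealMr.
have [n] := ubnP (size (msupp p)); elim: n p => // n IH p; rewrite ltnS => sp pC.
have [->|p0] := eqVneq p 0.
  by exists 0%N, (fun=> 0), (fun=> 0); split=> [[]|] //; rewrite big_ord0.
have lc0 : mleadc p != 0 by rewrite mleadc_eq0.
have [lam [lamP lam1]] := klinear_ex io lc0.
pose g := map_mpoly io (map_mpoly lam p).
have gC : g \in curve_ideal C by apply/kerX; apply: param_lam_stable => //; exact/kerX.
have gL : g \is a mpolyOver N (mem L).
  by apply/allP => _ /mapP[m _ ->]; rewrite mcoeff_map_mpoly; apply/mem_set/ioP; eexists.
have qC : p - (mleadc p)%:MP * g \in curve_ideal C by rewrite rpredB // idealMr.
have [|k [c [h [hG qE]]]] := IH _ _ qC.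
  (* [lam] is 1 at the leading coefficient of [p], so the leading monomial cancels; a monomial
     absent from [p] is absent from [g], so no new one appears. *)
  apply: leq_trans sp; apply: (@leq_ltn_trans (size (rem (mlead p) (msupp p)))); last first.
    by rewrite size_rem ?mlead_supp // ltn_predL lt0n size_eq0 msupp_eq0.
  apply: uniq_leq_size => // m; rewrite (mem_rem_uniq _ (msupp_uniq p)) !inE !mcoeff_msupp.
  rewrite mcoeffB mcoeffCM !mcoeff_map_mpoly /=.
  have [->|_] /= := eqVneq m (mlead p); first by rewrite lam1 rmorph1 mulr1 subrr eqxx.
  by apply: contraNneq => ->; rewrite !raddf0 mulr0 subrr.
exists k.+1, (fun i => oapp c (mleadc p)%:MP (unlift ord0 i)), (fun i => oapp h g (unlift ord0 i)).
split=> [i|]; first by case: unliftP => [i' _|_] /=; [exact: hG | split].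
rewrite big_ord_recl unlift_none /=; under eq_bigr do rewrite liftK /=.
by rewrite -qE addrC subrK.
Qed.

End FieldsOfDefinition.

(** [K] is asked to lie in a finitely generated field, rather than to be one, so that the statement
    applies directly to the minimum field of definition. *)
Lemma infinitely_many_quadratic (F : closedFieldType) (N : nat) (C : irreducible_curve F N)
    (K : set F) (s : seq F) : [pchar F] =i pred0 -> K `<=` generated_subfield s ->
  rational_curve C -> is_field_of_definition C K ->
  infinite_set [set L | is_field_of_parametrization C L /\ quadratic_extension K L].
Proof.
move=> char0 Ks rat Kdef /finite_seqP[Ls LsE].
have Ksub : is_subfield K by case: Kdef.
have [M [io ioP]] := embedded_subfield Ksub.
have Cdef := field_of_definition_curve_defined ioP Kdef.
have [X [x [y [al [ga [pX al0 ga0 con]]]]]] := conic_model_ex char0 Cdef rat.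
(* For [L] quadratic over [K], [e] lists a basis; the empty list is a dummy value for the other
   sets. *)
have genP L : exists e : seq F, quadratic_extension K L ->
    forall z, L z -> generated_subfield (s ++ e) z.
  have [[_ _ [b [_ bS _]]]|nq] := pselect (quadratic_extension K L); last by exists [::].
  exists (codom b) => _ z /bS[c [cK ->]] G Gs sG.
  have G0 := subfield0 Gs; have GD := subfieldD Gs; have GM := subfieldM Gs.
  apply: (@big_ind _ G) => [|u v Gu Gv|i _]; [exact: G0 | exact: GD|].
  apply: (GM); last first.
    by apply/set_mem/sG; rewrite mem_cat codom_f orbT.
  by apply: (Ks _ (cK i)) => // u us; apply: sG; rewrite mem_cat us.
have [e eP] := choice genP.
(* All quadratic extensions of [K] in the supposed finite list [Ls] lie in the field generated by
   [S], so a square root outside that field yields one that is missing. *)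
pose S := s ++ flatten [seq e L | L <- Ls].
have [||k kP] := @nonsquare_value F S (io al) (io ga) char0; rewrite ?fmorph_eq0 //.
have [w] := @solve_monicpoly F 2 (fun i => if i == 0%N then io al * k%:~R ^+ 2 + io ga else 0) isT.
rewrite !big_ord_recl big_ord0 /= mul0r !addr0 expr0 mulr1 => wE.
have nS := kP w wE.
have SG z (s' : seq F) : {subset s' <= S} -> generated_subfield s' z -> generated_subfield S z.
  by move=> sS h G Gs SG; apply: h => // u /sS; exact: SG.
have Kw : ~ K w.
  by move=> /Ks h; apply: nS; apply: SG h => u us; rewrite mem_cat us.
have dE : io (al * k%:~R ^+ 2 + ga) = w ^+ 2.
  by rewrite rmorphD rmorphM rmorphXn rmorph_int -wE.
have Kd : K (io (al * k%:~R ^+ 2 + ga)) by apply/ioP; eexists.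
pose L := adjoin_sqrt K w.
have Lq : quadratic_extension K L := adjoin_sqrt_quadratic Ksub (esym dE) Kd Kw.
have [Lsub KL _] := Lq; have [Lt [il ilP]] := embedded_subfield Lsub.
have [j ilj] : exists j : {rmorphism M -> Lt}, forall a, il (j a) = io a.
  by apply: inclusion_ex => a; apply/ilP/KL/ioP; exists a.
have Lw : L w := adjoin_sqrt_gen w Ksub.
have Lp := point_parametrization Cdef ilj Lsub ilP pX con dE Lw.
have LLs : L \in Ls by have : [set` Ls] L by rewrite -LsE.
apply: nS; apply: SG (eP L Lq w Lw) => u; rewrite !mem_cat => /orP[->//|ue].
by apply/orP; right; apply/flattenP; exists (e L) => //; exact: map_f.
Qed.

Theorem corollary2p9 (F : closedFieldType) (N : nat) (K : set F)
    (C : irreducible_curve F N)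
    (charF0 : [pchar F] =i pred0)
    (K_subfield : is_subfield K)
    (K_fg : finitely_generated_over_Q K)
    (F_algebraic : forall x : F, algebraic_over K x)
    (C_rational : rational_curve C)
    (K_def : is_field_of_definition C K) :
  (~ is_field_of_parametrization C K ->
     infinite_set [set L : set F | is_field_of_parametrization C L /\
                                   quadratic_extension K L]) /\
  (forall k : set F, is_minimum_field_of_definition C k ->
     ~ is_field_of_parametrization C k ->
     infinite_set [set L : set F | is_minimal_field_of_parametrization C L /\
                                   quadratic_extension k L]).
Proof.
have [s Ks] := K_fg.
split=> [_|k [k_def k_min] k_param].
  by apply: (infinitely_many_quadratic (s := s)) => //; rewrite Ks.
have k_s : k `<=` generated_subfield s by rewrite -Ks; exact: k_min.
have := infinitely_many_quadratic charF0 k_s C_rational k_def.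
(* It is enough that each field of parametrization quadratic over [k] is minimal: finiteness of the
   set of minimal ones would then make the larger-looking set finite. *)
apply: contra_not; apply: sub_finite_set => L [L_param L_quad]; split=> //.
split=> // L' L'_param L'L.
have k_L' := k_min _ (parametrization_definition L'_param).
have [|//] := quadratic_intermediate k_def.1 L_quad L'_param.1 k_L' L'L.
by move=> L'k; move: L'_param; rewrite L'k.
Qed.
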